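(* Let $L>0$ and $T=nL$ for some $n\in\mathbb{N}$. Let $\{\Sigma_h\}_h$ be a family of $\mathcal{S}^1_{0,}(\Sigma_h)$-admissible meshes of $\Sigma$, with $H^1$-stability constant independent of $h$, each satisfying the time-slice matching condition. Let $z\in H^s_{0,}(\Sigma)$, for $s\in[1/2,2]$, denote the exact solution of $(-\frac12\mathsf{Id}+\mathsf{K})z=g$, and let $z_h^1\in\mathcal{S}^1_{0,}(\Sigma_h)$ be the Galerkin solution, i.e. the solution of $$\left\langle\left(-\tfrac12\mathsf{Id}+\mathsf{K}\right)z_h^1,v_h\right\rangle_\Sigma=\langle g,v_h\rangle_\Sigma\quad\text{for all }v_h\in\mathcal{S}^1_{0,}(\Sigma_h).$$ Then the a priori error estimate $$\|z-z_h^1\|_{H^{1/2}_{0,}(\Sigma)}\le\tilde c\,h^{s-1/2}\,\|z\|_{H^s(\Sigma)}$$ holds for a positive constant $\tilde c$ independent of $h$.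
   Context: Spaces. $\Gamma=\{0,L\}$, $\Sigma=\Gamma\times[0,T]$. A function on $\Sigma$ is a pair $v=(v_0,v_L)=(v(0,\cdot),v(L,\cdot))$ of functions on $(0,T)$; $L^2(\Sigma)=L^2(0,T)\times L^2(0,T)$ and $H^s(\Sigma)=H^s(0,T)\times H^s(0,T)$ is the standard Sobolev space with its product norm $\|\cdot\|_{H^s(\Sigma)}$. $H^1_{0,}(\Sigma)=\{v: v_0,v_L\in H^1(0,T),\ v_0(0)=v_L(0)=0\}$ with norm $\|\partial_t v\|_{L^2(\Sigma)}$. For $s\in(0,1)$, $H^s_{0,}(\Sigma)$ is the Hilbert interpolation space of order $s$ between $L^2(\Sigma)$ (order $0$) and $H^1_{0,}(\Sigma)$ (order $1$), with the interpolation norm; in particular $H^{1/2}_{0,}(\Sigma)=[H^1_{0,}(\Sigma),L^2(\Sigma)]_{1/2}$. For $s\in(1,2]$, $H^s_{0,}(\Sigma)=H^s(\Sigma)\cap H^1_{0,}(\Sigma)$. $\langle\cdot,\cdot\rangle_\Sigma$ is the duality pairing extending the $L^2(\Sigma)$ inner product. The datum $g$ is in $H^{1/2}_{0,}(\Sigma)$. Operator. $\mathsf{Id}$ is the identity and $\mathsf{K}$ is the double layer operator of the one-dimensional wave equation: $\mathsf{K}v(0,t)=-\tfrac12 v(L,t-L)$, $\mathsf{K}v(L,t)=-\tfrac12 v(0,t-L)$, where functions on $\Sigma$ are extended by zero to times $t\le0$. Meshes. A mesh $\Sigma_h=\Sigma_h^0\cup\Sigma_h^L$ of $\Sigma$ with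 maximal meshwidth $h$ consists of a partition $\Sigma_h^0$ of $\{0\}\times(0,T)$ and a partition $\Sigma_h^L$ of $\{L\}\times(0,T)$ into finitely many non-overlapping intervals. $\mathcal{S}^1_{0,}(\Sigma_h)\subset H^1_{0,}(\Sigma)$ is the space of functions that are, on each of the two boundary components, continuous and piecewise linear with respect to the mesh, and vanish at $t=0$. Admissibility. $\Sigma_h$ is $\mathcal{S}^1_{0,}(\Sigma_h)$-admissible if the $L^2(\Sigma)$-orthogonal projection $Q_h^0$ onto $\mathcal{S}^1_{0,}(\Sigma_h)$ is $H^1$-stable, i.e. $\|Q^0_hw\|_{H^1_{0,}(\Sigma)}\le c_{s,1}\|w\|_{H^1_{0,}(\Sigma)}$ for all $w\in H^1_{0,}(\Sigma)$, with a constant $c_{s,1}$ (the $H^1$-stability constant). Time-slice matching condition. With $T=nL$ and time slices $T_j:=((j-1)L,jL)$, $j=1,\dots,n$, each slice on each boundary component is a union of mesh elements (up to endpoints), and, identifying meshes on $T_j$ and $T_{j+1}$ via the time translation $t\mapsto t+L$, one has $\Sigma^0_{h|T_j}=\Sigma^L_{h|T_{j+1}}$ and $\Sigma^L_{h|T_j}=\Sigma^0_{h|T_{j+1}}$ for all $j=1,\dots,n-1$.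
   Formalization: At s=1/2 no constant independent of h and z exists with the H^{1/2}(Σ) norm on the right; there the uniform estimate uses the H^{1/2}_{0,}(Σ) norm of z instead, and the estimate with the H^{1/2}(Σ) norm is given with a constant independent of h but depending on z. *)

(* Defs.v *)
From HB Require Import structures.
From mathcomp Require Import all_boot all_order all_algebra.
From mathcomp Require Import all_classical all_reals all_analysis.

Set Implicit Arguments.
Unset Strict Implicit.
Unset Printing Implicit Defensive.

Import Order.TTheory GRing.Theory Num.Theory.
Import numFieldNormedType.Exports.

Local Open Scope classical_set_scope.
Local Open Scope ring_scope.

(* A function on Sigma = {0, L} x (0, T) is a pair (v_0, v_L) of functions
   R -> R of which only the values on (0, T) matter.
   Norms are valued in \bar R. *)

Section SobolevInterval.
Variables (R : realType) (T : R).
Implicit Types f g phi : R -> R.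

Definition itvT : set R := `]0, T[%classic.

Definition l2normsq f : \bar R := \int[lebesgue_measure]_(x in itvT) ((f x) ^+ 2)%:E.

Definition inL2 f : Prop := measurable_fun itvT f /\ (l2normsq f < +oo)%E.

(* C^1_c(0, T) *)
Definition test_function phi : Prop :=
  [/\ forall x, derivable phi x 1, continuous (derive1 phi)
    & exists a b, [/\ 0 < a, b < T & forall x, x \notin `[a, b] -> phi x = 0]].

Definition is_weak_derivative f g : Prop :=
  [/\ inL2 f, inL2 g & forall phi, test_function phi ->
      \int[lebesgue_measure]_(x in itvT) (f x * derive1 phi x) =
      - \int[lebesgue_measure]_(x in itvT) (g x * phi x)].

(* A representative of the weak derivative, or 0 if f is not in H^1(0, T). *)
Definition weak_derivative f : R -> R := xget (fun=> 0) (is_weak_derivative f).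

Definition inH1 f : Prop := exists g, is_weak_derivative f g.

(* The square of the Sobolev-Slobodeckij seminorm of order theta in (0, 1). *)
Definition slobodeckij_sq (theta : R) f : \bar R :=
  \int[lebesgue_measure]_(x in itvT) \int[lebesgue_measure]_(y in itvT)
    (`|f x - f y| ^+ 2 / `|x - y| `^ (1 + 2 * theta))%:E.

(* H^s(0, T), s >= 0, with s = m + theta, m integer and 0 <= theta < 1. *)
Definition inHs (s : R) f : Prop :=
  let m := Num.truncn s in
  let theta := s - m%:R in
  [/\ inL2 f, forall k, (k < m)%N -> inH1 (iter k weak_derivative f)
    & 0 < theta -> (slobodeckij_sq theta (iter m weak_derivative f) < +oo)%E].

Definition hs_normsq (s : R) f : \bar R :=
  let m := Num.truncn s in
  let theta := s - m%:R in
  (\sum_(k < m.+1) l2normsq (iter k weak_derivative f) +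
   (if (0 < theta)%R then slobodeckij_sq theta (iter m weak_derivative f)
    else 0))%E.

(* f in H^1(0, T) and f(0) = 0, the value at 0 being that of the continuous
   representative. *)
Definition inH10 f : Prop :=
  inH1 f /\
  exists fc, [/\ {within `[0, T], continuous fc},
    ae_eq lebesgue_measure itvT fc f & fc 0 = 0].

End SobolevInterval.

Section SobolevSigma.
Variables (R : realType) (T : R).
Implicit Types u v w : (R -> R) * (R -> R).

Definition inL2S v : Prop := inL2 T v.1 /\ inL2 T v.2.

Definition l2normsqS v : \bar R := (l2normsq T v.1 + l2normsq T v.2)%E.

(* On L^2(Sigma) the duality pairing is the L^2 inner product. *)
Definition pairing u v : R :=
  \int[lebesgue_measure]_(x in itvT T) (u.1 x * v.1 x) +
  \int[lebesgue_measure]_(x in itvT T) (u.2 x * v.2 x).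

Definition ae_eqS u v : Prop :=
  ae_eq lebesgue_measure (itvT T) u.1 v.1 /\
  ae_eq lebesgue_measure (itvT T) u.2 v.2.

Definition inHsS (s : R) v : Prop := inHs T s v.1 /\ inHs T s v.2.

Definition hs_normS (s : R) v : \bar R :=
  sqrte (hs_normsq T s v.1 + hs_normsq T s v.2)%E.

Definition inH10S v : Prop := inH10 T v.1 /\ inH10 T v.2.

Definition h10_normsqS v : \bar R :=
  l2normsqS (weak_derivative T v.1, weak_derivative T v.2).

Definition h10_normS v : \bar R := sqrte (h10_normsqS v).

(* The K-method for the Hilbert couple (L^2(Sigma), H^1_{0,}(Sigma)), with the
   quadratic K-functional; K_sq tau v is the square of K(tau, v). *)
Definition K_sq (tau : R) v : \bar R :=
  ereal_inf [set (l2normsqS (v - w)%R + (tau ^+ 2)%:E * h10_normsqS w)%E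
            | w in [set w | inH10S w]].

(* The factor 2 sin(pi s) / pi makes the norm exact: since
   \int_0^oo t^(1-2s) l^2 / (1 + t^2 l^2) dt = l^(2s) pi / (2 sin(pi s)), it is
   the norm given by the power s of the positive self-adjoint operator
   associated with the couple. *)
Definition interp_norm (s : R) v : \bar R :=
  sqrte ((2 * sin (pi * s) / pi)%:E *
    \int[lebesgue_measure]_(tau in `]0%R, +oo[)
      ((tau `^ (- (2 * s) - 1))%:E * K_sq tau v))%E.

(* H^s_{0,}(Sigma) for 0 < s <= 2 *)
Definition inHs0S (s : R) v : Prop :=
  if s < 1 then inL2S v /\ (interp_norm s v < +oo)%E
  else inHsS s v /\ inH10S v.

End SobolevSigma.

Section Operator.
Variables (R : realType) (L : R).

Definition zero_ext (f : R -> R) (t : R) : R := if 0 < t then f t else 0.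

Definition double_layer (v : (R -> R) * (R -> R)) : (R -> R) * (R -> R) :=
  (fun t => - 2^-1 * zero_ext v.2 (t - L),
   fun t => - 2^-1 * zero_ext v.1 (t - L)).

(* - 1/2 Id + K *)
Definition bie_op (v : (R -> R) * (R -> R)) : (R -> R) * (R -> R) :=
  (fun t => - 2^-1 * v.1 t, fun t => - 2^-1 * v.2 t) + double_layer v.

End Operator.

Section Meshes.
Variables (R : realType) (T : R).

(* A partition 0 = t_0 < t_1 < ... < t_N = T is given by [:: t_1; ...; t_N],
   as in itv_partition; a mesh of Sigma is a pair of partitions. *)
Definition is_mesh (m : seq R * seq R) : Prop :=
  itv_partition 0 T m.1 /\ itv_partition 0 T m.2.

Definition elements (p : seq R) : seq (R * R) := zip (0 :: p) p.

Definition meshwidth (m : seq R * seq R) : R :=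
  \big[Num.max/0]_(e <- elements m.1 ++ elements m.2) (e.2 - e.1).

Definition piecewise_linear (p : seq R) (f : R -> R) : Prop :=
  forall e, e \in elements p ->
    exists a b, forall t, t \in `]e.1, e.2[ -> f t = a * t + b.

Definition spline0 (p : seq R) (f : R -> R) : Prop :=
  [/\ {within `[0, T], continuous f}, piecewise_linear p f & f 0 = 0].

(* S^1_{0,}(Sigma_h) *)
Definition S10 (m : seq R * seq R) (v : (R -> R) * (R -> R)) : Prop :=
  spline0 m.1 v.1 /\ spline0 m.2 v.2.

(* q = Q_h^0 w *)
Definition is_L2_projection (m : seq R * seq R) (w q : (R -> R) * (R -> R)) :
    Prop :=
  S10 m q /\ forall vh, S10 m vh -> pairing T q vh = pairing T w vh.

Definition S10_admissible (c : R) (m : seq R * seq R) : Prop :=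
  forall w q, inH10S T w -> is_L2_projection m w q ->
    (h10_normS T q <= c%:E * h10_normS T w)%E.

End Meshes.

Section TimeSlices.
Variables (R : realType) (L : R).

(* the elements in the time slice T_j = ((j - 1) L, j L), j >= 1 *)
Definition slice_elements (p : seq R) (j : nat) : seq (R * R) :=
  [seq e <- elements p | (j.-1%:R * L <= e.1) && (e.2 <= j%:R * L)].

Definition slice_union (p : seq R) (j : nat) : Prop :=
  \bigcup_(e in [set` slice_elements p j]) `[e.1, e.2]%classic =
  `[j.-1%:R * L, j%:R * L]%classic.

Definition translate (es : seq (R * R)) : seq (R * R) :=
  [seq (e.1 + L, e.2 + L) | e <- es].

Definition time_slice_matching (n : nat) (m : seq R * seq R) : Prop :=
  (forall j, (1 <= j <= n)%N -> slice_union m.1 j /\ slice_union m.2 j) /\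
  (forall j, (1 <= j < n)%N ->
     translate (slice_elements m.1 j) = slice_elements m.2 j.+1 /\
     translate (slice_elements m.2 j) = slice_elements m.1 j.+1).

End TimeSlices.

Section Problem.
Variables (R : realType) (T L : R).

Definition exact_solution (s : R) (g z : (R -> R) * (R -> R)) : Prop :=
  [/\ inHs0S T 2^-1 g, inHs0S T s z & ae_eqS T (bie_op L z) g].

Definition galerkin_solution (m : seq R * seq R) (g zh : (R -> R) * (R -> R)) :
    Prop :=
  S10 T m zh /\
  forall vh, S10 T m vh -> pairing T (bie_op L zh) vh = pairing T g vh.

End Problem.

(* Main.v *)
Require Import Defs.
From HB Require Import structures.
From mathcomp Require Import all_boot all_order all_algebra.
From mathcomp Require Import all_classical all_reals all_analysis.
From mathcomp Require Import measurable_realfun.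
From mathcomp Require Import ring lra.

Set Implicit Arguments.
Unset Strict Implicit.
Unset Printing Implicit Defensive.

Import Order.TTheory GRing.Theory Num.Theory.
Import numFieldNormedType.Exports.

Local Open Scope classical_set_scope.
Local Open Scope ring_scope.

(** On (0, T) the operator is A = - 1/2 (Id + P), where P exchanges the two
    components and delays them by L. Three facts about P carry the proof. It is
    nilpotent, because T = n L, so that A is invertible on L^2. It commutes with
    the differentiation of functions that vanish at t = 0, so that everything
    proved for A in L^2 also holds in H^1_{0,}. And it maps the spline space to
    itself, because the time slices of the meshes match, so that A maps the
    spline space onto itself.

    Hence the Galerkin solution zh of A z = g is characterized by A zh = Q A z,
    with Q the L^2 projection onto the splines. The map from z to z - zh is thus
    linear, bounded on L^2 because Q is a projection [galerkin_error_l2], and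
    bounded on H^1_{0,} because Q is H^1-stable [galerkin_error_h10]. As splines
    are their own Galerkin solutions, comparison with the piecewise linear
    interpolant adds first order convergence in L^2 for data in H^1_{0,}
    [galerkin_error_first_order].

    The H^{1/2}_{0,} norm of the error is, up to a constant, the integral of
    t^(-2) K(t, z - zh)^2 over t > 0, with K the K-functional. Splitting
    z = (z - w) + w with w in H^1_{0,} gives, for all such w and all t > 0,
      K(t, z - zh)^2 <= M (|z - w|^2 + t^2 |w'|^2),
      |z - zh|^2 <= M (|z - w|^2 + h^2 |w'|^2),
    where K(t, z - zh) <= |z - zh| and |.| is the norm of L^2
    [K_sq_galerkin_error, l2_galerkin_error]. The choice of w depends on s.

    - For s = 1/2 the infimum over w bounds K(t, z - zh)^2 by M K(t, z)^2.
    - For 1/2 < s < 1, w is the mean of z, extended by zero, over the window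
      (x - t, x), with t itself as the length for t < h and any length in
      [h/2, h) for larger t. Both terms are then controlled by the L^2 modulus of
      continuity of the extension, whose weighted integral is at most the squared
      Slobodeckij seminorm of z plus 1/(2s) times the integral of z^2 / x^(2s)
      [modulus_integral_le]. The latter is bounded by the seminorm too
      [hardy_inequality], by an absorption argument which needs that it is
      finite: this is where the interpolation norm of z, hence the vanishing of
      z at t = 0, is used [sqint_near0_K_sq].
    - For 1 <= s <= 2 a spline is first subtracted from z, zero if s = 1 and the
      interpolant otherwise; the derivative of the remainder has L^2 norm
      O(h^(s - 1)), and w is the whole remainder.

    At s = 1/2 the second form of the estimate follows from the first, with the
    ratio of the two norms of z in the constant; if the norm of H^{1/2} vanishes
    then so does z, and if it is infinite there is nothing to prove. *)

Notation mu := lebesgue_measure.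

(** * Integrals and square integrals *)

Section GeneralIntegral.
Context {R : realType}.
Local Open Scope ereal_scope.

Import HBNNSimple.

(** The integral is the supremum over the simple functions below, hence monotone
    for arbitrary nonnegative functions, measurable or not. *)
Lemma ge0_le_integral_nonmeas d (X : measurableType d)
    (m : {measure set X -> \bar R}) (D : set X) (f g : X -> \bar R) :
  (forall x, D x -> 0 <= f x) -> (forall x, D x -> f x <= g x) ->
  \int[m]_(x in D) f x <= \int[m]_(x in D) g x.
Proof.
move=> f0 fg.
have h0 x : 0 <= (f \_ D) x by exact: erestrict_ge0.
have k0 x : 0 <= (g \_ D) x.
  by apply: erestrict_ge0 => y Dy; exact: le_trans (f0 _ Dy) (fg _ Dy).
rewrite !(integral_mkcond D) !ge0_integralTE//.
apply: ereal_sup_le => _ [h hf <-]; exists h => //= x.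
apply: (le_trans (hf x)); rewrite !patchE; case: ifPn => // xD.
by apply: fg; exact: set_mem.
Qed.

(** Tonelli's theorem for restricted domains, by extending the integrand by zero. *)
Lemma tonelli_set d1 d2 (X : measurableType d1) (Y : measurableType d2)
    (m1 : {sigma_finite_measure set X -> \bar R})
    (m2 : {sigma_finite_measure set Y -> \bar R})
    (A : set X) (B : set Y) (f : X -> Y -> \bar R) :
  measurable A -> measurable B ->
  measurable_fun (A `*` B) (fun z => f z.1 z.2) ->
  (forall x y, A x -> B y -> 0 <= f x y) ->
  \int[m1]_(x in A) \int[m2]_(y in B) f x y =
  \int[m2]_(y in B) \int[m1]_(x in A) f x y.
Proof.
move=> mA mB mf f0.
have mAB : measurable (A `*` B) by exact: measurableX.
pose F := (fun z : X * Y => f z.1 z.2) \_ (A `*` B).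
have mF : measurable_fun setT F by exact/(measurable_restrictT _ mAB).
have F0 z : 0 <= F z by apply: erestrict_ge0 => -[x y] [/= Ax By]; exact: f0.
have := @fubini_tonelli _ _ _ _ _ m1 m2 F mF F0.
have EL : \int[m1]_x \int[m2]_y F (x, y) = \int[m1]_(x in A) \int[m2]_(y in B) f x y.
  rewrite [RHS]integral_mkcond; apply: eq_integral => x _.
  rewrite patchE; case: ifPn => xA.
    rewrite [RHS]integral_mkcond; apply: eq_integral => y _.
    by rewrite /F !patchE in_setX xA.
  apply: integral0_eq => y _; by rewrite /F patchE in_setX (negbTE xA).
have ER : \int[m2]_y \int[m1]_x F (x, y) = \int[m2]_(y in B) \int[m1]_(x in A) f x y.
  rewrite [RHS]integral_mkcond; apply: eq_integral => y _.
  rewrite patchE; case: ifPn => yB.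
    rewrite [RHS]integral_mkcond; apply: eq_integral => x _.
    by rewrite /F !patchE in_setX yB andbT.
  apply: integral0_eq => x _; by rewrite /F patchE in_setX (negbTE yB) andbF.
by rewrite EL ER.
Qed.

Lemma measurable_fun_tonelli d1 d2 (X : measurableType d1) (Y : measurableType d2)
    (m2 : {sigma_finite_measure set Y -> \bar R})
    (A : set X) (B : set Y) (f : X -> Y -> \bar R) :
  measurable A -> measurable B ->
  measurable_fun (A `*` B) (fun z => f z.1 z.2) ->
  (forall x y, A x -> B y -> 0 <= f x y) ->
  measurable_fun A (fun x => \int[m2]_(y in B) f x y).
Proof.
move=> mA mB mf f0.
have mAB : measurable (A `*` B) by exact: measurableX.
pose F := (fun z : X * Y => f z.1 z.2) \_ (A `*` B).
have mF : measurable_fun setT F by exact/(measurable_restrictT _ mAB).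
have F0 z : 0 <= F z by apply: erestrict_ge0 => -[x y] [/= Ax By]; exact: f0.
apply: (eq_measurable_fun (fubini_F m2 F)); last first.
  by apply: measurable_funTS; exact: measurable_fun_fubini_tonelli_F.
move=> x xA; rewrite [RHS]integral_mkcond /fubini_F; apply: eq_integral => y _.
by rewrite /F !patchE in_setX xA.
Qed.

(** Translation preserves the length of half-open intervals, which determines the
    measure. *)
Lemma lebesgue_measure_shift (a : R) (A : set R) : measurable A ->
  pushforward mu ((fun x : R => (x + a)%R) : measurableTypeR R -> measurableTypeR R) A = mu A.
Proof.
move=> mA; apply/esym/lebesgue_measure_unique => //.
  by apply: measurable_funD; [exact: measurable_id|exact: measurable_cst].
move=> mf _ [[b c] /= _ <-].
rewrite /pushforward.
rewrite (_ : _ @^-1` _ = `](b - a)%R, (c - a)%R]%classic); last first.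
  apply/seteqP; split => x /=; rewrite !in_itv/= ltrBlDr lerBrDr; exact.
rewrite !lebesgue_measure_itv/= !lte_fin ltrD2r.
by case: ifP => // _; rewrite -!EFinB; congr (_%:E); lra.
Qed.

Lemma ge0_integral_shift (a : R) (D : set R) (f : R -> \bar R) :
  measurable D -> measurable_fun D f -> (forall x, D x -> 0 <= f x) ->
  \int[mu]_(x in (fun x => x + a)%R @^-1` D) f (x + a)%R = \int[mu]_(x in D) f x.
Proof.
move=> mD mf f0.
have ms : measurable_fun setT ((fun x : R => (x + a)%R) : measurableTypeR R -> measurableTypeR R).
  by apply: measurable_funD; [exact: measurable_id|exact: measurable_cst].
have := @ge0_integral_pushforward _ _ _ _ _ _ ms mu D f mD mf.
rewrite /comp => <-; last by move=> x /set_mem /f0.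
by apply: eq_measure_integral => A mA _; exact: lebesgue_measure_shift.
Qed.

Lemma integral_shift (a : R) (D : set R) (f : R -> R) :
  measurable D -> mu.-integrable D (EFin \o f) ->
  mu.-integrable ((fun x => x + a)%R @^-1` D) (EFin \o (fun x => f (x + a)%R)) /\
  (\int[mu]_(x in (fun x => x + a) @^-1` D) f (x + a) = \int[mu]_(x in D) f x)%R.
Proof.
move=> mD intf.
have ms : measurable_fun setT ((fun x : R => (x + a)%R) : measurableTypeR R -> measurableTypeR R).
  by apply: measurable_funD; [exact: measurable_id|exact: measurable_cst].
have mD' : measurable ((fun x => x + a)%R @^-1` D).
  by rewrite -[X in measurable X]setTI; exact: ms.
pose g := f \_ D.
have mf : measurable_fun D f by have /measurable_int/measurable_EFinP := intf.
have mg : measurable_fun setT g by exact/(measurable_restrictT _ mD).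
have mfa : measurable_fun ((fun x => x + a)%R @^-1` D) (fun x => f (x + a)%R).
  apply: (measurable_comp mD) => //.
    by move=> _ [x xD <-].
  by apply: measurable_funTS.
have inta : mu.-integrable ((fun x => x + a)%R @^-1` D) (EFin \o (fun x => f (x + a)%R)).
  apply/integrableP; split; first exact/measurable_EFinP.
  rewrite (@ge0_integral_shift a D (fun x => `|(f x)%:E|)) //; last first.
    by do 2 apply: measurableT_comp => //.
  by case/integrableP : intf.
split => //; rewrite /Rintegral; congr fine.
pose G := EFin \o g.
have mG : measurable_fun setT G by exact/measurable_EFinP.
have intG : mu.-integrable ((fun x => x + a)%R @^-1` D) (G \o (fun x => (x + a)%R)).
  apply: eq_integrable inta => // x xD.
  by rewrite /G /g /= patchE mem_set //; exact: set_mem xD.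
transitivity (\int[mu]_(x in (fun x => x + a)%R @^-1` D) (G \o (fun x => (x + a)%R)) x).
  apply: eq_integral => x xD.
  by rewrite /G /g /= patchE mem_set//; exact: set_mem xD.
transitivity (\int[mu]_(x in D) G x); last first.
  by apply: eq_integral => x xD; rewrite /G /g /= patchE xD.
rewrite -(integral_pushforward ms mG intG mD).
by apply: eq_measure_integral => A mA _; exact: lebesgue_measure_shift.
Qed.

Lemma integrable_subR (D : set R) (f g : R -> R) : measurable D ->
  mu.-integrable D (EFin \o f) -> mu.-integrable D (EFin \o g) ->
  mu.-integrable D (EFin \o (fun x => f x - g x)%R).
Proof.
move=> mD If Ig; have := integrableB (mu:=mu) mD If Ig.
by apply: eq_integrable => // x _ /=; rewrite EFinB.
Qed.

Lemma integrable_scaleR (D : set R) (a : R) (f : R -> R) : measurable D ->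
  mu.-integrable D (EFin \o f) ->
  mu.-integrable D (EFin \o (fun x => a * f x)%R).
Proof.
move=> mD If; have := integrableZl (mu:=mu) mD a If.
by apply: eq_integrable => // x _ /=; rewrite EFinM.
Qed.
Lemma measurable_fun_comp_diff (f : R -> R) : measurable_fun setT f ->
  measurable_fun setT (fun z : measurableTypeR R * measurableTypeR R => f (z.1 - z.2)%R).
Proof.
move=> mf; have m1 := @measurable_fst _ _ (measurableTypeR R) (measurableTypeR R).
have m2 := @measurable_snd _ _ (measurableTypeR R) (measurableTypeR R).
have mB : measurable_fun setT (fun z : measurableTypeR R * measurableTypeR R => (z.1 - z.2)%R).
  exact: measurable_funB.
have mc := measurableT_comp mf mB; exact mc.
Qed.

End GeneralIntegral.

Section SquareIntegral.
Context {R : realType}.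
Implicit Types (D : set R) (f g h : R -> R).

Definition sqint D f : \bar R := (\int[mu]_(x in D) ((f x) ^+ 2)%:E)%E.

Lemma sqint_ge0 D f : (0 <= sqint D f)%E.
Proof. by apply: integral_ge0 => x _; rewrite lee_fin sqr_ge0. Qed.

Lemma measurable_sqr D f : measurable_fun D f ->
  measurable_fun D (fun x => ((f x) ^+ 2)%:E).
Proof. by move=> mf; apply/measurable_EFinP; exact: measurable_funX. Qed.

Lemma eq_sqint D f g : {in D, f =1 g} -> sqint D f = sqint D g.
Proof. by move=> fg; apply: eq_integral => x /fg ->. Qed.

Lemma sqintZ D (a : R) f : measurable D -> measurable_fun D f ->
  sqint D (fun x => a * f x) = ((a ^+ 2)%:E * sqint D f)%E.
Proof.
move=> mD mf; rewrite /sqint -ge0_integralZl_EFin ?sqr_ge0//.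
- by apply: eq_integral => x _; rewrite -EFinM exprMn.
- by move=> x _; rewrite lee_fin sqr_ge0.
- exact: measurable_sqr.
Qed.

Lemma sqint_le D f g : (forall x, D x -> (f x) ^+ 2 <= (g x) ^+ 2) ->
  (sqint D f <= sqint D g)%E.
Proof.
move=> fg; apply: ge0_le_integral_nonmeas => x Dx; rewrite lee_fin ?sqr_ge0//.
exact: fg.
Qed.

Lemma sqint_le2 D (a b : R) f g h : measurable D ->
  measurable_fun D f -> measurable_fun D g -> 0 <= a -> 0 <= b ->
  (forall x, D x -> (h x) ^+ 2 <= a * (f x) ^+ 2 + b * (g x) ^+ 2) ->
  (sqint D h <= a%:E * sqint D f + b%:E * sqint D g)%E.
Proof.
move=> mD mf mg a0 b0 hfg; rewrite /sqint.
rewrite -!ge0_integralZl_EFin//; try (by move=> x _; rewrite lee_fin sqr_ge0);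
  try exact: measurable_sqr.
rewrite -ge0_integralD//=; last 4 first.
- by move=> x _; rewrite -EFinM lee_fin mulr_ge0 ?sqr_ge0.
- by apply: measurable_funeM; exact: measurable_sqr.
- by move=> x _; rewrite -EFinM lee_fin mulr_ge0 ?sqr_ge0.
- by apply: measurable_funeM; exact: measurable_sqr.
apply: ge0_le_integral_nonmeas => x Dx; first by rewrite lee_fin sqr_ge0.
by rewrite -!EFinM -EFinD lee_fin hfg.
Qed.

Lemma sqintD_le D f g : measurable D ->
  measurable_fun D f -> measurable_fun D g ->
  (sqint D (fun x => f x + g x)%R <= 2%:E * sqint D f + 2%:E * sqint D g)%E.
Proof.
move=> mD mf mg; apply: sqint_le2 => // x Dx /=.
by rewrite -subr_ge0; have := sqr_ge0 (f x - g x); lra.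
Qed.

Lemma sqintB_le D f g : measurable D ->
  measurable_fun D f -> measurable_fun D g ->
  (sqint D (fun x => f x - g x)%R <= 2%:E * sqint D f + 2%:E * sqint D g)%E.
Proof.
move=> mD mf mg; apply: sqint_le2 => // x Dx /=.
by rewrite -subr_ge0; have := sqr_ge0 (f x + g x); lra.
Qed.

Lemma sqint_subset D D' f : measurable D -> measurable D' ->
  measurable_fun D' f -> D `<=` D' -> (sqint D f <= sqint D' f)%E.
Proof.
move=> mD mD' mf DD'; apply: ge0_subset_integral => //.
- exact: measurable_sqr.
- by move=> x _; rewrite lee_fin sqr_ge0.
Qed.

Lemma ae_eq_sqint D f g : measurable D -> measurable_fun D f ->
  measurable_fun D g -> ae_eq mu D f g -> sqint D f = sqint D g.
Proof.
move=> mD mf mg fg; apply: ge0_ae_eq_integral => //; try exact: measurable_sqr.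
- by move=> x _; rewrite lee_fin sqr_ge0.
- by move=> x _; rewrite lee_fin sqr_ge0.
- by apply: filterS fg => x /[apply] ->.
Qed.

Definition sqintegrable D f := measurable_fun D f /\ (sqint D f < +oo)%E.

Lemma sqintegrable_integrableM D f g : measurable D ->
  sqintegrable D f -> sqintegrable D g ->
  mu.-integrable D (EFin \o (fun x => f x * g x)).
Proof.
move=> mD [mf f2] [mg g2]; apply/integrableP; split.
  by apply/measurable_EFinP; exact: measurable_funM.
apply: (@le_lt_trans _ _ (sqint D f + sqint D g)%E); last exact: lte_add_pinfty.
rewrite /sqint -ge0_integralD//=; try (by move=> x _; rewrite lee_fin sqr_ge0);
  try exact: measurable_sqr.
apply: ge0_le_integral_nonmeas => x Dx //.
rewrite -EFinD lee_fin normrM -(real_normK (num_real (f x))) -(real_normK (num_real (g x))).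
have := sqr_ge0 (`|f x| - `|g x|); have := sqr_ge0 (`|f x| + `|g x|); lra.
Qed.

Lemma sqint_fin_num D f : sqintegrable D f -> sqint D f \is a fin_num.
Proof. by move=> [_ f2]; rewrite ge0_fin_numE ?sqint_ge0. Qed.

Lemma sqintegrableZ D (a : R) f : measurable D -> sqintegrable D f ->
  sqintegrable D (fun x => a * f x).
Proof.
move=> mD [mf f2]; split; first exact: measurable_funM.
rewrite sqintZ//; apply: lte_mul_pinfty => //; rewrite lee_fin; exact: sqr_ge0.
Qed.

Lemma sqintegrableD D f g : measurable D -> sqintegrable D f ->
  sqintegrable D g -> sqintegrable D (fun x => f x + g x).
Proof.
move=> mD [mf f2] [mg g2]; split; first exact: measurable_funD.
by apply: le_lt_trans (sqintD_le mD mf mg) _; apply: lte_add_pinfty;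
  apply: lte_mul_pinfty.
Qed.

Lemma sqintegrableB D f g : measurable D -> sqintegrable D f ->
  sqintegrable D g -> sqintegrable D (fun x => f x - g x).
Proof.
move=> mD [mf f2] [mg g2]; split; first exact: measurable_funB.
by apply: le_lt_trans (sqintB_le mD mf mg) _; apply: lte_add_pinfty;
  apply: lte_mul_pinfty.
Qed.

Lemma sqintegrable_cst D (c : R) : measurable D -> (mu D < +oo)%E ->
  sqintegrable D (cst c).
Proof.
move=> mD muD; split => //.
rewrite /sqint (_ : (fun x => _) = cst (c ^+ 2)%:E)// integral_cst//.
by rewrite lte_mul_pinfty// lee_fin sqr_ge0.
Qed.

Lemma sqintegrable0 D : measurable D -> sqintegrable D (cst 0).
Proof.
move=> mD; split => //; rewrite /sqint.
by under eq_integral do rewrite /= expr0n; rewrite integral0.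
Qed.

Lemma sqintegrableS D D' f : measurable D -> measurable D' -> D `<=` D' ->
  sqintegrable D' f -> sqintegrable D f.
Proof.
move=> mD mD' DD' [mf f2]; split; first exact: measurable_funS mf.
by apply: le_lt_trans f2; exact: sqint_subset.
Qed.

Lemma sqintegrable_integrable D f : measurable D -> (mu D < +oo)%E ->
  sqintegrable D f -> mu.-integrable D (EFin \o f).
Proof.
move=> mD muD f2.
have := sqintegrable_integrableM mD (sqintegrable_cst 1 mD muD) f2.
by apply: eq_integrable => // x _ /=; rewrite mul1r.
Qed.

(** The Cauchy-Schwarz inequality, as the variance of f on D is nonnegative. *)
Lemma Rintegral_sqr_le D f : measurable D -> (mu D < +oo)%E ->
  sqintegrable D f ->
  (((\int[mu]_(x in D) f x) ^+ 2)%:E <= mu D * sqint D f)%E.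
Proof.
move=> mD muD f2.
have intf := sqintegrable_integrable mD muD f2.
have intff := sqintegrable_integrableM mD f2 f2.
set I := \int[mu]_(x in D) f x.
have mfin : mu D \is a fin_num by rewrite ge0_fin_numE.
have E : sqint D f = (\int[mu]_(x in D) (f x * f x))%:E.
  by rewrite /Rintegral fineK ?integrable_fin_num//; apply: eq_integral => x _; rewrite expr2.
have [m0|m0] := eqVneq (fine (mu D)) 0.
  have : `|I| <= 0.
    have mu0 : mu D = 0%E by rewrite -(fineK mfin) m0.
    rewrite /I /Rintegral (null_set_integral (mu:=mu))//= ?normr0//.
    by case/integrableP : intf.
  rewrite normr_le0 => /eqP ->; rewrite expr0n/=.
  by rewrite mule_ge0// sqint_ge0.
rewrite -(fineK mfin) E -EFinM lee_fin.
set m := fine _ in m0 *; set S := \int[mu]_(x in D) _.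
have m_gt0 : 0 < m by rewrite lt_neqAle eq_sym m0 fine_ge0.
have ic (c : R) : mu.-integrable D (EFin \o cst c).
  exact: sqintegrable_integrable (sqintegrable_cst _ mD muD).
(* This is the integral of the square of f minus its mean I / m. *)
have : 0 <= \int[mu]_(x in D) ((f x * f x - (2 * (I / m)) * f x) + (I / m) ^+ 2).
  apply: Rintegral_ge0 => x _.
  have := sqr_ge0 (f x - I / m); lra.
rewrite RintegralD//; last 2 first.
- by apply: integrable_subR => //; exact: integrable_scaleR.
- exact: ic.
rewrite RintegralB//; last exact: (integrable_scaleR (2 * (I / m)) mD intf).
rewrite RintegralZl// Rintegral_cst// -/I -/S -/m.
have -> : S - 2 * (I / m) * I + (I / m) ^+ 2 * m = S - I ^+ 2 / m by field.
by rewrite subr_ge0 ler_pdivrMr// mulrC.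
Qed.

End SquareIntegral.

(** * Primitives of square integrable functions *)

Lemma measurable_itvT {R : realType} (T : R) : measurable (itvT T).
Proof. exact: measurable_itv. Qed.
#[global] Hint Extern 0 (measurable (itvT _)) => exact: measurable_itvT : core.

Lemma mu_itvT_lty {R : realType} (T : R) : (mu (itvT T) < +oo)%E.
Proof.
rewrite /itvT lebesgue_measure_itv/=; case: ifP => _ //.
by rewrite -EFinD ltry.
Qed.
#[global] Hint Extern 0 (is_true (_ (itvT _) < _)%E) => exact: mu_itvT_lty : core.

Section Primitive.
Context {R : realType} (T : R).
Implicit Types (f g : R -> R).

Definition cut f : R -> R := f \_ (itvT T).

Lemma cutE f x : 0 < x < T -> cut f x = f x.
Proof. by move=> xT; rewrite /cut patchE mem_set//= /itvT/= in_itv. Qed.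

Lemma cut_in f : {in itvT T, cut f =1 f}.
Proof. by move=> x xT; rewrite /cut patchE xT. Qed.

Lemma cut0 f x : ~~ (0 < x < T) -> cut f x = 0.
Proof.
move=> xT; rewrite /cut patchE memNset//= /itvT/= in_itv/=; exact/negP.
Qed.

Lemma measurable_cut f : measurable_fun (itvT T) f -> measurable_fun setT (cut f).
Proof. by move=> mf; exact/(measurable_restrictT _ (measurable_itvT T)). Qed.

Lemma sqint_cut D f : measurable D ->
  sqint D (cut f) = sqint (D `&` itvT T) f.
Proof.
move=> mD; rewrite /sqint integral_mkcondr; apply: eq_integral => x _.
by rewrite /cut !patchE; case: ifPn => // _; rewrite expr0n.
Qed.

Lemma sqint_cutT f : sqint setT (cut f) = sqint (itvT T) f.
Proof. by rewrite sqint_cut// setTI. Qed.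

Lemma sqintegrable_cut D f : measurable D -> inL2 T f -> sqintegrable D (cut f).
Proof.
move=> mD [mf f2]; split; first by apply: measurable_funTS; exact: measurable_cut.
rewrite sqint_cut//; apply: le_lt_trans f2; apply: sqint_subset => //.
exact: measurableI.
Qed.

Lemma integrable_cut D f : measurable D -> mu.-integrable (itvT T) (EFin \o f) ->
  mu.-integrable D (EFin \o cut f).
Proof.
move=> mD intf; apply: (integrableS measurableT) => //.
have /integrable_mkcond := intf => /(_ (measurable_itvT T)).
by apply: eq_integrable => // x _; rewrite /cut /= !patchE; case: ifP.
Qed.

Lemma inL2_integrable f : inL2 T f -> mu.-integrable (itvT T) (EFin \o f).
Proof. by move=> f2; apply: sqintegrable_integrable. Qed.

Lemma inL2_bounded f M : measurable_fun (itvT T) f ->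
  (forall x, 0 < x < T -> `|f x| <= M) -> inL2 T f.
Proof.
move=> mf fM; split=> //; apply: (@le_lt_trans _ _ (sqint (itvT T) (cst M))).
  apply: sqint_le => x; rewrite /itvT/= in_itv/= => /fM xM.
  by rewrite -real_normK ?num_real// ler_sqr ?nnegrE// (le_trans _ xM).
by have [] := @sqintegrable_cst R (itvT T) M (measurable_itvT T) (mu_itvT_lty T).
Qed.

Definition prim g x := \int[mu]_(y in `]-oo, x]) cut g y.

Lemma primB g x y : mu.-integrable (itvT T) (EFin \o g) -> x <= y ->
  prim g y - prim g x = \int[mu]_(z in `]x, y]) cut g z.
Proof.
move=> ig xy; rewrite /prim Rintegral_itvB//.
by apply: integrable_cut.
Qed.

Lemma prim_le0 g x : x <= 0 -> prim g x = 0.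
Proof.
move=> x0; rewrite /prim /Rintegral integral0_eq// => y /=; rewrite in_itv/= => yx.
by rewrite cut0// (_ : 0 < y = false)//; apply/negbTE; rewrite -leNgt (le_trans yx).
Qed.

Lemma prim_sqr_le g x y : inL2 T g -> x <= y ->
  (((prim g y - prim g x) ^+ 2)%:E <= (y - x)%:E * sqint `]x, y] (cut g))%E.
Proof.
move=> g2 xy; rewrite primB//; last exact: inL2_integrable.
have E : mu `]x, y] = (y - x)%:E.
  rewrite lebesgue_measure_itv/= lte_fin; case: ltP => // yx.
  by rewrite (@le_anti _ _ x y) ?xy// subrr.
rewrite -E; apply: Rintegral_sqr_le => //.
  by rewrite [X in (X < _)%E]E ltry.
exact: sqintegrable_cut.
Qed.

Lemma prim_sqr_leT g x y : inL2 T g -> x <= y ->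
  (prim g y - prim g x) ^+ 2 <= (y - x) * fine (sqint (itvT T) g).
Proof.
move=> g2 xy; rewrite -lee_fin [leRHS]EFinM fineK; last first.
  by apply: sqint_fin_num.
apply: (le_trans (prim_sqr_le g2 xy)); apply: lee_wpmul2l.
  by rewrite lee_fin subr_ge0.
rewrite -sqint_cutT; apply: sqint_subset => //; apply: measurable_cut.
by case: g2.
Qed.

Lemma prim_continuous g : inL2 T g -> continuous (prim g).
Proof.
move=> g2 x; apply/cvgrPdist_le => /= e e0.
set S := fine (sqint (itvT T) g).
have S0 : 0 <= S by rewrite fine_ge0// sqint_ge0.
near=> y.
suff : `|prim g x - prim g y| ^+ 2 <= e ^+ 2.
  by rewrite ler_sqr ?nnegrE// ltW.
apply: (@le_trans _ _ (`|x - y| * (S + 1))).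
  rewrite real_normK ?num_real//; have [xy|yx] := leP x y.
    rewrite ler0_norm ?subr_le0// opprB.
    rewrite -sqrrN opprB; apply: le_trans (prim_sqr_leT g2 xy) _.
    by apply: ler_wpM2l; rewrite ?subr_ge0// lerDl.
  rewrite ger0_norm ?subr_ge0 ?(ltW yx)//.
  apply: le_trans (prim_sqr_leT g2 (ltW yx)) _.
  by apply: ler_wpM2l; rewrite ?subr_ge0 ?(ltW yx)// lerDl.
rewrite -ler_pdivlMr; last by rewrite ltr_wpDl.
near: y; apply: cvgr_dist_le; first exact: cvg_id.
by rewrite divr_gt0// ?exprn_gt0// ltr_wpDl.
Unshelve. all: by end_near. Qed.

Lemma measurable_prim D g : inL2 T g -> measurable_fun D (prim g).
Proof.
move=> g2; apply: measurable_funTS; apply: continuous_measurable_fun.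
exact: prim_continuous.
Qed.

Lemma inL2_prim g : inL2 T g -> inL2 T (prim g).
Proof.
move=> g2; split; first exact: measurable_prim.
set S := fine (sqint (itvT T) g).
have S0 : 0 <= S by rewrite fine_ge0// sqint_ge0.
rewrite /l2normsq.
apply: (@le_lt_trans _ _ (\int[mu]_(x in itvT T) (cst (T * S)%:E x))%E).
  apply: ge0_le_integral_nonmeas => x; first by rewrite lee_fin sqr_ge0.
  rewrite /itvT /= in_itv/= => /andP[x0 xT]; rewrite lee_fin.
  have := prim_sqr_leT g2 (ltW x0); rewrite (prim_le0 _ (lexx 0)) !subr0 => h.
  by apply: le_trans h _; apply: ler_wpM2r => //; exact: ltW.
rewrite integral_cst//; apply: lte_mul_pinfty => //.
rewrite lee_fin; have [T0|T0] := leP 0 T; first exact: mulr_ge0.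
suff -> : S = 0 by rewrite mulr0.
by rewrite /S /sqint /itvT set_itv_ge ?integral_set0// -leNgt bnd_simp ltW.
Qed.

Lemma prim_subr f g x : mu.-integrable (itvT T) (EFin \o f) ->
  mu.-integrable (itvT T) (EFin \o g) ->
  prim (fun x => f x - g x) x = prim f x - prim g x.
Proof.
move=> If Ig; rewrite /prim -RintegralB//; [|exact: integrable_cut..].
by apply: eq_Rintegral => y _; rewrite /cut !patchE; case: ifP; rewrite // subr0.
Qed.

Lemma prim_addr f g x : mu.-integrable (itvT T) (EFin \o f) ->
  mu.-integrable (itvT T) (EFin \o g) ->
  prim (fun x => f x + g x) x = prim f x + prim g x.
Proof.
move=> If Ig; rewrite /prim -RintegralD//; [|exact: integrable_cut..].
by apply: eq_Rintegral => y _; rewrite /cut !patchE; case: ifP; rewrite // addr0.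
Qed.

Lemma prim_scaler a f x : mu.-integrable (itvT T) (EFin \o f) ->
  prim (fun x => a * f x) x = a * prim f x.
Proof.
move=> If; rewrite /prim -RintegralZl//; [|exact: integrable_cut..].
by apply: eq_Rintegral => y _; rewrite /cut !patchE; case: ifP; rewrite // mulr0.
Qed.

(** A function whose primitive is constant vanishes almost everywhere, by the
    Lebesgue differentiation theorem. *)
Lemma prim_cst_ae0 g c : mu.-integrable (itvT T) (EFin \o g) ->
  (forall x, 0 < x < T -> prim g x = c) -> ae_eq mu (itvT T) g (cst 0).
Proof.
move=> ig gc.
have icut D : measurable D -> mu.-integrable D (EFin \o cut g).
  by move=> mD; exact: integrable_cut.
have := @FTC1Ny R (cut g).
move=> /(_ (fun y => icut _ (measurable_itv _))) /(_ _)/wrap[].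
  exact: integrable_locally.
apply: filterS; first exact: (ae_filter_ringOfSetsType mu).
move=> x /= [dF F'] xT; move: (xT); rewrite /itvT/= in_itv/= => xT'.
rewrite -(cutE g xT') -F' -[RHS](derive1_cst c x) !derive1E; apply: near_eq_derive.
near=> y; apply: gc; near: y.
have : nbhs x (itvT T) by apply: open_nbhs_nbhs; split => //; exact: interval_open.
by apply: filterS => y; rewrite /itvT/= in_itv.
Unshelve. all: by end_near. Qed.

End Primitive.

Section ByParts.
Context {R : realType}.
Implicit Types (D : set R) (f g p q : R -> R).

(** Integration by parts for primitives, as Fubini's theorem on the half-plane
    y <= x. *)
Lemma Rintegral_prim_swap p q :
  mu.-integrable setT (EFin \o p) -> mu.-integrable setT (EFin \o q) ->
  \int[mu]_x (q x * \int[mu]_(y in `]-oo, x]) p y) =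
  \int[mu]_y (p y * \int[mu]_(x in `[y, +oo[) q x).
Proof.
move=> ip iq.
have mp : measurable_fun setT p by have /measurable_int/measurable_EFinP := ip.
have mq : measurable_fun setT q by have /measurable_int/measurable_EFinP := iq.
pose D : set R := `[0, +oo[%classic.
have mD : measurable_fun setT (\1_D : R -> R) by apply: measurable_indic; exact: measurable_itv.
pose F (z : measurableTypeR R * measurableTypeR R) : R := \1_D (z.1 - z.2) * (p z.2 * q z.1).
have mF : measurable_fun setT F.
  have mc := measurable_fun_comp_diff mD.
  apply: measurable_funM; first exact mc.
  by apply: measurable_funM; apply: measurableT_comp.
have iF : (mu \x mu)%E.-integrable setT (EFin \o F).
  apply/integrable12ltyP; first exact/measurable_EFinP.
  apply: (@le_lt_trans _ _ (\int[mu]_x (`|(q x)%:E| * \int[mu]_y `|(p y)%:E|))%E).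
    apply: ge0_le_integral_nonmeas => x _; first exact: integral_ge0.
    rewrite -ge0_integralZl//; last first.
      by apply: measurableT_comp => //; exact/measurable_EFinP.
    apply: ge0_le_integral_nonmeas => y _ //.
    rewrite /F /= lee_fin !normrM [leRHS]mulrC -[leRHS]mul1r ler_wpM2r ?mulr_ge0//.
    by rewrite indicE; case: (_ \in _); rewrite ?normr1 ?normr0.
  rewrite ge0_integralZr//; last 2 first.
  - by apply: measurableT_comp => //; exact/measurable_EFinP.
  - exact: integral_ge0.
  have /integrableP[_ ip2] := ip; have /integrableP[_ iq2] := iq.
  have fp : (\int[mu]_y `|(p y)%:E|)%E \is a fin_num.
    by rewrite ge0_fin_numE ?integral_ge0.
  rewrite -(fineK fp) muleC; apply: lte_mul_pinfty => //.
  by rewrite lee_fin fine_ge0// integral_ge0.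
have := Fubini iF.
have -> : (\int[mu]_x \int[mu]_y (EFin \o F) (x, y) =
    \int[mu]_x (q x * \int[mu]_(y in `]-oo, x]) p y)%R%:E)%E.
  apply: eq_integral => x _.
  transitivity (\int[mu]_(y in `]-oo, x]) ((q x)%:E * (p y)%:E))%E.
    rewrite [RHS]integral_mkcond; apply: eq_integral => y _.
    rewrite /F /= patchE indicE /D /=.
    have -> : (x - y \in `[0, +oo[%classic) = (y \in `]-oo, x]%classic).
      by apply/idP/idP; rewrite !inE /= !in_itv/= andbT subr_ge0.
    by case: ifP => _; rewrite ?mul1r ?mul0r// EFinM muleC.
  have ip' : mu.-integrable `]-oo, x] (EFin \o p) by exact: (integrableS measurableT).
  rewrite integralZl// EFinM; congr (_ * _)%E; rewrite /Rintegral fineK//.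
  exact: (integrable_fin_num (mu:=mu)).
have -> : (\int[mu]_y \int[mu]_x (EFin \o F) (x, y) =
    \int[mu]_y (p y * \int[mu]_(x in `[y, +oo[) q x)%R%:E)%E.
  apply: eq_integral => y _.
  transitivity (\int[mu]_(x in `[y, +oo[) ((p y)%:E * (q x)%:E))%E.
    rewrite [RHS]integral_mkcond; apply: eq_integral => x _.
    rewrite /F /= patchE indicE /D /=.
    have -> : (x - y \in `[0, +oo[%classic) = (x \in `[y, +oo[%classic).
      by apply/idP/idP; rewrite !inE /= !in_itv/= !andbT subr_ge0.
    by case: ifP => _; rewrite ?mul1r ?mul0r// EFinM muleC.
  have iq' : mu.-integrable `[y, +oo[ (EFin \o q) by exact: (integrableS measurableT).
  rewrite integralZl// EFinM; congr (_ * _)%E; rewrite /Rintegral fineK//.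
  exact: (integrable_fin_num (mu:=mu)).
by rewrite /Rintegral => ->.
Qed.

Lemma continuous_bounded_itv a b f : {within `[a, b], continuous f} ->
  exists2 M, 0 <= M & forall x, a <= x <= b -> `|f x| <= M.
Proof.
move=> cf.
have [ab|ba] := leP a b; last first.
  by exists 0 => // x /andP[ax xb]; have := le_trans ax xb; rewrite leNgt ba.
have := @compact_bounded R R^o (f @` `[a, b]).
have cK : compact (f @` `[a, b]).
  by apply: continuous_compact => //; exact: segment_compact.
move=> /(_ cK)[M [Mr HM]]; exists (`|M| + 1) => [|x xab].
  by rewrite addr_ge0.
apply: HM; last by exists x => //=; rewrite in_itv.
by rewrite ltr_pwDr// ler_norm.
Qed.

End ByParts.

Section WeakDerivative.
Context {R : realType} (T : R).
Implicit Types (f g phi : R -> R).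

Lemma continuous_integrable_itvT phi : continuous phi ->
  mu.-integrable (itvT T) (EFin \o phi).
Proof.
move=> cphi; apply: (@integrableS _ _ _ mu `[0, T]) => //.
  by apply: subset_itv_oo_cc.
by apply: continuous_compact_integrable; [exact: segment_compact|exact: continuous_subspaceT].
Qed.

Lemma continuous_inL2 phi : continuous phi -> inL2 T phi.
Proof.
move=> cphi; have [M M0 HM] := @continuous_bounded_itv R 0 T phi (continuous_subspaceT cphi).
apply: (@inL2_bounded _ _ _ M); first by apply: measurable_funTS; exact: continuous_measurable_fun.
by move=> x /andP[x0 xT]; apply: HM; rewrite !ltW.
Qed.

Lemma test_function_sqint phi : test_function T phi -> inL2 T phi.
Proof.
move=> [dphi cphi _]; have cp : continuous phi.
  by move=> x; apply/differentiable_continuous/derivable1_diffP.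
exact: continuous_inL2.
Qed.

(** By Fubini's theorem the integral of (prim g) phi' is that of g against the
    integral of phi' over [y, T], which is - phi y since phi vanishes near T. *)
Lemma prim_weak_derivative g : inL2 T g -> is_weak_derivative T (prim T g) g.
Proof.
move=> g2; split => //; first exact: inL2_prim.
move=> phi tphi; have [dphi cphi [a [b [a0 bT phi0]]]] := tphi.
have cp : continuous phi.
  by move=> x; apply/differentiable_continuous/derivable1_diffP.
have ig := inL2_integrable g2.
have iphi := continuous_integrable_itvT cphi.
transitivity (\int[mu]_x (cut T (derive1 phi) x * \int[mu]_(y in `]-oo, x]) cut T g y)).
  rewrite Rintegral_mkcond; apply: eq_Rintegral => x _.
  by rewrite /cut !patchE; case: ifP; rewrite ?mul0r// mulrC.
rewrite Rintegral_prim_swap; [|exact: integrable_cut..].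
rewrite [in RHS]Rintegral_mkcond.
rewrite -mulN1r -RintegralZl//; last first.
  have /integrable_mkcond := sqintegrable_integrableM (measurable_itvT T) g2 (test_function_sqint tphi).
  move=> /(_ (measurable_itvT T)); apply: eq_integrable => // x _.
  by rewrite /= !patchE; case: ifP.
apply: eq_Rintegral => y _.
rewrite mulN1r /cut !patchE; case: ifPn => yT; last by rewrite mul0r oppr0.
rewrite -mulrN; congr (_ * _).
move: yT; rewrite inE /itvT /= in_itv/= => /andP[y0 yT].
have phiT : phi T = 0.
  by apply: phi0; rewrite in_itv/= negb_and -!ltNge bT orbT.
transitivity (\int[mu]_(x in `[y, T]) derive1 phi x).
  transitivity (\int[mu]_(x in `[y, T[) derive1 phi x).
    rewrite -Rintegral_mkcondr; congr (Rintegral _ _ _); apply/seteqP.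
    split=> x /=; rewrite !in_itv/= ?andbT; first by move=> [-> /andP[]].
    by move=> /andP[yx xT]; rewrite yx xT (lt_le_trans y0 yx).
  rewrite Rintegral_itv_bndo_bndc//.
  apply: (@integrableS _ _ _ mu `[y, T]) => //; first exact: subset_itv_co_cc.
  by apply: continuous_compact_integrable; [exact: segment_compact|exact: continuous_subspaceT].
(* By the fundamental theorem of calculus, as phi T = 0. *)
have cR : derivable_oo_LRcontinuous phi y T.
  split => [x _||]; first exact: dphi.
  - by apply: cvg_at_right_filter; exact: cp.
  - by apply: cvg_at_left_filter; exact: cp.
have /= := continuous_FTC2 yT (continuous_subspaceT cphi) cR (fun x _ => erefl).
by rewrite /Rintegral => ->; rewrite phiT -EFinB sub0r.
Qed.

End WeakDerivative.

(** * Du Bois-Reymond's lemma and the structure of H^1 *)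

Section FundamentalLemma.
Context {R : realType} (T : R).
Implicit Types (f g k m psi : R -> R).

(** A continuous psi of mean zero that is supported in (0, T) is the derivative of
    a test function, namely of its primitive. *)
Lemma mean_zero_test k psi a b :
  (forall phi, test_function T phi ->
     \int[mu]_(x in itvT T) (k x * derive1 phi x) = 0) ->
  continuous psi -> 0 < a -> b < T ->
  (forall x, ~~ (a <= x <= b) -> psi x = 0) ->
  \int[mu]_(x in itvT T) psi x = 0 ->
  \int[mu]_(x in itvT T) (k x * psi x) = 0.
Proof.
move=> kphi cpsi a0 bT supp psi0.
have ipsi : mu.-integrable setT (EFin \o psi).
  have : mu.-integrable `[a, b] (EFin \o psi).
    by apply: continuous_compact_integrable; [exact: segment_compact|exact: continuous_subspaceT].
  move=> /integrable_mkcond - /(_ (measurable_itv _)).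
  apply: eq_integrable => // x _; rewrite patchE; case: ifPn => //.
  by rewrite notin_setE/= in_itv/= => /negP/supp ->.
pose F x := \int[mu]_(y in `]-oo, x]) psi y.
have dF x : derivable F x 1 /\ derive1 F x = psi x.
  apply: (@continuous_FTC1 _ _ -oo%O x (x + 1)); rewrite ?ltrDl ?ltNyr//.
    exact: integrableS ipsi.
  exact: cpsi.
have eF : derive1 F = psi by apply/funext => x; case: (dF x).
have tF : test_function T F.
  split; first by move=> x; case: (dF x).
    by rewrite eF.
  exists a, b; split => // x; rewrite in_itv/= negb_and -!ltNge.
  have [xa _|ax /= bx] := ltP x a.
    rewrite /F /Rintegral integral0_eq// => y /=; rewrite in_itv/= => yx.
    by rewrite supp// negb_and -ltNge (le_lt_trans yx xa).
  rewrite -psi0 /F Rintegral_mkcond [RHS]Rintegral_mkcond.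
  apply: eq_Rintegral => y _; rewrite !patchE.
  have [yab|/supp ->] := boolP (a <= y <= b); last by do 2 case: ifP.
  have [ay yb] := andP yab.
  rewrite !mem_set//=; rewrite /itvT/= in_itv/=.
    by rewrite (lt_le_trans a0 ay) (le_lt_trans yb bT).
  by rewrite (le_trans yb (ltW bx)).
by rewrite -eF; exact: kphi.
Qed.

(** A continuous approximation of the indicator of ]a, b[: as test functions are
    only C^1, their derivatives can be chosen piecewise linear. *)
Definition trapezoid (a b : R) (k : nat) (x : R) : R :=
  Num.min 1 (Num.max 0 (k%:R * Num.min (x - a) (b - x))).

Lemma trapezoid_continuous a b j : continuous (trapezoid a b j).
Proof.
have -> : trapezoid a b j = cst 1 \min (cst 0 \max
    (fun x => j%:R * ((fun x => x - a) \min (fun x => b - x)) x)) by [].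
apply: min_fun_continuous; first exact: cst_continuous.
apply: max_fun_continuous; first exact: cst_continuous.
have cm : continuous ((fun x : R => x - a) \min (fun x => b - x)).
  apply: min_fun_continuous => x.
    by apply: cvgB; [exact: cvg_id|exact: cvg_cst].
  by apply: cvgB; [exact: cvg_cst|exact: cvg_id].
by move=> x; apply: cvgMr; exact: cm.
Qed.

Lemma trapezoid_supp a b j x : ~~ (a <= x <= b) -> trapezoid a b j x = 0.
Proof.
rewrite /trapezoid => h; have mn : Num.min (x - a) (b - x) <= 0.
  move: h; rewrite negb_and -!ltNge ge_min => /orP[xa|bx].
    by rewrite subr_le0 (ltW xa).
  by rewrite !subr_le0 (ltW bx) orbT.
rewrite (max_l (_ : _ <= 0)); first by rewrite min_r.
by rewrite mulr_ge0_le0.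
Qed.

Lemma trapezoid_ge0 a b j x : 0 <= trapezoid a b j x.
Proof. by rewrite /trapezoid le_min ler01 le_max lexx. Qed.

Lemma trapezoid_le1 a b j x : trapezoid a b j x <= 1.
Proof. by rewrite /trapezoid ge_min lexx. Qed.

Lemma trapezoid_cvg a b x :
  trapezoid a b j x @[j --> \oo] --> (\1_(`]a, b[%classic : set R) x : R).
Proof.
rewrite indicE; have [|] := boolP (x \in `]a, b[%classic).
  rewrite inE/= in_itv/= => /andP[ax xb].
  set c := Num.min (x - a) (b - x).
  have c0 : 0 < c by rewrite lt_min !subr_gt0 ax.
  apply: (@cvg_near_cst _ _ (1 : R)) => //.
  near=> k; rewrite /trapezoid -/c.
  have h : 1 <= k%:R * c.
    rewrite -ler_pdivrMr//.
    near: k; exact: nbhs_infty_ger.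
  by rewrite max_r ?min_l// (le_trans ler01 h).
rewrite notin_setE/= in_itv/= => /negP h.
apply: (@cvg_near_cst _ _ (0 : R)) => //.
near=> k; rewrite /trapezoid.
have mn : Num.min (x - a) (b - x) <= 0.
  move: h; rewrite negb_and -!leNgt ge_min => /orP[xa|bx].
    by rewrite subr_le0 xa.
  by rewrite !subr_le0 bx orbT.
rewrite (max_l (_ : _ <= 0)); first by rewrite min_r.
by rewrite mulr_ge0_le0.
Unshelve. all: by end_near. Qed.

(** In the limit of the trapezoids, m has integral zero over every interval, so
    that its primitive is constant. *)
Lemma trapezoid_ae0 m : mu.-integrable (itvT T) (EFin \o m) ->
  (forall a b j, 0 < a -> b < T ->
     \int[mu]_(x in itvT T) (m x * trapezoid a b j x) = 0) ->
  ae_eq mu (itvT T) m (cst 0).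
Proof.
move=> im mt; apply: (@prim_cst_ae0 _ _ _ (prim T m (T / 2))) => //.
have mm : measurable_fun (itvT T) m by have /measurable_int/measurable_EFinP := im.
have mtr a b j : measurable_fun setT (trapezoid a b j).
  by apply: continuous_measurable_fun; exact: trapezoid_continuous.
have int0 a b : 0 < a -> b < T -> \int[mu]_(x in `]a, b[) cut T m x = 0.
  move=> a0 bT.
  have := @dominated_convergence _ _ _ mu (itvT T) (measurable_itvT T)
    (fun j x => (m x * trapezoid a b j x)%:E)
    (fun x => (m x * \1_(`]a, b[%classic : set R) x)%:E)
    (fun x => `|(m x)%:E|)%E.
  case.
  - move=> j; apply/measurable_EFinP; apply: measurable_funM => //.
    by apply: measurable_funTS; exact: mtr.
  - apply/measurable_EFinP; apply: measurable_funM => //.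
  - apply: aeW => x _; apply: cvg_EFin; first by near=> j.
    by apply: cvgMr; exact: trapezoid_cvg.
  - exact: integrable_abse im.
  - apply: aeW => x j _; rewrite /= lee_fin normrM [`|trapezoid _ _ _ _|]ger0_norm ?trapezoid_ge0//.
    by rewrite ler_piMr// trapezoid_le1.
  move=> _ _.
  rewrite (_ : [sequence _]_n = cst 0%E); last first.
    apply/funext => j /=; have := mt a b j a0 bT; rewrite /Rintegral => /eqP.
    rewrite fine_eq0; first by move=> /eqP.
    apply: (integrable_fin_num (mu:=mu)) => //.
    apply: (@le_integrable _ _ _ mu _ _ _ (EFin \o m)) => //.
      by apply/measurable_EFinP; apply: measurable_funM => //; apply: measurable_funTS; exact: mtr.
    move=> x _; rewrite /= lee_fin normrM [`|trapezoid _ _ _ _|]ger0_norm ?trapezoid_ge0//.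
    by rewrite ler_piMr// trapezoid_le1.
  move=> /(cvg_unique _)/(_ (cvg_cst _)) h.
  rewrite /Rintegral (_ : integral _ _ _ = 0%E)//.
  rewrite -[RHS]h// [LHS]integral_mkcond [RHS]integral_mkcond.
  apply: eq_integral => x _; rewrite !patchE /cut patchE indicE.
  by case: ifP => _; case: ifP => _; rewrite ?mulr1 ?mulr0.
have key x y : 0 < x -> y < T -> x <= y -> prim T m x = prim T m y.
  move=> x0 yT xy; apply/eqP; rewrite eq_sym -subr_eq0 primB//.
  rewrite -Rintegral_itv_bndo_bndc ?int0//.
  exact: integrable_cut.
move=> x /andP[x0 xT].
have [xt|tx] := leP x (T / 2).
  by rewrite (@key x (T / 2))//; have := lt_trans x0 xT; lra.
by rewrite -(@key (T / 2) x)//; [have := lt_trans x0 xT; lra|exact: ltW].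
Unshelve. all: by end_near. Qed.

(** All trapezoids become admissible in [mean_zero_test] after subtraction of a
    multiple of a fixed one; this multiple determines the constant. *)
Lemma du_Bois_Reymond k : inL2 T k ->
  (forall phi, test_function T phi ->
     \int[mu]_(x in itvT T) (k x * derive1 phi x) = 0) ->
  exists c, ae_eq mu (itvT T) k (cst c).
Proof.
move=> k2 kphi; have ik := inL2_integrable k2.
have itr a b j : mu.-integrable (itvT T) (EFin \o trapezoid a b j).
  by apply: continuous_integrable_itvT; exact: trapezoid_continuous.
have itr2 a b j : inL2 T (trapezoid a b j).
  exact/continuous_inL2/trapezoid_continuous.
have iktr a b j := sqintegrable_integrableM (measurable_itvT T) k2 (itr2 a b j).
pose N a b j := \int[mu]_(x in itvT T) trapezoid a b j x.
have [[a [b [j [a0 bT NN]]]]|nN] :=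
    pselect (exists a b j, [/\ 0 < a, b < T & N a b j != 0]); last first.
  exists 0; apply: trapezoid_ae0 => // a b j a0 bT.
  have Nabj : N a b j = 0.
    by apply: contrapT => /eqP NN; apply: nN; exists a, b, j.
  apply: mean_zero_test a0 bT _ _ => //.
  - exact: trapezoid_continuous.
  - exact: trapezoid_supp.
set X := \int[mu]_(x in itvT T) (k x * trapezoid a b j x).
pose c := X / N a b j.
exists c.
have kc0 : ae_eq mu (itvT T) (fun x => k x - c) (cst 0).
  have ic : mu.-integrable (itvT T) (EFin \o cst c).
    by apply: sqintegrable_integrable => //; exact: sqintegrable_cst.
  apply: trapezoid_ae0; first exact: integrable_subR.
  move=> a' b' j' a'0 b'T.
  pose psi x := trapezoid a' b' j' x - (N a' b' j' / N a b j) * trapezoid a b j x.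
  have ipsi0 : \int[mu]_(x in itvT T) psi x = 0.
    rewrite RintegralB//; last exact: integrable_scaleR.
    by rewrite RintegralZl// -/(N a b j) divfK// subrr.
  have supp x : ~~ (Num.min a a' <= x <= Num.max b b') -> psi x = 0.
    rewrite ge_min le_max => h; rewrite /psi !trapezoid_supp ?mulr0 ?subrr//.
      by apply: contra h => /andP[-> ->]; rewrite ?orbT.
    by apply: contra h => /andP[-> ->]; rewrite ?orbT.
  have : \int[mu]_(x in itvT T) (k x * psi x) = 0.
    apply: mean_zero_test supp ipsi0 => //.
    - move=> x; apply: cvgB; first exact: trapezoid_continuous.
      by apply: cvgMr; exact: trapezoid_continuous.
    - by rewrite lt_min a0.
    - by rewrite gt_max bT.
  have -> : \int[mu]_(x in itvT T) (k x * psi x) =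
     \int[mu]_(x in itvT T) (k x * trapezoid a' b' j' x) - N a' b' j' / N a b j * X.
    rewrite /X -RintegralZl// -RintegralB//; last exact: integrable_scaleR.
    by apply: eq_Rintegral => x _; rewrite /psi; ring.
  have -> : \int[mu]_(x in itvT T) ((k x - c) * trapezoid a' b' j' x) =
     \int[mu]_(x in itvT T) (k x * trapezoid a' b' j' x) - c * N a' b' j'.
    rewrite /N -RintegralZl// -RintegralB//; last exact: integrable_scaleR.
    by apply: eq_Rintegral => x _; ring.
  by move=> <-; congr (_ - _); rewrite /c; field.
apply: filterS kc0.
by move=> x /[apply] /= /eqP; rewrite subr_eq0 => /eqP.
Qed.

(** The difference of f and the primitive of g annihilates the derivatives of all
    test functions. *)
Lemma weak_derivative_prim f g : is_weak_derivative T f g ->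
  exists c, ae_eq mu (itvT T) f (fun x => c + prim T g x).
Proof.
move=> [f2 g2 fg].
have [_ _ pg] := prim_weak_derivative g2.
have p2 := inL2_prim g2.
have k2 : inL2 T (fun x => f x - prim T g x) by exact: sqintegrableB.
have [c kc] : exists c, ae_eq mu (itvT T) (fun x => f x - prim T g x) (cst c).
  apply: du_Bois_Reymond => // phi tphi.
  have d2 : inL2 T (derive1 phi).
    by have [_ cphi _] := tphi; exact: continuous_inL2.
  transitivity (\int[mu]_(x in itvT T) (f x * derive1 phi x - prim T g x * derive1 phi x)).
    by apply: eq_Rintegral => x _; rewrite mulrBl.
  rewrite RintegralB//; [|exact: sqintegrable_integrableM..].
  by rewrite fg// pg// subrr.
exists c; apply: filterS kc.
by move=> x /[apply] /= <-; rewrite subrK.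
Qed.

(** A continuous function that does not vanish at a point of [0, T], even at an end
    point, does not vanish on some interval inside (0, T), which has positive measure. *)
Lemma ae0_continuous (h : R -> R) : {within `[0, T], continuous h} ->
  ae_eq mu (itvT T) h (cst 0) -> 0 < T -> forall x, 0 <= x <= T -> h x = 0.
Proof.
move=> /subspace_continuousP ch h0 T0 x xT; apply: contrapT => /eqP hx0.
have e0 : 0 < `|h x| by rewrite normr_gt0.
have := ch x; rewrite /= in_itv/= => /(_ xT)/cvgrPdist_lt/(_ _ e0).
rewrite near_withinE => /nbhs_ballP[d /= d0 hd].
have nz y : ball x d y -> 0 < y < T -> h y != 0.
  move=> xy /andP[y0 yT]; have := hd y xy; rewrite /= in_itv/= !ltW// => /(_ isT).
  by rewrite /from_subspace; apply: contraTneq => ->; rewrite subr0 ltxx.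
pose a := Num.max 0 (x - d / 2); pose b := Num.min T (x + d / 2).
have [x0 xT'] := andP xT.
have ab : a < b by rewrite /a /b lt_min !gt_max T0; lra.
have sub y : a < y < b -> ball x d y /\ 0 < y < T.
  rewrite /a /b lt_min gt_max => /andP[/andP[y0 xy] /andP[yT yx]].
  split; last by rewrite y0 yT.
  by rewrite /ball/= ltr_norml; lra.
case: h0 => N [mN N0 hN].
have sN : `]a, b[ `<=` N.
  move=> y; rewrite /= in_itv/= => /sub[xy yT]; apply: hN => /= hy.
  by have := nz y xy yT; rewrite hy ?eqxx// /itvT/= in_itv.
have : (mu `]a, b[ <= mu N)%E by apply: le_measure; rewrite ?inE.
rewrite N0 leNgt lebesgue_measure_itv/= lte_fin ab.
by rewrite -EFinB lte_fin subr_gt0 ab.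
Qed.

Lemma weak_derivative_unique f g1 g2 : 0 < T -> is_weak_derivative T f g1 ->
  is_weak_derivative T f g2 -> ae_eq mu (itvT T) g1 g2.
Proof.
move=> T0 w1 w2; have [c1 e1] := weak_derivative_prim w1.
have [c2 e2] := weak_derivative_prim w2.
have [_ g12 _] := w1; have [_ g22 _] := w2.
have i1 := inL2_integrable g12; have i2 := inL2_integrable g22.
have h0 : forall x, 0 <= x <= T ->
    (c1 + prim T g1 x) - (c2 + prim T g2 x) = 0.
  apply: ae0_continuous => //.
    apply: continuous_subspaceT => x.
    by apply: cvgB; apply: cvgD;
      first [exact: cvg_cst|exact: prim_continuous].
  apply: filterS2 e1 e2.
  by move=> x + + xT => /(_ xT) <- /(_ xT) <-; rewrite subrr.
have d0 : ae_eq mu (itvT T) (fun x => g1 x - g2 x) (cst 0).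
  apply: (@prim_cst_ae0 _ _ _ (c2 - c1)); first exact: integrable_subR.
  move=> x /andP[x0 xT]; rewrite prim_subr//.
  by have := h0 x; rewrite !ltW// => /(_ isT); lra.
apply: filterS d0.
by move=> x /[apply] /= /eqP; rewrite subr_eq0 => /eqP.
Qed.

End FundamentalLemma.

(** * The space H^1_{0,} and the K-functional *)

Section H10.
Context {R : realType} (T : R).
Hypothesis T_gt0 : 0 < T.
Implicit Types (f g w : R -> R) (u v z : (R -> R) * (R -> R)).

(** The graph of the derivative on H^1_{0,}(0, T). Unlike [weak_derivative], which
    chooses a representative, it is visibly a linear relation. *)
Definition is_prim w g :=
  [/\ inL2 T w, inL2 T g & ae_eq mu (itvT T) w (prim T g)].

(** The continuous representative of w differs from the primitive of the weak
    derivative by a constant, which is zero as both vanish at 0. *)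
Lemma inH10_is_prim w : inH10 T w -> is_prim w (weak_derivative T w).
Proof.
move=> [w1 [fc [cfc fcw fc0]]].
have wd : is_weak_derivative T w (weak_derivative T w).
  by have [g wg] := w1; exact: (@xgetPex _ (fun=> 0) (is_weak_derivative T w)).
have [w2 g2 _] := wd; split => //.
have [c wc] := weak_derivative_prim wd.
suff c0 : c = 0 by apply: filterS wc => x /[apply] ->; rewrite c0 add0r.
have h0 : forall x, 0 <= x <= T -> fc x - (c + prim T (weak_derivative T w) x) = 0.
  apply: ae0_continuous => //.
    move=> x; apply: cvgB; first exact: cfc.
    apply: cvgD; first exact: cvg_cst.
    by move: x; apply: continuous_subspaceT; exact: prim_continuous.
  by apply: filterS2 fcw wc => x + + xT => /(_ xT) -> /(_ xT) ->; rewrite subrr.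
have := h0 0; rewrite fc0 prim_le0// addr0 sub0r lexx ltW// => /(_ isT) /eqP.
by rewrite oppr_eq0 => /eqP.
Qed.

Lemma is_prim_weak_derivative w g : is_prim w g -> is_weak_derivative T w g.
Proof.
move=> [w2 g2 wg]; have [p2 _ pg] := prim_weak_derivative g2; split => // phi tphi.
rewrite -pg//; have [_ cphi _] := tphi.
have mphi : measurable_fun (itvT T) (derive1 phi).
  by apply: measurable_funTS; exact: continuous_measurable_fun.
congr fine; apply: ae_eq_integral => //.
- by apply/measurable_EFinP; apply: measurable_funM => //; case: w2.
- by apply/measurable_EFinP; apply: measurable_funM => //; case: p2.
- by apply: filterS wg => x /[apply] ->.
Qed.

Lemma is_prim_inH10 w g : is_prim w g -> inH10 T w.
Proof.
move=> wg; split; first by exists g; exact: is_prim_weak_derivative.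
have [w2 g2 e] := wg; exists (prim T g); split.
- exact/continuous_subspaceT/prim_continuous.
- by apply: filterS e => x /[apply] ->.
- exact: prim_le0.
Qed.

Lemma is_prim_l2normsq w g : is_prim w g ->
  l2normsq T (weak_derivative T w) = l2normsq T g.
Proof.
move=> wg; have wd := is_prim_weak_derivative wg.
have wd' : is_weak_derivative T w (weak_derivative T w).
  by exact: (@xgetPex _ (fun=> 0) (is_weak_derivative T w) (ex_intro _ g wd)).
have [_ [mg _] _] := wd; have [_ [mg' _] _] := wd'.
apply: ae_eq_sqint => //; exact: weak_derivative_unique wd' wd.
Qed.

Lemma is_primD w1 w2 g1 g2 : is_prim w1 g1 -> is_prim w2 g2 ->
  is_prim (fun x => w1 x + w2 x) (fun x => g1 x + g2 x).
Proof.
move=> [w12 g12 e1] [w22 g22 e2]; split; try exact: sqintegrableD.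
apply: filterS2 e1 e2 => x + + xT => /(_ xT) -> /(_ xT) ->.
by rewrite prim_addr//; exact: inL2_integrable.
Qed.

Lemma is_primB w1 w2 g1 g2 : is_prim w1 g1 -> is_prim w2 g2 ->
  is_prim (fun x => w1 x - w2 x) (fun x => g1 x - g2 x).
Proof.
move=> [w12 g12 e1] [w22 g22 e2]; split; try exact: sqintegrableB.
apply: filterS2 e1 e2 => x + + xT => /(_ xT) -> /(_ xT) ->.
by rewrite prim_subr//; exact: inL2_integrable.
Qed.

Lemma is_primZ a w g : is_prim w g ->
  is_prim (fun x => a * w x) (fun x => a * g x).
Proof.
move=> [w2 g2 e]; split; try exact: sqintegrableZ.
apply: filterS e => x /[apply] ->.
by rewrite prim_scaler//; exact: inL2_integrable.
Qed.

Lemma is_prim0 : is_prim (cst 0) (cst 0).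
Proof.
have z2 : inL2 T (cst 0) by exact: sqintegrable0.
split => //; apply: aeW => x _.
by rewrite /prim /Rintegral integral0_eq// => y _; rewrite /cut patchE; case: ifP.
Qed.

Lemma is_prim_prim g : inL2 T g -> is_prim (prim T g) g.
Proof. by move=> g2; split => //; [exact: inL2_prim|exact: aeW]. Qed.

Lemma is_prim_eq w w' g : {in itvT T, w =1 w'} -> is_prim w g -> is_prim w' g.
Proof.
move=> ww' [[mw w2] g2 e]; split => //.
  split; first exact: eq_measurable_fun mw.
  by rewrite [X in (X < _)%E](_ : _ = sqint (itvT T) w)//; apply/esym/eq_sqint.
by apply: filterS e => x h xT; rewrite -ww' ?inE// h.
Qed.

Definition is_primS v u := is_prim v.1 u.1 /\ is_prim v.2 u.2.

Lemma inH10S_is_primS v :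
  inH10S T v -> is_primS v (weak_derivative T v.1, weak_derivative T v.2).
Proof. by move=> [h1 h2]; split; exact: inH10_is_prim. Qed.

Lemma is_primS_inH10S v u : is_primS v u -> inH10S T v.
Proof. by move=> [h1 h2]; split; [exact: is_prim_inH10 h1|exact: is_prim_inH10 h2]. Qed.

Lemma is_primS_h10_normsqS v u : is_primS v u -> h10_normsqS T v = l2normsqS T u.
Proof.
by move=> [v1 v2]; rewrite /h10_normsqS /l2normsqS/= (is_prim_l2normsq v1) (is_prim_l2normsq v2).
Qed.

Lemma is_primSB v v' u u' : is_primS v u -> is_primS v' u' ->
  is_primS (v - v') (u - u').
Proof. by move=> [? ?] [? ?]; split; exact: is_primB. Qed.

Lemma is_primS0 : is_primS 0 0.
Proof. by split; exact: is_prim0. Qed.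

Lemma inL2SB v v' : inL2S T v -> inL2S T v' -> inL2S T (v - v').
Proof. by move=> [? ?] [? ?]; split; exact: sqintegrableB. Qed.

Lemma is_primS_inL2S v u : is_primS v u -> inL2S T v.
Proof. by move=> [[? _ _] [? _ _]]. Qed.

Lemma is_primS_inL2Sr v u : is_primS v u -> inL2S T u.
Proof. by move=> [[_ ? _] [_ ? _]]. Qed.

Lemma l2normsqS_ge0 v : (0 <= l2normsqS T v)%E.
Proof. by rewrite adde_ge0//; exact: sqint_ge0. Qed.

Lemma h10_normsqS_ge0 v : (0 <= h10_normsqS T v)%E.
Proof. exact: l2normsqS_ge0. Qed.

Lemma l2normsqE f : l2normsq T f = sqint (itvT T) f.
Proof. by []. Qed.

Lemma l2normsqSD_le v v' : inL2S T v -> inL2S T v' ->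
  (l2normsqS T (v + v')%R <= 2%:E * l2normsqS T v + 2%:E * l2normsqS T v')%E.
Proof.
move=> [[m1 _] [m2 _]] [[m1' _] [m2' _]].
rewrite /l2normsqS !l2normsqE !(ge0_muleDr _ (sqint_ge0 _ _) (sqint_ge0 _ _)).
by rewrite [leRHS]addeACA; apply: leeD; exact: sqintD_le.
Qed.

Lemma l2normsqSB_le v v' : inL2S T v -> inL2S T v' ->
  (l2normsqS T (v - v')%R <= 2%:E * l2normsqS T v + 2%:E * l2normsqS T v')%E.
Proof.
move=> [[m1 _] [m2 _]] [[m1' _] [m2' _]].
rewrite /l2normsqS !l2normsqE !(ge0_muleDr _ (sqint_ge0 _ _) (sqint_ge0 _ _)).
by rewrite [leRHS]addeACA; apply: leeD; exact: sqintB_le.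
Qed.

Lemma K_sq_le (tau : R) v (w : (R -> R) * (R -> R)) : inH10S T w ->
  (K_sq T tau v <= l2normsqS T (v - w)%R + (tau ^+ 2)%:E * h10_normsqS T w)%E.
Proof. by move=> h; apply: ereal_inf_lbound; exists w. Qed.

Lemma K_sq_le_l2normsqS tau v : (K_sq T tau v <= l2normsqS T v)%E.
Proof.
apply: le_trans (K_sq_le tau v (is_primS_inH10S is_primS0)) _.
rewrite (is_primS_h10_normsqS is_primS0) subr0.
rewrite [X in (_ + _ * X)%E](_ : _ = 0%E) ?mule0 ?adde0//.
rewrite /l2normsqS /l2normsq/=.
by under eq_integral do rewrite expr0n; rewrite integral0 add0e.
Qed.

Lemma K_sq_ge0 tau v : (0 <= K_sq T tau v)%E.
Proof.
apply: le_ereal_inf_tmp => _ [w _ <-].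
by rewrite adde_ge0 ?l2normsqS_ge0// mule_ge0 ?l2normsqS_ge0// lee_fin sqr_ge0.
Qed.

(** By Cauchy-Schwarz, w x ^+ 2 <= x |g|^2. *)
Lemma sqint_prim_near0 w g tau : is_prim w g -> 0 < tau ->
  (sqint (`]0%R, tau[ `&` itvT T) w <= (tau ^+ 2)%:E * sqint (itvT T) g)%E.
Proof.
move=> [[mw w2] g2 wg] tau0.
have mD : measurable (`]0, tau[ `&` itvT T) by exact: measurableI.
rewrite (@ae_eq_sqint _ _ w (prim T g))//; last 3 first.
- exact: measurable_funS mw.
- exact: measurable_prim.
- by apply: filterS wg => x h [_ /h].
have gf := sqint_fin_num g2; set S := sqint (itvT T) g in gf *.
have S0 : 0 <= fine S by rewrite fine_ge0// sqint_ge0.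
apply: (@le_trans _ _ (\int[mu]_(x in `]0%R, tau[ `&` itvT T) cst (tau * fine S)%R%:E x)%E).
  apply: ge0_le_integral_nonmeas => x; first by rewrite lee_fin sqr_ge0.
  rewrite /= in_itv/= => -[/andP[x0 xt] _]; rewrite lee_fin.
  have := prim_sqr_leT g2 (ltW x0); rewrite (prim_le0 _ _ (lexx 0)) !subr0 => /le_trans; apply.
  by apply: ler_wpM2r => //; exact: ltW.
rewrite integral_cst// -[in leRHS](fineK gf) -EFinM.
apply: (@le_trans _ _ ((tau * fine S)%R%:E * mu `]0%R, tau[%classic)%E).
  apply: lee_wpmul2l; first by rewrite lee_fin mulr_ge0// ltW.
  by apply: le_measure; rewrite ?inE//; exact: subIsetl.
rewrite lebesgue_measure_itv/= lte_fin tau0 -EFinB -EFinM lee_fin subr0.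
by rewrite expr2 mulrAC.
Qed.

(** Functions of H^1_{0,} are small near t = 0, so that the K-functional controls
    the mass of z there. This is how the interpolation norm sees the boundary
    condition at t = 0. *)
Lemma sqint_near0_K_sq z tau : inL2S T z -> 0 < tau ->
  (sqint (`]0%R, tau[ `&` itvT T) z.1 <= 2%:E * K_sq T tau z)%E /\
  (sqint (`]0%R, tau[ `&` itvT T) z.2 <= 2%:E * K_sq T tau z)%E.
Proof.
move=> [[mz1 z1] [mz2 z2]] tau0.
have mD : measurable (`]0, tau[ `&` itvT T) by exact: measurableI.
have DT : `]0, tau[ `&` itvT T `<=` itvT T by exact: subIsetr.
have key f w g : measurable_fun (itvT T) f -> is_prim w g ->
  (sqint (`]0%R, tau[ `&` itvT T) f <=
   2%:E * (sqint (itvT T) (fun x => f x - w x)%R + (tau ^+ 2)%:E * sqint (itvT T) g))%E.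
  move=> mf wg; have [[mw _] _ _] := wg.
  have mfw : measurable_fun (itvT T) (fun x => f x - w x) by exact: measurable_funB.
  apply: (@le_trans _ _ (2%:E * sqint (`]0%R, tau[ `&` itvT T) (fun x => f x - w x)%R +
     2%:E * sqint (`]0%R, tau[ `&` itvT T) w)%E).
    apply: sqint_le2 => //.
    - exact: measurable_funS mfw.
    - exact: measurable_funS mw.
    by move=> x _; have := sqr_ge0 (f x - 2 * w x); lra.
  have h : (0 <= (tau ^+ 2)%:E * sqint (itvT T) g)%E.
    by rewrite mule_ge0 ?sqint_ge0// lee_fin sqr_ge0.
  rewrite (ge0_muleDr _ (sqint_ge0 _ _) h).
  apply: leeD; apply: lee_wpmul2l => //; last exact: sqint_prim_near0.
  exact: sqint_subset.
have half (a b : \bar R) : (a <= 2%:E * b)%E <-> ((2^-1)%:E * a <= b)%E.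
  by rewrite lee_pdivrMl.
split; apply/half; apply: le_ereal_inf_tmp => _ [w /= /inH10S_is_primS wg <-];
  rewrite -half (is_primS_h10_normsqS wg); have [wg1 wg2] := wg.
- apply: le_trans (key _ _ _ mz1 wg1) _; apply: lee_wpmul2l => //; apply: leeD.
    by rewrite /l2normsqS leeDl// sqint_ge0.
  by apply: lee_wpmul2l; rewrite ?lee_fin ?sqr_ge0// /l2normsqS leeDl// sqint_ge0.
- apply: le_trans (key _ _ _ mz2 wg2) _; apply: lee_wpmul2l => //; apply: leeD.
    by rewrite /l2normsqS leeDr// sqint_ge0.
  by apply: lee_wpmul2l; rewrite ?lee_fin ?sqr_ge0// /l2normsqS leeDr// sqint_ge0.
Qed.

End H10.

(** * The boundary integral operator *)

Section Delay.
Context {R : realType} (L T : R).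
Hypothesis L_gt0 : 0 < L.
Implicit Types (x t : R) (f g w : R -> R).

Definition delay f t := zero_ext f (t - L).

Lemma delayE f x : 0 < x < T -> delay f x = cut T f (x - L).
Proof.
move=> /andP[x0 xT]; rewrite /delay /zero_ext; case: ifPn => xL.
  by rewrite cutE// xL/=; have := L_gt0; lra.
by rewrite cut0// negb_and xL.
Qed.

Lemma measurable_shift (a : R) :
  measurable_fun setT ((fun x : R => x + a) : measurableTypeR R -> measurableTypeR R).
Proof. by apply: measurable_funD; [exact: measurable_id|exact: measurable_cst]. Qed.

Lemma measurable_delay f : measurable_fun (itvT T) f ->
  measurable_fun (itvT T) (delay f).
Proof.
move=> mf; have : measurable_fun (itvT T) (fun x => cut T f (x - L)).
  apply: measurable_funTS.
  by apply: (@measurableT_comp _ _ _ _ _ _ (cut T f)); [exact: measurable_cut|exact: measurable_shift].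
apply: eq_measurable_fun => x.
by rewrite inE /itvT/= in_itv/= => xT; rewrite delayE.
Qed.

Lemma sqint_delay f t : measurable_fun (itvT T) f -> t <= T ->
  sqint `]0, t[ (delay f) = sqint `]0, t - L[ f.
Proof.
move=> mf tT; rewrite (@eq_sqint _ _ _ (fun x => cut T f (x - L))); last first.
  move=> x; rewrite inE/= in_itv/= => /andP[x0 xt].
  by rewrite delayE// x0 (lt_le_trans xt).
have mc := measurable_cut mf.
have := @ge0_integral_shift R (- L) `](- L), (t - L)[ (fun x => (cut T f x ^+ 2)%:E).
rewrite /sqint (_ : (fun x => x - L) @^-1` _ = `]0, t[%classic); last first.
  by apply/seteqP; split => x/=; rewrite !in_itv/=; lra.
move=> ->//; last 2 first.
- by apply: measurable_sqr; exact: measurable_funTS.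
- by move=> x _; rewrite lee_fin sqr_ge0.
rewrite -/(sqint _ _) sqint_cut//; congr (sqint _ f); apply/seteqP.
have L0 := L_gt0.
by split => x; rewrite /itvT/= !in_itv/=; [move=> []; lra|move=> ?; split; lra].
Qed.

Lemma sqint_delay_le f : measurable_fun (itvT T) f ->
  (sqint (itvT T) (delay f) <= sqint (itvT T) f)%E.
Proof.
move=> mf; rewrite {1}/itvT sqint_delay//; apply: sqint_subset => //.
apply: subset_itvl; rewrite bnd_simp; have := L_gt0; lra.
Qed.

Lemma inL2_delay f : inL2 T f -> inL2 T (delay f).
Proof.
move=> [mf f2]; split; first exact: measurable_delay.
by apply: le_lt_trans f2; exact: sqint_delay_le.
Qed.

Lemma ae_eq_shift (a : R) f g : ae_eq mu setT f g ->
  ae_eq mu setT (fun x => f (x + a)) (fun x => g (x + a)).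
Proof.
move=> [N [mN N0 sub]]; exists ((fun x => x + a) @^-1` N); split.
- by rewrite -[X in measurable X]setTI; exact: measurable_shift.
- by rewrite -N0; exact: lebesgue_measure_shift.
- by move=> x h; apply: sub.
Qed.

Lemma prim_delay g x : 0 < x < T -> mu.-integrable (itvT T) (EFin \o g) ->
  prim T (delay g) x = prim T g (x - L).
Proof.
move=> /andP[x0 xT] ig; rewrite /prim.
have ic : mu.-integrable `]-oo, (x - L)] (EFin \o cut T g) by exact: integrable_cut.
have [_ <-] := integral_shift (- L) (measurable_itv _) ic.
rewrite (_ : (fun x => x - L) @^-1` _ = `]-oo, x]%classic); last first.
  by apply/seteqP; split => y/=; rewrite !in_itv/= lerD2r.
apply: eq_Rintegral => y; rewrite inE/= in_itv/= => yx.
have L0 := L_gt0.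
have [y0|y0] := ltP 0 y; first by rewrite cutE ?delayE// y0 (le_lt_trans yx).
rewrite !cut0// negb_and -!leNgt; last by rewrite y0.
by apply/orP; left; lra.
Qed.

(** The extension by zero of w has no jump at t = 0, so that delaying commutes with
    differentiation. *)
Lemma is_prim_delay w g : is_prim T w g -> is_prim T (delay w) (delay g).
Proof.
move=> [w2 g2 wg]; split; try exact: inL2_delay.
have e : ae_eq mu setT (cut T w) (cut T (prim T g)).
  apply: filterS wg => x h _; rewrite /cut !patchE; case: ifPn => // /set_mem.
  exact: h.
have e' := @ae_eq_shift (- L) _ _ e.
apply: filterS e' => x /(_ Logic.I) h; rewrite /itvT/= in_itv/= => xT.
rewrite delayE// h prim_delay//; last exact: inL2_integrable.
have [x0 xT'] := andP xT; have L0 := L_gt0.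
have [xL|xL] := ltP 0 (x - L); first by rewrite cutE// xL; lra.
by rewrite cut0 ?negb_and -?leNgt ?xL// prim_le0.
Qed.

End Delay.

Section Operator.
Context {R : realType} (L : R) (n : nat).
Hypothesis L_gt0 : 0 < L.
Let T := n.+1%:R * L.
Implicit Types (x t : R) (f g w : R -> R) (u v z : (R -> R) * (R -> R)).
Notation delay := (delay L).

Lemma final_time_gt0 : 0 < T.
Proof. by rewrite mulr_gt0. Qed.

Notation bie := (bie_op L).

Lemma bie_opB u v : bie (u - v) = bie u - bie v.
Proof.
have ze f g x : zero_ext (f - g) x = zero_ext f x - zero_ext g x.
  by rewrite /zero_ext; case: ifP; rewrite ?subrr.
congr (_, _); apply/funext => x.
  change (- 2^-1 * (u.1 x - v.1 x) + - 2^-1 * zero_ext (u.2 - v.2) (x - L) =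
   (- 2^-1 * u.1 x + - 2^-1 * zero_ext u.2 (x - L)) - (- 2^-1 * v.1 x + - 2^-1 * zero_ext v.2 (x - L))).
  by rewrite ze; ring.
change (- 2^-1 * (u.2 x - v.2 x) + - 2^-1 * zero_ext (u.1 - v.1) (x - L) =
   (- 2^-1 * u.2 x + - 2^-1 * zero_ext u.1 (x - L)) - (- 2^-1 * v.2 x + - 2^-1 * zero_ext v.1 (x - L))).
by rewrite ze; ring.
Qed.

Lemma bie_op1 v x : (bie v).1 x = - 2^-1 * v.1 x + - 2^-1 * delay v.2 x.
Proof. by []. Qed.

Lemma bie_op2 v x : (bie v).2 x = - 2^-1 * v.2 x + - 2^-1 * delay v.1 x.
Proof. by []. Qed.

Lemma inL2S_bie v : inL2S T v -> inL2S T (bie v).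
Proof.
move=> [v1 v2]; split.
  apply: (@sqintegrableD _ _ (fun x => - 2^-1 * v.1 x) (fun x => - 2^-1 * delay v.2 x)) => //;
  by apply: sqintegrableZ => //; exact: inL2_delay.
apply: (@sqintegrableD _ _ (fun x => - 2^-1 * v.2 x) (fun x => - 2^-1 * delay v.1 x)) => //;
by apply: sqintegrableZ => //; exact: inL2_delay.
Qed.

Lemma is_primS_bie v u : is_primS T v u -> is_primS T (bie v) (bie u).
Proof.
move=> [v1 v2]; split.
  apply: (@is_primD _ _ (fun x => - 2^-1 * v.1 x) (fun x => - 2^-1 * delay v.2 x));
  by apply: is_primZ => //; exact: is_prim_delay.
apply: (@is_primD _ _ (fun x => - 2^-1 * v.2 x) (fun x => - 2^-1 * delay v.1 x));
by apply: is_primZ => //; exact: is_prim_delay.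
Qed.

Lemma bie_op_bounded v : inL2S T v -> (l2normsqS T (bie v) <= l2normsqS T v)%E.
Proof.
move=> [[m1 _] [m2 _]]; rewrite /l2normsqS !l2normsqE.
have key f g : measurable_fun (itvT T) f -> measurable_fun (itvT T) g ->
  (sqint (itvT T) (fun x => - 2^-1 * f x + - 2^-1 * delay g x)%R <=
    (2^-1)%:E * sqint (itvT T) f + (2^-1)%:E * sqint (itvT T) g)%E.
  move=> mf mg.
  apply: (@le_trans _ _ ((2^-1)%:E * sqint (itvT T) f + (2^-1)%:E * sqint (itvT T) (delay g))%E).
    (* Young's inequality (a + b)^2 <= 2 a^2 + 2 b^2, with a and b halved. *)
    apply: sqint_le2 => //; first exact: measurable_delay.
    by move=> x _; have := sqr_ge0 (f x - delay g x); lra.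
  by apply: leeD => //; apply: lee_wpmul2l => //; exact: sqint_delay_le.
apply: le_trans (leeD (key _ _ m1 m2) (key _ _ m2 m1)) _.
rewrite [in leLHS](addeC ((2^-1)%:E * sqint _ v.2)%E) [leLHS]addeACA.
rewrite -!ge0_muleDl// -!EFinD (_ : 2^-1 + 2^-1 = 1 :> R); last by lra.
by rewrite !mul1e.
Qed.

(** Causality makes the operator invertible: on the first k + 1 time slices,
    v = - 2 A v - P v, where P v depends on v in the first k of them only. The
    squared norms N k thus satisfy N (k + 1) <= 8 |A v|^2 + 2 N k. *)
Lemma bie_op_stable v : inL2S T v ->
  (l2normsqS T v <= (8 * 2 ^+ n.+1)%:E * l2normsqS T (bie v))%E.
Proof.
move=> v2S; have [[m1 _] [m2 _]] := v2S.
have [[mb1 _] [mb2 _]] := inL2S_bie v2S.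
set A := l2normsqS T (bie v).
have A0 : (0 <= A)%E by exact: l2normsqS_ge0.
pose D (k : nat) : set R := `]0, (k%:R * L)[%classic.
have mD k : measurable (D k) by exact: measurable_itv.
have DT k : (k <= n.+1)%N -> D k `<=` itvT T.
  by move=> kn; apply: subset_itvl; rewrite bnd_simp ler_pM2r// ler_nat.
have DTn : D n.+1 = itvT T by [].
have step f g b k : (k < n.+1)%N -> measurable_fun (itvT T) f -> measurable_fun (itvT T) g ->
    measurable_fun (itvT T) b ->
    (forall x, b x = - 2^-1 * f x + - 2^-1 * delay g x) ->
    (sqint (D k.+1) f <= 8%:E * sqint (itvT T) b + 2%:E * sqint (D k) g)%E.
  move=> kn mf mg mb fb.
  apply: (@le_trans _ _ (8%:E * sqint (D k.+1) b + 2%:E * sqint (D k.+1) (delay g))%E).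
    apply: sqint_le2 => //.
    - by apply: measurable_funS mb => //; exact: DT.
    - apply: measurable_funS (measurable_delay L_gt0 mg) => //; exact: DT.
    - move=> x _; rewrite fb; have := sqr_ge0 (f x + 2 * delay g x); nra.
  apply: leeD; apply: lee_wpmul2l => //.
    by apply: sqint_subset => //; exact: DT.
  rewrite /D (sqint_delay (T := T))//; last by rewrite ler_pM2r// ler_nat.
  by rewrite -natr1 mulrDl mul1r addrK.
have main k : (k <= n.+1)%N ->
    (sqint (D k) v.1 + sqint (D k) v.2 <= (8 * (2 ^+ k - 1))%:E * A)%E.
  elim: k => [_|k IH kn].
    rewrite expr0 subrr mulr0 mul0e /D mul0r set_itvoo0.
    by rewrite /sqint !integral_set0 add0e.
  have h1 := step v.1 v.2 (bie v).1 k kn m1 m2 mb1 (bie_op1 v).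
  have h2 := step v.2 v.1 (bie v).2 k kn m2 m1 mb2 (bie_op2 v).
  apply: (le_trans (leeD h1 h2)).
  rewrite addeACA -(ge0_muleDr _ (sqint_ge0 _ _) (sqint_ge0 _ _)).
  rewrite -(ge0_muleDr _ (sqint_ge0 _ _) (sqint_ge0 _ _)) -!l2normsqE -/(l2normsqS T (bie v)).
  rewrite -/A (addeC (sqint _ _)).
  have h : (2%:E * (sqint (D k) v.1 + sqint (D k) v.2) <= (2 * (8 * (2 ^+ k - 1)))%:E * A)%E.
    by rewrite EFinM -muleA; apply: lee_wpmul2l => //; exact: IH (ltnW kn).
  apply: (le_trans (leeD (lexx _) h)).
  rewrite -ge0_muleDl//; last first.
    by rewrite lee_fin !mulr_ge0// subr_ge0 exprn_ege1// ler1n.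
  rewrite -EFinD; apply: lee_wpmul2r => //; rewrite lee_fin exprS; lra.
have := main n.+1 (leqnn _); rewrite DTn => /le_trans; apply.
by apply: lee_wpmul2r => //; rewrite lee_fin; lra.
Qed.

End Operator.

(** * Piecewise linear splines *)

Section Partitions.
Context {R : realType}.
Implicit Types (a b x t : R) (p : seq R) (e : R * R) (F : R -> R).

(** The elements of a partition with an arbitrary left end, as needed for induction
    on the partition. *)
Definition cells a p : seq (R * R) := zip (a :: p) p.

Lemma cells_cons a b p : cells a (b :: p) = (a, b) :: cells b p.
Proof. by []. Qed.

Lemma cellsP a p e : path <%R a p -> e \in cells a p ->
  [/\ a <= e.1, e.1 < e.2 & e.2 <= last a p].
Proof.
elim: p a => [//|b p IH] a /= /andP[ab bp]; rewrite inE => /predU1P[->|ep] /=.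
  split => //; have : all (<=%R b) (b :: p).
    rewrite /= lexx; apply/allP => y yp; apply: ltW.
    by have /allP := lt_path_min bp; apply.
  by move=> /allP; apply; exact: mem_last.
by have [be e12 el] := IH b bp ep; split => //; apply: le_trans be; exact: ltW.
Qed.

Lemma cells_order a p e e' : path <%R a p -> e \in cells a p ->
  e' \in cells a p -> [\/ e = e', e.2 <= e'.1 | e'.2 <= e.1].
Proof.
elim: p a => [//|b p IH] a /= /andP[ab bp].
rewrite !inE => /predU1P[->|ep] /predU1P[->|ep'] /=.
- exact: Or31.
- by apply: Or32; have [] := cellsP bp ep'.
- by apply: Or33; have [] := cellsP bp ep.
- exact: IH ep ep'.
Qed.

Lemma cells_unique a p e e' x : path <%R a p -> e \in cells a p ->
  e' \in cells a p -> e.1 < x < e.2 -> e'.1 <= x <= e'.2 -> e = e'.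
Proof.
move=> ap ep ep' /andP[x1 x2] /andP[x3 x4].
case: (cells_order ap ep ep') => // h; exfalso.
  by have := lt_le_trans x2 (le_trans h x3); rewrite ltxx.
by have := lt_le_trans x1 (le_trans x4 h); rewrite ltxx.
Qed.

Lemma cells_cover a p x : path <%R a p -> a < x <= last a p ->
  exists2 e, e \in cells a p & e.1 < x <= e.2.
Proof.
elim: p a => [a _ /=|b p IH a /= /andP[ab bp] /andP[ax xl]].
  by move=> /andP[/lt_le_trans] /[apply]; rewrite ltxx.
have [xb|bx] := leP x b; first by exists (a, b); rewrite ?inE ?eqxx//= ax.
have [|e ep xe] := IH b bp; first by rewrite bx.
by exists e => //; rewrite inE ep orbT.
Qed.

(** The primitive of the indicator of a cell: the ramps are the basis of the
    splines for which the coefficients are the slopes. *)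
Definition ramp e x := Num.min (Num.max (x - e.1) 0) (e.2 - e.1).

Lemma ramp_below e x : e.1 < e.2 -> x <= e.1 -> ramp e x = 0.
Proof.
move=> e12 xe; rewrite /ramp max_r ?subr_le0// min_l// subr_ge0; exact: ltW.
Qed.

Lemma ramp_above e x : e.1 < e.2 -> e.2 <= x -> ramp e x = e.2 - e.1.
Proof.
move=> e12 ex; rewrite /ramp max_l; last by rewrite subr_ge0 (le_trans (ltW e12)).
by rewrite min_r// lerD2r.
Qed.

Lemma ramp_in e x : e.1 <= x <= e.2 -> ramp e x = x - e.1.
Proof.
move=> /andP[x1 x2]; rewrite /ramp max_l ?subr_ge0// min_l// lerD2r//.
Qed.

Lemma ramp_continuous e : continuous (ramp e).
Proof.
have -> : ramp e = ((fun x => x - e.1) \max (cst 0)) \min (cst (e.2 - e.1)) by [].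
apply: min_fun_continuous; last exact: cst_continuous.
apply: max_fun_continuous; last exact: cst_continuous.
by move=> x; apply: cvgB; [exact: cvg_id|exact: cvg_cst].
Qed.

Definition slope F e := (F e.2 - F e.1) / (e.2 - e.1).

(** The piecewise linear interpolant of F - F a; as a combination of ramps it is a
    spline, with a known derivative, by linearity. *)
Definition interp_lin a p F x := \sum_(e <- cells a p) slope F e * ramp e x.

Definition interp_slope a p F x :=
  \sum_(e <- cells a p) slope F e * (\1_(`]e.1, e.2]%classic : set R) x : R).

Lemma interp_lin_below a p F x : path <%R a p -> x <= a -> interp_lin a p F x = 0.
Proof.
move=> ap xa; rewrite /interp_lin big_seq big1// => e ep.
have [ae e12 _] := cellsP ap ep.
by rewrite ramp_below ?mulr0// (le_trans xa).
Qed.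

Lemma interp_lin_in a p F e x : path <%R a p -> e \in cells a p ->
  e.1 <= x <= e.2 -> interp_lin a p F x = F e.1 - F a + slope F e * (x - e.1).
Proof.
elim: p a => [//|b p IH] a ap; rewrite cells_cons inE.
have /= /andP[ab bp] := ap.
rewrite /interp_lin cells_cons big_cons -/(interp_lin b p F x).
move=> /predU1P[->|ep] xe.
  move: xe => /= xe; rewrite ramp_in// subrr add0r.
  by rewrite interp_lin_below ?addr0//; case/andP : xe.
have [be e12 _] := cellsP bp ep.
have [x1 _] := andP xe.
rewrite ramp_above//=; last exact: le_trans be x1.
rewrite (IH b)// /slope/= divfK; last by rewrite subr_eq0 gt_eqF.
ring.
Qed.

Lemma interp_slope_in a p F e x : path <%R a p -> e \in cells a p ->
  e.1 < x <= e.2 -> interp_slope a p F x = slope F e.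
Proof.
elim: p a => [//|b p IH] a ap; rewrite cells_cons inE.
have /= /andP[ab bp] := ap.
rewrite /interp_slope cells_cons big_cons -/(interp_slope b p F x).
move=> /predU1P[->|ep] xe.
  move: xe => /= xe; rewrite indicE mem_set/=; last by rewrite in_itv.
  rewrite mulr1 /interp_slope big_seq big1 ?addr0// => e' ep'.
  have [be _ _] := cellsP bp ep'.
  rewrite indicE memNset ?mulr0//= in_itv/= => /andP[+ _].
  by case/andP : xe => _ xb; rewrite ltNge (le_trans xb be).
have [be e12 _] := cellsP bp ep.
rewrite indicE memNset/=; last first.
  rewrite in_itv/= => /andP[_ xb]; have /andP[] := xe.
  by rewrite ltNge (le_trans xb be).
by rewrite mulr0 add0r (IH b).
Qed.

End Partitions.

Section Splines.
Context {R : realType} (T : R) (p : seq R).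
Hypothesis T_gt0 : 0 < T.
Hypothesis p_part : itv_partition 0 T p.
Implicit Types (x t : R) (f g : R -> R) (e : R * R).

Lemma partition_path : path <%R 0 p. Proof. by case: p_part. Qed.

Lemma partition_last : last 0 p = T. Proof. by case: p_part => _ /eqP. Qed.

Lemma cells_in_T e : e \in cells 0 p -> [/\ 0 <= e.1, e.1 < e.2 & e.2 <= T].
Proof. by move=> /(cellsP partition_path); rewrite partition_last. Qed.

Lemma spline0_0 : spline0 T p (cst 0).
Proof.
split => //; first by apply: continuous_subspaceT; exact: cst_continuous.
by move=> e _; exists 0, 0 => t _; rewrite mul0r addr0.
Qed.

Lemma spline0D f g : spline0 T p f -> spline0 T p g ->
  spline0 T p (fun x => f x + g x).
Proof.
move=> [cf lf f0] [cg lg g0]; split; last by rewrite f0 g0 addr0.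
  by move=> x; apply: cvgD; [exact: cf|exact: cg].
move=> e ep; have [a [b fab]] := lf e ep; have [c [d gcd]] := lg e ep.
by exists (a + c), (b + d) => t te; rewrite fab// gcd//; ring.
Qed.

Lemma spline0Z k f : spline0 T p f -> spline0 T p (fun x => k * f x).
Proof.
move=> [cf lf f0]; split; last by rewrite f0 mulr0.
  by move=> x; apply: cvgMr; exact: cf.
move=> e ep; have [a [b fab]] := lf e ep.
by exists (k * a), (k * b) => t te; rewrite fab//; ring.
Qed.

Lemma spline0B f g : spline0 T p f -> spline0 T p g ->
  spline0 T p (fun x => f x - g x).
Proof.
move=> sf sg; have := spline0D sf (spline0Z (-1) sg).
by under [X in spline0 T p X -> _]funext do rewrite mulN1r.
Qed.

Lemma spline0_ramp e : e \in cells 0 p -> spline0 T p (ramp e).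
Proof.
move=> ep; have [e0 e12 eT] := cells_in_T ep; split.
- exact/continuous_subspaceT/ramp_continuous.
- move=> e' ep'; case: (cells_order partition_path ep ep') => [<-|h|h].
  + exists 1, (- e.1) => t; rewrite in_itv/= => /andP[t1 t2].
    by rewrite ramp_in ?mul1r// !ltW.
  + exists 0, (e.2 - e.1) => t; rewrite in_itv/= => /andP[t1 t2].
    by rewrite ramp_above ?mul0r ?add0r// (le_trans h)// ltW.
  + exists 0, 0 => t; rewrite in_itv/= => /andP[t1 t2].
    by rewrite ramp_below ?mul0r ?add0r// (le_trans _ h)// ltW.
- by rewrite ramp_below.
Qed.

Lemma spline0_sum (s : seq (R * R)) (c : R * R -> R) (phi : R * R -> R -> R) :
  (forall e, e \in s -> spline0 T p (phi e)) ->
  spline0 T p (fun x => \sum_(e <- s) c e * phi e x).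
Proof.
elim: s => [_|e s IH h].
  under [X in spline0 T p X]funext do rewrite big_nil; exact: spline0_0.
under [X in spline0 T p X]funext do rewrite big_cons.
apply: spline0D; first by apply/spline0Z/h; rewrite inE eqxx.
by apply: IH => e' es; apply: h; rewrite inE es orbT.
Qed.

Lemma spline0_interp_lin F : spline0 T p (interp_lin 0 p F).
Proof. exact/spline0_sum/spline0_ramp. Qed.

Lemma affine_closed_cell f c d a b : {within `[0, T], continuous f} ->
  0 <= c -> c < d -> d <= T ->
  (forall t, t \in `]c, d[ -> f t = a * t + b) ->
  forall t, c <= t <= d -> f t = a * t + b.
Proof.
move=> cf c0 cd dT fab.
have cf' : {within `[c, d], continuous f}.
  apply: continuous_subspaceW cf => x; rewrite /= !in_itv/= => /andP[cx xd].
  by rewrite (le_trans c0 cx) (le_trans xd dT).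
have [_ fc fd] := (continuous_within_itvP _ cd).1 cf'.
have ab t : a * x + b @[x --> t] --> a * t + b.
  by apply: cvgD; [apply: cvgMr; exact: cvg_id|exact: cvg_cst].
move=> t /andP[]; rewrite le_eqVlt => /predU1P[<- _|ct].
  apply: (cvg_unique _ fc) => //.
  apply: cvg_trans (cvg_at_right_filter (ab c)); apply: near_eq_cvg.
  near=> x; rewrite fab// in_itv/=; apply/andP; split; near: x.
    exact: nbhs_right_gt.
  exact: nbhs_right_lt.
rewrite le_eqVlt => /predU1P[->|td]; last by rewrite fab// in_itv/= ct.
apply: (cvg_unique _ fd) => //.
apply: cvg_trans (cvg_at_left_filter (ab d)); apply: near_eq_cvg.
near=> x; rewrite fab// in_itv/=; apply/andP; split; near: x.
  exact: nbhs_left_gt.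
exact: nbhs_left_lt.
Unshelve. all: by end_near. Qed.

(** A spline agrees with its interpolant, hence is a combination of ramps. *)
Lemma spline0_interp_linE f : spline0 T p f ->
  forall x, 0 <= x <= T -> f x = interp_lin 0 p f x.
Proof.
move=> [cf lf f0] x /andP[]; rewrite le_eqVlt => /predU1P[<- _|x0 xT].
  by rewrite interp_lin_below// partition_path.
have [|e ep /andP[x1 x2]] := @cells_cover _ 0 p x partition_path.
  by rewrite x0 partition_last.
have [e0 e12 eT] := cells_in_T ep.
rewrite (interp_lin_in _ partition_path ep) ?x2 ?ltW//.
have [a [b fab]] := lf e ep.
have key := affine_closed_cell cf e0 e12 eT fab.
have kx : f x = a * x + b by apply: key; rewrite x2 ltW.
have k1 : f e.1 = a * e.1 + b by apply: key; rewrite lexx ltW.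
have k2 : f e.2 = a * e.2 + b by apply: key; rewrite lexx ltW.
rewrite f0 subr0 /slope kx k1 k2.
by field; rewrite subr_eq0 gt_eqF.
Qed.

Lemma is_prim_ramp e : 0 <= e.1 -> e.1 < e.2 -> e.2 <= T ->
  is_prim T (ramp e) (\1_(`]e.1, e.2]%classic : set R) : R -> R).
Proof.
move=> e0 e12 eT.
have i2 : inL2 T (\1_(`]e.1, e.2]%classic : set R) : R -> R).
  apply: (@inL2_bounded _ _ _ 1) => [|x _].
    by apply: measurable_indic; exact: measurable_itv.
  by rewrite indicE; case: (_ \in _); rewrite ?normr1 ?normr0.
apply: is_prim_eq (is_prim_prim i2) => x.
rewrite inE /itvT/= in_itv/= => /andP[x0 xT].
rewrite /prim /Rintegral.
transitivity (fine (\int[mu]_(y in `]-oo, x]) (\1_(`]e.1, e.2]%classic : set R) y)%:E)%E).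
  congr fine; apply: eq_integral => y; rewrite inE/= in_itv/= => yx; have [y0|y0] := ltP 0 y.
    by rewrite cutE// y0 (le_lt_trans yx).
  rewrite cut0 ?negb_and -?leNgt ?y0// indicE memNset//= in_itv/= => /andP[+ _].
  by rewrite ltNge (le_trans y0).
rewrite integral_indic//.
rewrite (_ : _ `&` _ = `]e.1, (Num.min e.2 x)]%classic); last first.
  apply/seteqP; split => y /=; rewrite !in_itv/= le_min; first by move=> [/andP[-> ->] ->].
  by move=> /and3P[-> -> ->].
transitivity (fine (mu `]e.1, (Num.min e.2 x)]%classic)); first by [].
rewrite lebesgue_measure_itv/= lte_fin lt_min e12/=.
have [ex|xe] := ltP e.1 x; last by rewrite ramp_below.
have [e2x|xe2] := leP e.2 x; first by rewrite -EFinB/= ramp_above.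
by rewrite -EFinB/= ramp_in// !ltW.
Qed.

Lemma is_prim_sum (s : seq (R * R)) (c : R * R -> R) (phi psi : R * R -> R -> R) :
  (forall e, e \in s -> is_prim T (phi e) (psi e)) ->
  is_prim T (fun x => \sum_(e <- s) c e * phi e x)
            (fun x => \sum_(e <- s) c e * psi e x).
Proof.
elim: s => [_|e s IH h].
  under [X in is_prim T X _]funext do rewrite big_nil.
  under [X in is_prim T _ X]funext do rewrite big_nil.
  exact: is_prim0.
under [X in is_prim T X _]funext do rewrite big_cons.
under [X in is_prim T _ X]funext do rewrite big_cons.
apply: is_primD; first by apply/is_primZ/h; rewrite inE eqxx.
by apply: IH => e' es; apply: h; rewrite inE es orbT.
Qed.

Lemma is_prim_interp_lin F : is_prim T (interp_lin 0 p F) (interp_slope 0 p F).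
Proof.
by apply: is_prim_sum => e /cells_in_T[e0 e12 eT]; exact: is_prim_ramp.
Qed.

Lemma is_prim_spline0 f : spline0 T p f -> is_prim T f (interp_slope 0 p f).
Proof.
move=> sf; apply: is_prim_eq (is_prim_interp_lin f) => x.
rewrite inE /itvT/= in_itv/= => /andP[x0 xT].
by rewrite -spline0_interp_linE// !ltW.
Qed.

Definition ip f g := \int[mu]_(x in itvT T) (f x * g x).

Lemma ipC f g : ip f g = ip g f.
Proof. by apply: eq_Rintegral => x _; rewrite mulrC. Qed.

Lemma ipDl f1 f2 g : inL2 T f1 -> inL2 T f2 -> inL2 T g ->
  ip (fun x => f1 x + f2 x) g = ip f1 g + ip f2 g.
Proof.
move=> h1 h2 hg; rewrite /ip -RintegralD//; [|exact: sqintegrable_integrableM..].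
by apply: eq_Rintegral => x _; rewrite mulrDl.
Qed.

Lemma ipBl f1 f2 g : inL2 T f1 -> inL2 T f2 -> inL2 T g ->
  ip (fun x => f1 x - f2 x) g = ip f1 g - ip f2 g.
Proof.
move=> h1 h2 hg; rewrite /ip -RintegralB//; [|exact: sqintegrable_integrableM..].
by apply: eq_Rintegral => x _; rewrite mulrBl.
Qed.

Lemma ipZl k f g : inL2 T f -> inL2 T g -> ip (fun x => k * f x) g = k * ip f g.
Proof.
move=> h1 hg; rewrite /ip -RintegralZl//; last exact: sqintegrable_integrableM.
by apply: eq_Rintegral => x _; rewrite mulrA.
Qed.

Lemma ip_sqint f : inL2 T f -> (ip f f)%:E = sqint (itvT T) f.
Proof.
move=> f2; rewrite /ip /Rintegral fineK.
  by apply: eq_integral => x _; rewrite expr2.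
by apply: (integrable_fin_num (mu:=mu)) => //; exact: sqintegrable_integrableM.
Qed.

Lemma ip_ge0 f : 0 <= ip f f.
Proof. by apply: Rintegral_ge0 => x _; rewrite -expr2 sqr_ge0. Qed.

(** The degenerate case of the Cauchy-Schwarz inequality. *)
Lemma ip_null f g : inL2 T f -> inL2 T g -> ip g g = 0 -> ip f g = 0.
Proof.
move=> f2 g2 g0.
have key k : 0 <= ip f f - 2 * k * ip f g.
  have h := ip_ge0 (fun x => f x - k * g x).
  have g2' := sqintegrableZ k (measurable_itvT T) g2.
  have fg2 := sqintegrableB (measurable_itvT T) f2 g2'.
  have E u : inL2 T u -> ip u (fun x => f x - k * g x) = ip u f - k * ip u g.
    by move=> u2; rewrite ipC ipBl// ipZl// (ipC f) (ipC g).
  by move: h; rewrite (E _ fg2) (ipC (fun x => f x - _) f) (E _ f2)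
    (ipC (fun x => f x - _) g) (E _ g2) g0 (ipC g f); lra.
have [//|n0] := eqVneq (ip f g) 0; exfalso.
(* This k makes the nonnegative bound of [key] equal to - 1. *)
have := key ((ip f f + 1) / (2 * ip f g)).
have -> : 2 * ((ip f f + 1) / (2 * ip f g)) * ip f g = ip f f + 1 by field.
lra.
Qed.

(** Gram-Schmidt: the orthogonal projection onto the span of a finite family. The
    last clause records that the projection lies in this span. *)
Lemma projection_span (S : (R -> R) -> Prop) (s : seq (R * R))
    (phi : R * R -> R -> R) :
  S (cst 0) -> (forall f g, S f -> S g -> S (fun x => f x + g x)) ->
  (forall k f, S f -> S (fun x => k * f x)) ->
  (forall e, e \in s -> S (phi e) /\ inL2 T (phi e)) ->
  forall w, inL2 T w -> exists q, [/\ S q, inL2 T q,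
    forall e, e \in s -> ip q (phi e) = ip w (phi e) &
    forall u, inL2 T u -> (forall e, e \in s -> ip u (phi e) = 0) -> ip u q = 0].
Proof.
move=> S0 SD SZ; elim: s => [_ w w2|e0 s IH h w w2].
  exists (cst 0); split => //; first exact: sqintegrable0.
  move=> u _ _; rewrite /ip /Rintegral integral0_eq//= => x _; by rewrite mulr0.
have h' e : e \in s -> S (phi e) /\ inL2 T (phi e).
  by move=> es; apply: h; rewrite inE es orbT.
have [Se0 e02] : S (phi e0) /\ inL2 T (phi e0) by apply: h; rewrite inE eqxx.
have [q1 [Sq1 q12 q1w q1s]] := IH h' w w2.
have [q0 [Sq0 q02 q0w q0s]] := IH h' _ e02.
pose r x := phi e0 x + (-1) * q0 x.
have q02' := sqintegrableZ (-1) (measurable_itvT T) q02.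
have r2 : inL2 T r by exact: sqintegrableD.
have Sr : S r by apply: SD => //; exact: SZ.
have rs e : e \in s -> ip r (phi e) = 0.
  move=> es; have [_ e2] := h' e es.
  by rewrite /r ipDl// ipZl// q0w//; ring.
pose d x := w x - q1 x.
have d2 : inL2 T d by exact: sqintegrableB.
have ds e : e \in s -> ip d (phi e) = 0.
  by move=> es; have [_ e2] := h' e es; rewrite /d ipBl// q1w// subrr.
pose a := ip d r / ip r r.
have ar : a * ip r r = ip d r.
  have [r0|rn0] := eqVneq (ip r r) 0; last by rewrite /a divfK.
  by rewrite r0 mulr0 (ip_null d2 r2 r0).
have ar2 := sqintegrableZ a (measurable_itvT T) r2.
exists (fun x => q1 x + a * r x); split.
- by apply: SD => //; exact: SZ.
- exact: sqintegrableD.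
- move=> e; rewrite inE => /predU1P[->|es].
    have E u : inL2 T u -> ip u (phi e0) = ip u r + ip u q0.
      move=> u2; rewrite (ipC u r) /r ipDl// ipZl// (ipC (phi e0)) (ipC q0); ring.
    rewrite ipDl// ipZl// (E r r2) (q0s r r2 rs) addr0 ar.
    have h1 := E d d2; rewrite (q0s d d2 ds) addr0 in h1.
    by rewrite -h1 /d ipBl//; ring.
  have [_ e2] := h' e es.
  by rewrite ipDl// ipZl// rs// mulr0 addr0 q1w.
- move=> u u2 us; rewrite ipC ipDl// ipZl// (ipC q1) q1s//; last first.
    by move=> e es; apply: us; rewrite inE es orbT.
  rewrite add0r /r ipDl// ipZl// (ipC _ u) us ?inE ?eqxx// (ipC q0) q0s//; first by ring.
  by move=> e es; apply: us; rewrite inE es orbT.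
Qed.

Lemma spline0_projection w : inL2 T w -> exists q, spline0 T p q /\
  forall v, spline0 T p v -> ip q v = ip w v.
Proof.
move=> w2.
have hs e : e \in cells 0 p -> spline0 T p (ramp e) /\ inL2 T (ramp e).
  move=> ep; split; first exact: spline0_ramp.
  by have [] := is_prim_spline0 (spline0_ramp ep).
have [q [Sq q2 qw _]] := projection_span spline0_0 spline0D spline0Z hs w2.
exists q; split => // v sv.
have E u : inL2 T u -> ip u v = \sum_(e <- cells 0 p) slope v e * ip u (ramp e).
  move=> u2; transitivity (ip u (interp_lin 0 p v)).
    apply: eq_Rintegral => x; rewrite inE /itvT/= in_itv/= => /andP[x0 xT].
    by rewrite -spline0_interp_linE// !ltW.
  rewrite /interp_lin; elim: (cells 0 p) hs => [_|e s IH hs].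
    rewrite big_nil /ip /Rintegral integral0_eq//= => x _; by rewrite big_nil mulr0.
  have hs' e' : e' \in s -> spline0 T p (ramp e') /\ inL2 T (ramp e').
    by move=> es; apply: hs; rewrite inE es orbT.
  have [se e2] : spline0 T p (ramp e) /\ inL2 T (ramp e) by apply: hs; rewrite inE eqxx.
  rewrite big_cons -IH//.
  under [X in ip u X]funext do rewrite big_cons.
  rewrite ipC ipDl//; first by rewrite ipZl// ipC (ipC _ u).
    exact: sqintegrableZ.
  have ss : spline0 T p (fun x => \sum_(j <- s) slope v j * ramp j x).
    by apply: spline0_sum => e' /hs'[].
  by have [] := is_prim_spline0 ss.
rewrite !E//; apply: eq_big_seq => e ep; rewrite qw//.
Qed.

End Splines.

(** * The Galerkin approximation *)

Section TimeSlices.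
Context {R : realType} (L : R) (n : nat).
Hypothesis L_gt0 : 0 < L.
Let T := n.+1%:R * L.
Let T_gt0 : 0 < T := final_time_gt0 n L_gt0.
Implicit Types (x t : R) (p : seq R) (f : R -> R) (e : R * R).

(** The slice that contains the midpoint of e is covered by its elements, and two
    elements that overlap are equal. *)
Lemma element_in_slice p e : itv_partition 0 T p ->
  (forall j, (1 <= j <= n.+1)%N -> slice_union L p j) ->
  e \in elements p -> exists2 j, (1 <= j <= n.+1)%N & e \in slice_elements L p j.
Proof.
move=> pT su ep; have [e0 e12 eT] := cells_in_T pT ep.
(* The midpoint is interior to e, which makes e the only element through it. *)
pose x := (e.1 + e.2) / 2.
have xe : e.1 < x < e.2 by rewrite /x; lra.
have x0 : 0 <= x / L by rewrite divr_ge0 ?ltW//; have := xe; lra.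
have /andP[k1 k2] := truncn_itv x0; set k := Num.truncn _ in k1 k2.
have kn : (k < n.+1)%N.
  rewrite -(ltr_nat R); apply: le_lt_trans k1 _.
  by rewrite ltr_pdivrMr//; case/andP : xe => _ /lt_le_trans; apply.
exists k.+1 => //.
have := su k.+1 kn => /seteqP[_]/(_ x).
have h : `[k.+1.-1%:R * L, k.+1%:R * L]%classic x.
  by rewrite /= in_itv/= -ler_pdivlMr// k1 -ler_pdivrMr// ltW.
move=> /(_ h)[e' /= e's]; rewrite in_itv/= => xe'.
suff -> : e = e' by [].
have e'p : e' \in cells 0 p by move: e's; rewrite /slice_elements mem_filter => /andP[].
exact: (cells_unique (partition_path pT) ep e'p xe xe').
Qed.

Lemma delay_continuous f : {within `[0, T], continuous f} -> f 0 = 0 ->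
  {within `[0, T], continuous (delay L f)}.
Proof.
move=> /subspace_continuousP cf f0.
have -> : delay L f = f \o (fun t => Num.max 0 (t - L)).
  apply/funext => t; rewrite /delay /zero_ext /=; by case: ltP.
have cg : continuous (fun t => Num.max 0 (t - L) : R).
  have -> : (fun t => Num.max 0 (t - L)) = (cst 0) \max (fun x => x - L) by [].
  apply: max_fun_continuous; first exact: cst_continuous.
  by move=> x; apply: cvgB; [exact: cvg_id|exact: cvg_cst].
apply/subspace_continuousP => t /= tT.
have gT s : s \in `[0, T] -> Num.max 0 (s - L) \in `[0, T].
  have := L_gt0; rewrite !in_itv/= le_max lexx/= ge_max (ltW T_gt0) /=; lra.
have /= cfg := cf _ (gT t tT).
move=> A /cfg h; have := cg t _ h.
change (nbhs t (fun x => `[0, T]%classic (Num.max 0 (x - L)) -> A (f (Num.max 0 (x - L)))) ->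
  nbhs t (fun x => `[0, T]%classic x -> A (f (Num.max 0 (x - L))))).
by apply: filterS => x /= hx xT; apply: hx; exact: gT.
Qed.

(** An element of p1 lies in the first slice, where the delayed spline vanishes, or
    is the translate of an element of p2, on which the spline is affine. *)
Lemma spline0_delay p1 p2 f : itv_partition 0 T p1 -> itv_partition 0 T p2 ->
  (forall j, (1 <= j <= n.+1)%N -> slice_union L p1 j) ->
  (forall j, (1 <= j < n.+1)%N ->
     translate L (slice_elements L p2 j) = slice_elements L p1 j.+1) ->
  spline0 T p2 f -> spline0 T p1 (delay L f).
Proof.
move=> p1T p2T su tr [cf lf f0]; split.
- exact: delay_continuous.
- move=> e ep; have [[//|[|j]] jn ej] := element_in_slice p1T su ep.
    exists 0, 0 => t; rewrite mul0r addr0 in_itv/= => /andP[_ te].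
    move: ej; rewrite mem_filter => /andP[/andP[_]]; rewrite mul1r => eL _.
    by rewrite /delay /zero_ext ifF//; apply/negbTE; rewrite -leNgt; lra.
  move: ej; rewrite -tr// => /mapP[e' e's ->] /=.
  have e'p : e' \in elements p2 by move: e's; rewrite mem_filter => /andP[].
  have [e'0 _ _] := cells_in_T p2T e'p.
  have [a [b fab]] := lf e' e'p.
  exists a, (b - a * L) => t; rewrite in_itv/= => /andP[t1 t2].
  rewrite /delay /zero_ext ifT; last by lra.
  by rewrite fab; [ring|rewrite in_itv/=; lra].
- by rewrite /delay /zero_ext ifF// sub0r oppr_gt0; apply/negbTE; rewrite -leNgt ltW.
Qed.

Variable m : seq R * seq R.
Hypothesis m_mesh : is_mesh T m.
Hypothesis m_slices : time_slice_matching L n.+1 m.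
Implicit Types (u v z w q : (R -> R) * (R -> R)).

(** The operator P in A = - 1/2 (Id + P). *)
Definition swap_delay v : (R -> R) * (R -> R) := (delay L v.2, delay L v.1).

Lemma S10_swap_delay v : S10 T m v -> S10 T m (swap_delay v).
Proof.
have [p1 p2] := m_mesh; have [su tr] := m_slices.
move=> [v1 v2]; split => /=.
  apply: spline0_delay p1 p2 _ _ v2 => j jn; first by case: (su j jn).
  by case: (tr j jn).
apply: spline0_delay p2 p1 _ _ v1 => j jn; first by case: (su j jn).
by case: (tr j jn).
Qed.

Lemma S10B v w : S10 T m v -> S10 T m w -> S10 T m (v - w).
Proof. by move=> [v1 v2] [w1 w2]; split; exact: spline0B. Qed.

Lemma S10Z k v : S10 T m v -> S10 T m (fun x => k * v.1 x, fun x => k * v.2 x).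
Proof. by move=> [v1 v2]; split; exact: spline0Z. Qed.

Lemma S10_0 : S10 T m 0.
Proof. by split; exact: spline0_0. Qed.

Lemma S10_is_primS v : S10 T m v ->
  is_primS T v (interp_slope 0 m.1 v.1, interp_slope 0 m.2 v.2).
Proof.
by have [p1 p2] := m_mesh; move=> [v1 v2]; split; exact: is_prim_spline0.
Qed.

Lemma S10_inL2S v : S10 T m v -> inL2S T v.
Proof. by move=> /S10_is_primS; exact: is_primS_inL2S. Qed.

Lemma S10_bie v : S10 T m v -> S10 T m (bie_op L v).
Proof.
move=> vS; have [d1 d2] := S10Z (- 2^-1) (S10_swap_delay vS).
by have [v1 v2] := S10Z (- 2^-1) vS; split; exact: spline0D.
Qed.

(** The equation A v = q is solved by the iteration v := - 2 q - P v, which fixes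
    one more time slice per step. *)
Lemma bie_op_S10_onto q : S10 T m q -> exists2 v, S10 T m v &
  forall x, 0 < x <= T -> (bie_op L v).1 x = q.1 x /\ (bie_op L v).2 x = q.2 x.
Proof.
move=> qS; pose q2 : (R -> R) * (R -> R) := (fun x => -2 * q.1 x, fun x => -2 * q.2 x).
pose v_ k := iter k (fun v => q2 - swap_delay v) 0.
have vS k : S10 T m (v_ k).
  elim: k => [|k IH]; first exact: S10_0.
  by apply: S10B; [exact: S10Z|exact: S10_swap_delay].
have v1 k x : (v_ k.+1).1 x = -2 * q.1 x - delay L (v_ k).2 x by [].
have v2 k x : (v_ k.+1).2 x = -2 * q.2 x - delay L (v_ k).1 x by [].
have stab k x : 0 < x <= k%:R * L ->
    (v_ k.+1).1 x = (v_ k).1 x /\ (v_ k.+1).2 x = (v_ k).2 x.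
  elim: k x => [x|k IH x /andP[x0 xk]]; first by rewrite mul0r; lra.
  rewrite !v1 !v2 /delay /zero_ext; case: ifPn => // xL.
  have [|-> ->//] := IH (x - L).
  by rewrite xL/= lerBlDr -{2}[L]mul1r -mulrDl natr1.
exists (v_ n.+1) => // x /stab[h1 h2].
by rewrite bie_op1 bie_op2; move: h1 h2; rewrite v1 v2; lra.
Qed.

Lemma pairingE u v : pairing T u v = ip T u.1 v.1 + ip T u.2 v.2.
Proof. by []. Qed.

Lemma pairing_eq u u' v : (forall x, 0 < x < T -> u.1 x = u'.1 x /\ u.2 x = u'.2 x) ->
  pairing T u v = pairing T u' v.
Proof.
move=> uu'; congr (_ + _); apply: eq_Rintegral => x.
  by rewrite inE /itvT/= in_itv/= => /uu'[-> _].
by rewrite inE /itvT/= in_itv/= => /uu'[_ ->].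
Qed.

Lemma pairingBl u u' v : inL2S T u -> inL2S T u' -> inL2S T v ->
  pairing T (u - u') v = pairing T u v - pairing T u' v.
Proof.
move=> [u1 u2] [u'1 u'2] [v1 v2]; rewrite !pairingE /=.
rewrite [X in X + _](_ : _ = ip T u.1 v.1 - ip T u'.1 v.1); last exact: ipBl.
rewrite [X in _ + X](_ : _ = ip T u.2 v.2 - ip T u'.2 v.2); last exact: ipBl.
by rewrite opprD addrACA.
Qed.

Lemma pairing_l2normsqS u : inL2S T u -> (pairing T u u)%:E = l2normsqS T u.
Proof. by move=> [u1 u2]; rewrite pairingE EFinD !ip_sqint. Qed.

(** The Galerkin solution for the datum A z. As a relation between z and zh it is
    linear, which is what the interpolation argument needs. *)
Definition galerkin_approx z zh := S10 T m zh /\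
  forall vh, S10 T m vh ->
    pairing T (bie_op L zh) vh = pairing T (bie_op L z) vh.

Lemma galerkin_approxB z zh w wh : inL2S T z -> inL2S T w ->
  galerkin_approx z zh -> galerkin_approx w wh -> galerkin_approx (z - w) (zh - wh).
Proof.
move=> z2 w2 [zhS zg] [whS wg]; split; first exact: S10B.
move=> vh vhS; rewrite !bie_opB !pairingBl; first by rewrite zg// wg.
all: by [apply: inL2S_bie|apply: S10_inL2S|apply: inL2S_bie => //; exact: S10_inL2S].
Qed.

Lemma galerkin_approx_id v : S10 T m v -> galerkin_approx v v.
Proof. by []. Qed.

(** The projection of A z is a spline, which A attains. *)
Lemma galerkin_approx_exists z : inL2S T z -> exists zh, galerkin_approx z zh.
Proof.
move=> z2; have [b1 b2] := inL2S_bie L_gt0 z2; have [p1 p2] := m_mesh.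
have [q1 [q1S q1z]] := spline0_projection p1 b1.
have [q2 [q2S q2z]] := spline0_projection p2 b2.
have [zh zhS zhq] := @bie_op_S10_onto (q1, q2) (conj q1S q2S).
exists zh; split => // vh [v1 v2].
rewrite (pairing_eq (u' := (q1, q2))); last first.
  by move=> x /andP[x0 xT]; apply: zhq; rewrite x0 ltW.
by rewrite !pairingE q1z// q2z.
Qed.

(** A zh is the orthogonal projection of A z, hence not larger, and A has a bounded
    inverse. *)
Lemma galerkin_approx_l2_le z zh : inL2S T z -> galerkin_approx z zh ->
  (l2normsqS T zh <= (8 * 2 ^+ n.+1)%:E * l2normsqS T z)%E.
Proof.
move=> z2 [zhS zg]; have bz2 := inL2S_bie L_gt0 z2.
have qS := S10_bie zhS; have zh2 := S10_inL2S zhS; have q2 := S10_inL2S qS.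
apply: le_trans (bie_op_stable L_gt0 zh2) _.
apply: lee_wpmul2l; first by rewrite lee_fin mulr_ge0// exprn_ge0.
apply: le_trans (bie_op_bounded L_gt0 z2).
rewrite -!pairing_l2normsqS// lee_fin.
have d2 := inL2SB bz2 q2.
have C u v : pairing T u v = pairing T v u by rewrite !pairingE !(ipC _ u.1) !(ipC _ u.2).
have : 0 <= pairing T (bie_op L z - bie_op L zh) (bie_op L z - bie_op L zh).
  by rewrite pairingE addr_ge0// ip_ge0.
rewrite pairingBl// (C _ (_ - _)) pairingBl// (C _ (_ - _)) pairingBl//.
have := C (bie_op L zh) (bie_op L z); have := zg _ qS; lra.
Qed.

Lemma galerkin_error_l2 z zh : inL2S T z -> galerkin_approx z zh ->
  (l2normsqS T (z - zh)%R <= (2 + 2 * (8 * 2 ^+ n.+1))%:E * l2normsqS T z)%E.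
Proof.
move=> z2 zg; have [zhS _] := zg; have zh2 := S10_inL2S zhS.
apply: le_trans (l2normsqSB_le z2 zh2) _.
have := galerkin_approx_l2_le z2 zg.
have two0 : (0 <= 2%:E :> \bar R)%E by [].
move=> /(lee_wpmul2l two0) h.
apply: le_trans (leeD (lexx _) h) _.
by rewrite muleA -EFinM -ge0_muleDl// lee_fin !mulr_ge0// exprn_ge0.
Qed.

Variable c : R.
Hypothesis m_adm : S10_admissible T c m.

(** Since A commutes with the derivative, the H^1-stability of the projection is a
    bound of A uh by A u in L^2, to which the stability of A in L^2 applies. *)
Lemma galerkin_error_h10 z u zh : is_primS T z u -> galerkin_approx z zh ->
  exists2 uh, is_primS T (z - zh) uh &
  (l2normsqS T uh <= (2 + 2 * (8 * 2 ^+ n.+1 * c ^+ 2))%:E * l2normsqS T u)%E.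
Proof.
move=> zu zg; have [zhS zgal] := zg.
have zhu := S10_is_primS zhS; set uh := (_, _) in zhu.
exists (u - uh); first exact: is_primSB.
have u2 := is_primS_inL2Sr zu; have uh2 := is_primS_inL2Sr zhu.
have bzu := is_primS_bie L_gt0 zu; have bzhu := is_primS_bie L_gt0 zhu.
have proj : is_L2_projection T m (bie_op L z) (bie_op L zh).
  by split => //; exact: S10_bie.
have := m_adm (is_primS_inH10S bzu) proj.
rewrite /h10_normS (is_primS_h10_normsqS T_gt0 bzu) (is_primS_h10_normsqS T_gt0 bzhu).
move=> h.
have adm : (l2normsqS T (bie_op L uh) <= (c ^+ 2)%:E * l2normsqS T (bie_op L u))%E.
  have g1 := l2normsqS_ge0 T (bie_op L uh); have g2 := l2normsqS_ge0 T (bie_op L u).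
  rewrite -(sqr_sqrte g1) -(sqr_sqrte g2).
  apply: (@le_trans _ _ ((`|c|%:E * sqrte (l2normsqS T (bie_op L u))) ^+ 2)%E).
    rewrite lee_sqr//; [|exact: sqrte_ge0|by rewrite mule_ge0 ?sqrte_ge0// lee_fin].
    apply: le_trans h _; apply: lee_wpmul2r; first exact: sqrte_ge0.
    by rewrite lee_fin ler_norm.
  by rewrite !expe2 muleACA -EFinM -expr2 real_normK ?num_real// -expr2 expe2.
apply: le_trans (l2normsqSB_le u2 uh2) _.
have st : (l2normsqS T uh <= (8 * 2 ^+ n.+1 * c ^+ 2)%:E * l2normsqS T u)%E.
  apply: le_trans (bie_op_stable L_gt0 uh2) _.
  rewrite (EFinM _ (c ^+ 2)) -muleA.
  apply: lee_wpmul2l; first by rewrite lee_fin mulr_ge0// exprn_ge0.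
  apply: le_trans adm _; apply: lee_wpmul2l; first by rewrite lee_fin sqr_ge0.
  exact: bie_op_bounded.
have two0 : (0 <= 2%:E :> \bar R)%E by [].
have := st => /(lee_wpmul2l two0) h'.
apply: le_trans (leeD (lexx _) h') _.
have C0 : 0 <= 8 * 2 ^+ n.+1 * c ^+ 2.
  by rewrite mulr_ge0 ?sqr_ge0// mulr_ge0// exprn_ge0.
by rewrite muleA -EFinM -ge0_muleDl// lee_fin mulr_ge0.
Qed.

End TimeSlices.

(** * Interpolation errors *)

Lemma measurable_slobodeckij_kernel {R : realType} (T r : R) (f : R -> R) :
  measurable_fun (itvT T) f ->
  measurable_fun (itvT T `*` itvT T)
    (fun z : measurableTypeR R * measurableTypeR R =>
       (`|f z.1 - f z.2| ^+ 2 / `|z.1 - z.2| `^ r)%:E).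
Proof.
move=> mf; have mfc := measurable_cut mf.
have m1 := @measurable_fst _ _ (measurableTypeR R) (measurableTypeR R).
have m2 := @measurable_snd _ _ (measurableTypeR R) (measurableTypeR R).
pose D (z : measurableTypeR R * measurableTypeR R) : R :=
  `|cut T f z.1 - cut T f z.2| ^+ 2 * `|z.1 - z.2| `^ (- r).
have mD : measurable_fun setT D.
  apply: measurable_funM.
    apply: measurable_funX; apply: measurableT_comp => //.
    by apply: measurable_funB; exact: measurableT_comp.
  apply: (@measurableT_comp _ _ _ _ _ _ (fun z : R => z `^ (- r))).
    exact: measurable_powR.
  by apply: measurableT_comp => //; exact: measurable_funB.
apply/measurable_EFinP; move: mD => /(measurable_funTS (D := itvT T `*` itvT T)).
apply: eq_measurable_fun => -[x y]; rewrite inE/= => -[xT yT].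
by rewrite /D/= !cut_in ?inE// powRN.
Qed.

(** Cauchy-Schwarz for c - g, the mean of which is c minus the mean of g. *)
Lemma sqr_sub_mean_le {R : realType} (D : set R) (l c : R) (g : R -> R) :
  measurable D -> 0 < l -> mu D = l%:E -> sqintegrable D g ->
  (((c - (\int[mu]_(y in D) g y) / l) ^+ 2)%:E <=
   l^-1%:E * sqint D (fun y => c - g y)%R)%E.
Proof.
move=> mD l0 mue gD.
have muy : (mu D < +oo)%E by rewrite [X in (X < _)%E]mue ltry.
have ige := sqintegrable_integrable mD muy gD.
have cx2 : sqintegrable D (cst c) by exact: sqintegrable_cst.
have d2 : sqintegrable D (fun y => c - g y) by exact: sqintegrableB.
have := Rintegral_sqr_le mD muy d2.
rewrite RintegralB//; last exact: sqintegrable_integrable cx2.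
have hc : \int[mu]_(_ in D) c = c * l.
  by rewrite Rintegral_cst// [X in fine X]mue.
rewrite hc [X in (_ <= X * _)%E -> _]mue.
set I := \int[mu]_(z in _) g z => H.
have -> : (c - I / l) ^+ 2 = l^-1 * (l^-1 * (c * l - I) ^+ 2).
  by field; rewrite gt_eqF.
rewrite EFinM; apply: lee_wpmul2l; first by rewrite lee_fin invr_ge0 ltW.
rewrite EFinM; apply: (@le_trans _ _ (l^-1%:E * (l%:E * sqint D (fun y : R => c - g y)%R))%E).
  by apply: lee_wpmul2l => //; rewrite lee_fin invr_ge0 ltW.
by rewrite muleA -EFinM mulVf ?mul1e// gt_eqF.
Qed.

Section Interpolation.
Context {R : realType} (T : R) (p : seq R) (h : R).
Hypothesis T_gt0 : 0 < T.
Hypothesis p_part : itv_partition 0 T p.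
Hypothesis h_gt0 : 0 < h.
Hypothesis p_width : forall e, e \in cells 0 p -> e.2 - e.1 <= h.
Implicit Types (x y t : R) (f g w : R -> R) (e : R * R).

Lemma cell_of x : 0 < x < T -> exists2 e, e \in cells 0 p & e.1 < x <= e.2.
Proof.
move=> /andP[x0 xT]; apply: cells_cover (partition_path p_part) _.
by rewrite x0 (partition_last p_part) ltW.
Qed.

(** By Tonelli's theorem: a point belongs to the windows of half-width h around the
    points of an interval of length 2 h. *)
Lemma window_sqint_le f g (k : R) : measurable_fun (itvT T) g -> 0 <= k ->
  (forall x, 0 < x < T ->
    ((f x ^+ 2)%:E <= k%:E * sqint `[(x - h)%R, (x + h)%R] (cut T g))%E) ->
  (sqint (itvT T) f <= (k * (2 * h))%:E * sqint (itvT T) g)%E.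
Proof.
move=> mg k0 fg; pose G := cut T g.
have mG : measurable_fun setT G by exact: measurable_cut.
pose W x y : \bar R := ((\1_(`[(x - h), (x + h)]%classic : set R) y : R) * G y ^+ 2)%:E.
have WE x y : W x y = ((\1_(`[(y - h), (y + h)]%classic : set R) x : R) * G y ^+ 2)%:E.
  rewrite /W !indicE (_ : (y \in _) = (x \in `[(y - h), (y + h)]%classic))//.
  by apply/idP/idP; rewrite !inE/= !in_itv/=; lra.
have mW : measurable_fun (itvT T `*` setT) (fun z : measurableTypeR R * measurableTypeR R => W z.1 z.2).
  apply/measurable_EFinP; apply: measurable_funM; last first.
    apply: measurable_funX.
    by apply: (@measurableT_comp _ _ _ _ _ _ G) => //; exact: measurable_funTS measurable_snd.
  have mi : measurable_fun setT (\1_(`[- h, h]%classic : set R) : R -> R) by exact: measurable_indic.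
  have := measurable_fun_comp_diff mi; move=> /(measurable_funTS (D := itvT T `*` setT)).
  apply: eq_measurable_fun => -[x y] _ /=.
  rewrite !indicE (_ : (x - y \in _) = (y \in `[(x - h), (x + h)]%classic))//.
  by apply/idP/idP; rewrite !inE/= !in_itv/=; lra.
have W0 x y : (0 <= W x y)%E.
  by rewrite lee_fin mulr_ge0 ?sqr_ge0// indicE.
have EW x : sqint `[(x - h)%R, (x + h)%R] G = (\int[mu]_y W x y)%E.
  rewrite /sqint integral_mkcond; apply: eq_integral => y _.
  by rewrite patchE /W indicE; case: ifP; rewrite ?mul1r ?mul0r.
have mWx : measurable_fun (itvT T) (fun x => \int[mu]_y W x y)%E.
  by apply: measurable_fun_tonelli mW _ => //.
apply: (@le_trans _ _ (k%:E * \int[mu]_(x in itvT T) \int[mu]_y W x y)%E).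
  rewrite -ge0_integralZl_EFin//; last by move=> x _; exact: integral_ge0.
  apply: ge0_le_integral_nonmeas => x; first by rewrite lee_fin sqr_ge0.
  by rewrite /itvT/= in_itv/= => xT; rewrite -EW; exact: fg.
rewrite EFinM -muleA; apply: lee_wpmul2l => //.
rewrite tonelli_set// -(sqint_cutT T g) /sqint -ge0_integralZl_EFin//; last 3 first.
- by move=> y _; rewrite lee_fin sqr_ge0.
- exact: measurable_sqr.
- by rewrite mulr_ge0// ltW.
apply: ge0_le_integral_nonmeas => y _; first exact: integral_ge0.
under eq_integral do rewrite WE mulrC EFinM.
rewrite ge0_integralZl_EFin ?sqr_ge0//; last first.
  by apply/measurable_EFinP; exact: measurable_indic.
rewrite muleC; apply: lee_wpmul2r; first by rewrite lee_fin sqr_ge0.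
rewrite integral_indic//.
apply: (@le_trans _ _ (mu `[(y - h), (y + h)])%R).
  by apply: le_measure; rewrite ?inE//; first [exact: measurableI|exact: subIsetl].
rewrite lebesgue_measure_itv/= lte_fin; case: ifP => _; last by rewrite lee_fin mulr_ge0// ltW.
by rewrite -EFinB lee_fin; lra.
Qed.

Lemma prim_window g x y z : inL2 T g -> x - h <= y -> y <= z -> z <= x + h ->
  (prim T g z - prim T g y) ^+ 2 <=
    (z - y) * fine (sqint `[(x - h)%R, (x + h)%R] (cut T g)).
Proof.
move=> g2 xy yz zx; have c2 := sqintegrable_cut (measurable_itv `[(x - h), (x + h)]) g2.
have mc : measurable_fun setT (cut T g) by apply: measurable_cut; case: g2.
rewrite -lee_fin [leRHS]EFinM fineK; last exact: sqint_fin_num.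
apply: le_trans (prim_sqr_le g2 yz) _; apply: lee_wpmul2l.
  by rewrite lee_fin subr_ge0.
apply: sqint_subset => //; first by apply: measurable_funTS.
by move=> t /=; rewrite !in_itv/=; lra.
Qed.

(** On its cell, the interpolant of the primitive is a convex combination of values
    at points within distance h. *)
Lemma interp_lin_l2_error w g : is_prim T w g ->
  (sqint (itvT T) (fun x => w x - interp_lin 0 p (prim T g) x)%R <=
   (h * (2 * h))%:E * sqint (itvT T) g)%E.
Proof.
move=> [[mw w2] g2 wg].
have [[mI _] _ _] := is_prim_interp_lin p_part (prim T g).
have mp : measurable_fun (itvT T) (prim T g) by exact: measurable_prim.
rewrite (@ae_eq_sqint _ _ _ (fun x => prim T g x - interp_lin 0 p (prim T g) x))//; last 3 first.
- exact: measurable_funB.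
- exact: measurable_funB.
- by apply: filterS wg => x /[apply] ->.
apply: window_sqint_le; [by case: g2|exact: ltW|move=> x xT].
have [e ep xe] := cell_of xT; have [e1x xe2] := andP xe.
have [e0 e12 eT] := cells_in_T p_part ep.
have eh := p_width ep.
have c2 := sqintegrable_cut (measurable_itv `[(x - h), (x + h)]) g2.
rewrite -(fineK (sqint_fin_num c2)) -EFinM lee_fin.
set S := fine _; have S0 : 0 <= S by rewrite fine_ge0// sqint_ge0.
rewrite (interp_lin_in _ (partition_path p_part) ep) ?(ltW e1x)//.
rewrite (prim_le0 _ _ (lexx 0)) subr0 /slope.
have h1 : (prim T g x - prim T g e.1) ^+ 2 <= (x - e.1) * S.
  by apply: prim_window => //; lra.
have h2 : (prim T g e.2 - prim T g x) ^+ 2 <= (e.2 - x) * S.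
  by apply: prim_window => //; lra.
set A := prim T g x - prim T g e.1 in h1; set B := prim T g e.2 - prim T g x in h2.
pose l := (x - e.1) / (e.2 - e.1).
have l01 : 0 <= l <= 1.
  by rewrite /l divr_ge0 ?ler_pdivrMr; lra.
have -> : prim T g x - (prim T g e.1 + (prim T g e.2 - prim T g e.1) / (e.2 - e.1) * (x - e.1))
    = (1 - l) * A - l * B.
  by rewrite /l /A /B; field; rewrite gt_eqF// subr_gt0.
have h1' : A ^+ 2 <= h * S by apply: le_trans h1 _; apply: ler_wpM2r => //; lra.
have h2' : B ^+ 2 <= h * S by apply: le_trans h2 _; apply: ler_wpM2r => //; lra.
apply: (@le_trans _ _ ((1 - l) * A ^+ 2 + l * B ^+ 2)).
  have : 0 <= l * (1 - l) * (A + B) ^+ 2 by rewrite mulr_ge0 ?sqr_ge0// mulr_ge0//; lra.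
  lra.
have [l0 l1] := andP l01.
have := ler_wpM2l l0 h2'; have l1' : 0 <= 1 - l by lra.
have := ler_wpM2l l1' h1'; lra.
Qed.

(** On each cell the slope of the interpolant is the mean of the derivative. *)
Lemma interp_slope_error g e x : inL2 T g -> e \in cells 0 p -> e.1 < x <= e.2 ->
  x < T ->
  (((g x - interp_slope 0 p (prim T g) x) ^+ 2)%:E <=
   (e.2 - e.1)^-1%:E * sqint `]e.1, e.2[ (fun y => g x - g y)%R)%E.
Proof.
move=> g2 ep xe xT; have [e0 e12 eT] := cells_in_T p_part ep.
rewrite (interp_slope_in _ (partition_path p_part) ep xe) /slope.
have ig := inL2_integrable g2.
rewrite primB//; last exact: ltW.
set l := e.2 - e.1; have l0 : 0 < l by rewrite subr_gt0.
have sub : `]e.1, e.2[ `<=` itvT T.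
  by apply: subset_itv; rewrite bnd_simp.
have g2e : sqintegrable `]e.1, e.2[ g by exact: sqintegrableS sub g2.
have mue : mu `]e.1, e.2[ = l%:E by rewrite lebesgue_measure_itv/= lte_fin e12.
have E : \int[mu]_(z in `]e.1, e.2]) cut T g z = \int[mu]_(z in `]e.1, e.2[) g z.
  rewrite -Rintegral_itv_bndo_bndc; last exact: integrable_cut.
  by apply: eq_Rintegral => z /set_mem/sub zT; rewrite cut_in// inE.
rewrite E; exact: sqr_sub_mean_le mue g2e.
Qed.

(** On a cell of length l <= h, the kernel of the seminorm is at least
    l^(- 1 - 2 theta), to be compared with the factor 1 / l of the mean. *)
Lemma slobodeckij_interp_error g theta : inL2 T g -> 0 < theta ->
  (sqint (itvT T) (fun x => g x - interp_slope 0 p (prim T g) x)%R <=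
   (h `^ (2 * theta))%:E * slobodeckij_sq T theta g)%E.
Proof.
move=> g2 th0; have [mg _] := g2; rewrite /slobodeckij_sq.
pose D x y := (`|g x - g y| ^+ 2 / `|x - y| `^ (1 + 2 * theta)).
have D0 x y : 0 <= D x y by rewrite divr_ge0 ?sqr_ge0// powR_ge0.
have key x : 0 < x < T -> (((g x - interp_slope 0 p (prim T g) x) ^+ 2)%:E <=
   (h `^ (2 * theta))%:E * \int[mu]_(y in itvT T) (D x y)%:E)%E.
  move=> xT; have [e ep xe] := cell_of xT; have [e1x xe2] := andP xe.
  have [e0 e12 eT] := cells_in_T p_part ep; have [x0 xT'] := andP xT.
  have eh := p_width ep.
  apply: le_trans (interp_slope_error g2 ep xe xT') _.
  have sub : `]e.1, e.2[ `<=` itvT T by apply: subset_itv; rewrite bnd_simp.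
  have mgx : measurable_fun (itvT T) (fun y => g x - g y).
    by apply: measurable_funB => //; exact: measurable_cst.
  have mD : measurable_fun (itvT T) (fun y => (D x y)%:E).
    apply/measurable_EFinP; apply: measurable_funM.
      by apply: measurable_funX; apply: measurableT_comp.
    rewrite (_ : (fun y => _) = (fun y => `|x - y| `^ (- (1 + 2 * theta)))); last first.
      by apply/funext => y; rewrite powRN.
    apply: measurable_funTS.
    apply: (@measurableT_comp _ _ _ _ _ _ (fun z : R => z `^ (- (1 + 2 * theta)))).
      exact: measurable_powR.
    apply: measurableT_comp => //; apply: measurable_funB; [exact: measurable_cst|exact: measurable_id].
  set l := e.2 - e.1; have l0 : 0 < l by rewrite subr_gt0.
  rewrite /sqint -ge0_integralZl_EFin//; last 3 first.
  - by move=> y _; rewrite lee_fin sqr_ge0.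
  - by apply: measurable_sqr; exact: measurable_funS mgx.
  - by rewrite invr_ge0 ltW.
  apply: (@le_trans _ _ (\int[mu]_(y in `]e.1, e.2[) ((h `^ (2 * theta))%:E * (D x y)%:E))%E); last first.
    rewrite -ge0_integralZl_EFin//; last 2 first.
    - by move=> y _; rewrite lee_fin.
    - exact: powR_ge0.
    apply: ge0_subset_integral => //; first exact: measurable_funeM.
    by move=> y _; rewrite -EFinM lee_fin mulr_ge0// powR_ge0.
  apply: ge0_le_integral_nonmeas => y; rewrite /= in_itv/= => /andP[y1 y2].
    by rewrite -EFinM lee_fin mulr_ge0 ?sqr_ge0// invr_ge0 ltW.
  rewrite -!EFinM lee_fin /D real_normK ?num_real//.
  have [->|xy] := eqVneq x y; first by rewrite subrr expr0n/= !(mulr0, mul0r).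
  have d0 : 0 < `|x - y| by rewrite normr_gt0 subr_eq0.
  rewrite mulrC [leRHS]mulrCA; apply: ler_wpM2l; first exact: sqr_ge0.
  have dl : `|x - y| <= l by rewrite /l ler_norml; lra.
  rewrite ler_pdivlMr ?powR_gt0// powRD; last by rewrite (gt_eqF d0) implybT.
  rewrite powRr1 ?(ltW d0)// mulrA.
  apply: (@le_trans _ _ (1 * `|x - y| `^ (2 * theta))).
    apply: ler_wpM2r; first exact: powR_ge0.
    by rewrite mulrC ler_pdivrMr// mul1r.
  rewrite mul1r; apply: ge0_ler_powR; rewrite ?nnegrE//; [lra|exact: ltW|].
  exact: le_trans dl eh.
rewrite -ge0_integralZl_EFin ?powR_ge0//; last 2 first.
- by move=> x _; apply: integral_ge0 => y _; rewrite lee_fin.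
- apply: (@measurable_fun_tonelli R _ _ (measurableTypeR R) (measurableTypeR R)
      mu (itvT T) (itvT T) (fun x y => (D x y)%:E)) => //.
    exact: measurable_slobodeckij_kernel.
  by move=> x y _ _; rewrite lee_fin.
apply: ge0_le_integral_nonmeas => x; first by rewrite lee_fin sqr_ge0.
by rewrite /itvT/= in_itv/=; exact: key.
Qed.

Lemma weak_derivative_interp_error g g' : is_weak_derivative T g g' ->
  (sqint (itvT T) (fun x => g x - interp_slope 0 p (prim T g) x)%R <=
   (h * (2 * h))%:E * sqint (itvT T) g')%E.
Proof.
move=> wd; have [c gc] := weak_derivative_prim wd; have [g2 g'2 _] := wd.
pose f x := c + prim T g' x.
have [mg _] := g2; have mf : measurable_fun (itvT T) f.
  by apply: measurable_funD; [exact: measurable_cst|exact: measurable_prim].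
have f2 : inL2 T f.
  by split => //; rewrite l2normsqE -(ae_eq_sqint (measurable_itvT T) mg mf gc); case: g2.
have [_ [mI _] _] := is_prim_interp_lin p_part (prim T g).
have pE : prim T g = prim T f.
  apply/funext => x; rewrite /prim /Rintegral; congr fine.
  have mcg := measurable_cut mg; have mcf := measurable_cut mf.
  apply: ae_eq_integral => //.
  - by apply/measurable_EFinP; exact: measurable_funTS.
  - by apply/measurable_EFinP; exact: measurable_funTS.
  - apply: filterS gc => y H _; rewrite /cut !patchE; case: ifPn => // /set_mem/H.
    by move=> ->.
rewrite (@ae_eq_sqint _ _ _ (fun x => f x - interp_slope 0 p (prim T f) x))//; last 3 first.
- exact: measurable_funB.
- by rewrite -pE; exact: measurable_funB.
- by apply: filterS gc => x H xT; rewrite H// pE.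
apply: window_sqint_le; [by case: g'2|exact: ltW|move=> x xT].
have [e ep xe] := cell_of xT; have [e1x xe2] := andP xe.
have [e0 e12 eT] := cells_in_T p_part ep; have [x0 xT'] := andP xT.
have eh := p_width ep.
apply: le_trans (interp_slope_error f2 ep xe xT') _.
have c2 := sqintegrable_cut (measurable_itv `[(x - h), (x + h)]) g'2.
rewrite -(fineK (sqint_fin_num c2)) -EFinM.
set S := fine _; have S0 : 0 <= S by rewrite fine_ge0// sqint_ge0.
set l := e.2 - e.1; have l0 : 0 < l by rewrite subr_gt0.
apply: (@le_trans _ _ (l^-1%:E * \int[mu]_(y in `]e.1, e.2[) (cst (h * S)%:E y))%E).
  apply: lee_wpmul2l; first by rewrite lee_fin invr_ge0 ltW.
  apply: ge0_le_integral_nonmeas => y; first by rewrite lee_fin sqr_ge0.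
  rewrite /= in_itv/= => /andP[y1 y2]; rewrite lee_fin /f.
  rewrite (_ : _ - _ = prim T g' x - prim T g' y); last by ring.
  have [xy|yx] := leP x y.
    rewrite -sqrrN opprB; apply: le_trans (prim_window (x := x) g'2 _ xy _) _; try lra.
    by apply: ler_wpM2r => //; lra.
  apply: le_trans (prim_window (x := x) g'2 _ (ltW yx) _) _; try lra.
  by apply: ler_wpM2r => //; lra.
have mue : mu `]e.1, e.2[ = l%:E by rewrite lebesgue_measure_itv/= lte_fin e12.
rewrite integral_cst// [X in (_ * (_ * X))%E]mue -!EFinM lee_fin.
by rewrite -/l mulrCA mulVf ?mulr1// gt_eqF.
Qed.

End Interpolation.

(** * Error bounds for the K-functional *)

Section PowerWeights.
Context {R : realType}.
Implicit Types (a h q t : R).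

Lemma powR_cvgy q : 0 < q -> x `^ q @[x --> +oo%R] --> (+oo%R : set_system R).
Proof.
move=> q0; apply/cvgryPge => A; near=> x.
have x0 : 0 <= x by near: x; apply: nbhs_pinfty_ge; rewrite num_real.
apply: (@le_trans _ _ (Num.max A 0)); first by rewrite le_max lexx.
set B := Num.max A 0; have B0 : 0 <= B by rewrite le_max lexx orbT.
rewrite -[leLHS](powRr1 B0) -(mulVf (lt0r_neq0 q0)) powRrM.
apply: ge0_ler_powR; rewrite ?nnegrE ?powR_ge0//; first exact: ltW.
Unshelve. all: by end_near. Qed.

Lemma powR_continuous_at q x : 0 < x -> {for x, continuous (@powR R ^~ q)}.
Proof.
move=> x0; apply/differentiable_continuous/derivable1_diffP.
by apply: derivable_powR; rewrite in_itv/= x0.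
Qed.

Lemma integral_powR_tail a q : 0 < a -> 1 < q ->
  (\int[mu]_(t in `[a, +oo[) (t `^ (- q))%:E = (a `^ (1 - q) / (q - 1))%:E)%E.
Proof.
move=> a0 q1; pose F x := (1 - q)^-1 * x `^ (1 - q).
have dF x : 0 < x -> derivable F x 1 /\ derive1 F x = x `^ (- q).
  move=> x0; have xi : x \in `]0, +oo[ by rewrite in_itv/= x0.
  have d : derivable (@powR R ^~ (1 - q)) x 1 by exact: derivable_powR.
  split; first exact: derivableZ d.
  rewrite /F derive1E deriveZ//= -derive1E powR_derive1// /GRing.scale/=.
  rewrite mulrA mulVf ?mul1r; last by rewrite subr_eq0 lt_eqF.
  by congr (_ `^ _); ring.
rewrite (@ge0_continuous_FTC2y _ _ F a 0); first by rewrite -EFinB /F sub0r -mulNr -invrN opprB mulrC.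
- by move=> x _; exact: powR_ge0.
- apply/continuous_within_itvcyP; split.
    move=> x; rewrite in_itv/= andbT => ax.
    by apply: powR_continuous_at; exact: lt_trans ax.
  by apply: cvg_at_right_filter; exact: powR_continuous_at.
- rewrite -(mulr0 (1 - q)^-1); apply: cvgMr.
  have h : (fun x : R => x `^ (1 - q)) = (fun x => (x `^ (q - 1))^-1).
    by apply/funext => x; rewrite -powRN opprB.
  rewrite h; apply/gtr0_cvgV0.
    by near=> x; apply: powR_gt0.
  by apply: powR_cvgy; rewrite subr_gt0.
- by move=> x ax; case: (dF x (lt_trans a0 ax)).
- apply: cvg_at_right_filter; apply: cvgMr; exact: powR_continuous_at.
- by move=> x; rewrite in_itv/= andbT => ax; case: (dF x (lt_trans a0 ax)).
Unshelve. all: by end_near. Qed.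

Lemma measurable_powRN (D : set R) q :
  measurable_fun D (fun t : R => (t `^ (- q))%:E).
Proof.
by apply/measurable_EFinP; apply: measurable_funTS; exact: measurable_powR.
Qed.

Lemma itv0y_split h : 0 < h -> `]0, +oo[%classic = `]0, h[ `|` `[h, +oo[ :> set R.
Proof.
move=> h0; apply/seteqP; split => t /=; rewrite !in_itv/= !andbT.
  by move=> t0; case: (ltP t h) => th; [left; rewrite t0|right].
by move=> [/andP[]//|]; exact: lt_le_trans.
Qed.

(** Below h the bound A is integrated against the weight; beyond h the constant B
    is multiplied with the explicit tail of the weight. *)
Lemma weighted_split_le (K A : R -> \bar R) (B : \bar R) h q :
  0 < h -> 1 < q -> (forall t, (0 < t)%R -> 0 <= K t)%E ->
  measurable_fun `]0, h[ A -> (forall t, (0 < t < h)%R -> K t <= A t)%E ->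
  (0 <= B)%E -> (forall t, (h <= t)%R -> K t <= B)%E ->
  (\int[mu]_(t in `]0%R, +oo[) ((t `^ (- q))%:E * K t) <=
   \int[mu]_(t in `]0%R, h[) ((t `^ (- q))%:E * A t) +
   (h `^ (1 - q) / (q - 1))%:E * B)%E.
Proof.
move=> h0 q1 K0 mA KA B0 KB.
have A0 t : 0 < t < h -> (0 <= A t)%E.
  by move=> th; apply: le_trans (KA _ th); apply: K0; case/andP : th.
have w0 t : (0 <= (t `^ (- q))%:E)%E by rewrite lee_fin powR_ge0.
pose G t := if t < h then A t else B.
have GA : {in `]0, h[%classic, G =1 A}.
  by move=> t; rewrite inE/= in_itv/= /G => /andP[_ ->].
have GB : {in `[h, +oo[%classic, G =1 cst B}.
  by move=> t; rewrite inE/= in_itv/= andbT /G leNgt => /negbTE ->.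
have mG1 : measurable_fun `]0, h[ G by apply: eq_measurable_fun mA => t /GA ->.
have mG2 : measurable_fun `[h, +oo[ G.
  by apply: (eq_measurable_fun (cst B)) => // t /GB ->.
apply: (@le_trans _ _ (\int[mu]_(t in `]0%R, +oo[) ((t `^ (- q))%:E * G t))%E).
  apply: ge0_le_integral_nonmeas => t; rewrite /= in_itv/= andbT => t0.
    by rewrite mule_ge0// K0.
  apply: lee_wpmul2l => //; rewrite /G; case: ltP => th; last exact: KB.
  by apply: KA; rewrite t0.
rewrite (itv0y_split h0) ge0_integral_setU//=; last 3 first.
- apply: emeasurable_funM; first exact: measurable_powRN.
  by apply/measurable_funU => //.
- move=> t [|]; rewrite /= in_itv/= => th; rewrite mule_ge0//.
    by rewrite GA ?inE/= ?in_itv//; exact: A0.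
  by rewrite GB ?inE/= ?in_itv.
- apply/disj_setPS => t [/=]; rewrite !in_itv/= => /andP[_ th].
  by rewrite andbT leNgt th.
apply: leeD.
  rewrite le_eqVlt; apply/orP; left; apply/eqP; apply: eq_integral => t th.
  by rewrite GA.
have -> : (\int[mu]_(t in `[h, +oo[) ((t `^ (- q))%:E * G t) =
    \int[mu]_(t in `[h, +oo[) ((t `^ (- q))%:E * B))%E.
  by apply: eq_integral => t /GB ->.
rewrite ge0_integralZr//; last exact: measurable_powRN.
by rewrite integral_powR_tail.
Qed.

Lemma nondecreasing_emeasurable (f : R -> \bar R) :
  (forall s t, (0 < s)%R -> (s <= t)%R -> f s <= f t)%E ->
  measurable_fun (`]0, +oo[%classic : set R) f.
Proof.
move=> nf; apply: (measurability _ (ErealGenOInfty.measurableE R)) => _ /= -[_ [r ->] <-].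
apply: is_interval_measurable => s t /= [] + fs [] + ft u /andP[su ut].
rewrite !in_itv/= !andbT => s0 t0; rewrite (lt_le_trans s0 su); split => //.
move: fs; rewrite !in_itv/= !andbT => /lt_le_trans; apply; exact: nf.
Qed.

End PowerWeights.

Section KFunctional.
Context {R : realType} (T : R).
Implicit Types (z v : (R -> R) * (R -> R)).

Lemma K_sq_nondecreasing v s t : 0 < s -> s <= t -> (K_sq T s v <= K_sq T t v)%E.
Proof.
move=> s0 st; apply: le_ereal_inf_tmp => _ [w wH <-].
apply: ge_ereal_inf; exists (l2normsqS T (v - w)%R + (s ^+ 2)%:E * h10_normsqS T w)%E.
  by exists w.
apply: leeD => //; apply: lee_wpmul2r; first exact: h10_normsqS_ge0.
by rewrite lee_fin ler_sqr ?nnegrE//; [exact: ltW|exact: le_trans (ltW s0) st].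
Qed.

Lemma measurable_K_sq v : measurable_fun (`]0, +oo[%classic : set R) (fun t => K_sq T t v).
Proof. by apply: nondecreasing_emeasurable => s t; exact: K_sq_nondecreasing. Qed.

End KFunctional.

Section Meshwidth.
Context {R : realType} (T : R) (m : seq R * seq R).
Hypothesis T_gt0 : 0 < T.
Hypothesis m_mesh : is_mesh T m.
Implicit Types e : R * R.

Lemma cells_le_meshwidth e : e \in cells 0 m.1 ++ cells 0 m.2 ->
  e.2 - e.1 <= meshwidth m.
Proof.
move=> em; rewrite /meshwidth.
exact: (le_bigmax_seq 0 e predT (fun e => e.2 - e.1) em isT).
Qed.

Lemma meshwidth_gt0 : 0 < meshwidth m.
Proof.
have [m1 m2] := m_mesh.
have [|e em /andP[e1 e2]] := @cells_cover _ 0 m.1 T (partition_path m1).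
  by rewrite T_gt0 (partition_last m1) lexx.
have [_ e12 _] := cells_in_T m1 em.
apply: lt_le_trans (cells_le_meshwidth (e := e) _); first by rewrite subr_gt0.
by rewrite mem_cat em.
Qed.

End Meshwidth.

Section ErrorBounds.
Context {R : realType} (L : R) (n : nat).
Hypothesis L_gt0 : 0 < L.
Let T := n.+1%:R * L.
Let T_gt0 : 0 < T := final_time_gt0 n L_gt0.
Variables (m : seq R * seq R) (c : R).
Hypothesis m_mesh : is_mesh T m.
Hypothesis m_slices : time_slice_matching L n.+1 m.
Hypothesis m_adm : S10_admissible T c m.
Let h := meshwidth m.
Let h_gt0 : 0 < h := meshwidth_gt0 T_gt0 m_mesh.
Implicit Types (z zh w u v : (R -> R) * (R -> R)).

Definition l2_cst : R := 2 + 2 * (8 * 2 ^+ n.+1).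
Definition h10_cst : R := 2 + 2 * (8 * 2 ^+ n.+1 * c ^+ 2).
Definition error_cst : R := 4 * l2_cst + h10_cst.

Lemma l2_cst_gt0 : 0 < l2_cst.
Proof. by rewrite /l2_cst ltr_wpDr// !mulr_ge0// exprn_ge0. Qed.

Lemma h10_cst_gt0 : 0 < h10_cst.
Proof. rewrite /h10_cst ltr_wpDr//; apply: mulr_ge0 => //.
by rewrite mulr_ge0 ?sqr_ge0// mulr_ge0// exprn_ge0. Qed.

Lemma error_cst_gt0 : 0 < error_cst.
Proof. by rewrite /error_cst addr_gt0 ?h10_cst_gt0// mulr_gt0 ?l2_cst_gt0. Qed.

(** The L^2 bound applied to w minus its interpolant, which is its own Galerkin
    approximation. *)
Lemma galerkin_error_first_order w u wh : is_primS T w u ->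
  galerkin_approx L n m w wh ->
  (l2normsqS T (w - wh)%R <= (l2_cst * (h * (2 * h)))%:E * l2normsqS T u)%E.
Proof.
move=> wu wg; have [m1 m2] := m_mesh.
pose v := (interp_lin 0 m.1 (prim T u.1), interp_lin 0 m.2 (prim T u.2)).
have vS : S10 T m v by split; exact: spline0_interp_lin.
have w2 := is_primS_inL2S wu; have v2 := S10_inL2S m_mesh vS.
have g := galerkin_approxB L_gt0 m_mesh w2 v2 wg (galerkin_approx_id vS).
have -> : w - wh = (w - v) - (wh - v) by rewrite opprB addrA subrK.
apply: le_trans (galerkin_error_l2 L_gt0 m_mesh m_slices (inL2SB w2 v2) g) _.
rewrite EFinM -muleA; apply: lee_wpmul2l; first by rewrite lee_fin ltW// l2_cst_gt0.
have [wu1 wu2] := wu.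
rewrite /l2normsqS !l2normsqE (ge0_muleDr _ (sqint_ge0 _ _) (sqint_ge0 _ _)).
apply: leeD.
  apply: (interp_lin_l2_error m1 h_gt0 _ wu1) => e em.
  by apply: cells_le_meshwidth; rewrite mem_cat em.
apply: (interp_lin_l2_error m2 h_gt0 _ wu2) => e em.
by apply: cells_le_meshwidth; rewrite mem_cat em orbT.
Qed.

(** If wh is the approximation of w then (z - w) - (zh - wh) and w - wh split the
    error, and each is bounded in the norm in which its datum is. *)
Lemma K_sq_galerkin_error z zh w u t : inL2S T z -> galerkin_approx L n m z zh ->
  is_primS T w u ->
  (K_sq T t (z - zh)%R <=
   error_cst%:E * (l2normsqS T (z - w)%R + (t ^+ 2)%:E * l2normsqS T u))%E.
Proof.
move=> z2 zg wu; have w2 := is_primS_inL2S wu.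
have [wh wg] := galerkin_approx_exists L_gt0 m_mesh m_slices w2.
have [uh wuh Huh] := galerkin_error_h10 L_gt0 m_mesh m_slices m_adm wu wg.
apply: le_trans (K_sq_le t (z - zh) (is_primS_inH10S wuh)) _.
rewrite (is_primS_h10_normsqS T_gt0 wuh).
have g := galerkin_approxB L_gt0 m_mesh z2 w2 zg wg.
have -> : (z - zh) - (w - wh) = (z - w) - (zh - wh).
  by rewrite !opprB addrACA [in RHS]addrACA (addrC (- zh)).
have h1 := galerkin_error_l2 L_gt0 m_mesh m_slices (inL2SB z2 w2) g.
have t0 : (0 <= (t ^+ 2)%:E :> \bar R)%E by rewrite lee_fin sqr_ge0.
have n1 := l2normsqS_ge0 T (z - w); have n2 := l2normsqS_ge0 T u.
rewrite (ge0_muleDr _ n1 (mule_ge0 t0 n2)).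
apply: leeD.
  apply: le_trans h1 _; apply: lee_wpmul2r => //; rewrite lee_fin /error_cst.
  by have := l2_cst_gt0; have := h10_cst_gt0; rewrite /l2_cst; lra.
rewrite muleCA; apply: lee_wpmul2l => //; apply: le_trans Huh _.
apply: lee_wpmul2r => //; rewrite lee_fin /error_cst.
by have := l2_cst_gt0; have := h10_cst_gt0; rewrite /h10_cst; lra.
Qed.

(** The same splitting, with the first order bound for w - wh. *)
Lemma l2_galerkin_error z zh w u : inL2S T z -> galerkin_approx L n m z zh ->
  is_primS T w u ->
  (l2normsqS T (z - zh)%R <=
   error_cst%:E * (l2normsqS T (z - w)%R + (h ^+ 2)%:E * l2normsqS T u))%E.
Proof.
move=> z2 zg wu; have w2 := is_primS_inL2S wu.
have [wh wg] := galerkin_approx_exists L_gt0 m_mesh m_slices w2.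
have g := galerkin_approxB L_gt0 m_mesh z2 w2 zg wg.
have zh2 := S10_inL2S m_mesh zg.1; have wh2 := S10_inL2S m_mesh wg.1.
have -> : z - zh = (z - w - (zh - wh)) + (w - wh).
  by rewrite opprB addrAC !subrKA.
have d1 := inL2SB (inL2SB z2 w2) (inL2SB zh2 wh2).
apply: le_trans (l2normsqSD_le d1 (inL2SB w2 wh2)) _.
have h1 := galerkin_error_l2 L_gt0 m_mesh m_slices (inL2SB z2 w2) g.
have h2 := galerkin_error_first_order wu wg.
have h0 : (0 <= (h ^+ 2)%:E :> \bar R)%E by rewrite lee_fin sqr_ge0.
have n1 := l2normsqS_ge0 T (z - w); have n2 := l2normsqS_ge0 T u.
have two0 : (0 <= 2%:E :> \bar R)%E by [].
rewrite (ge0_muleDr _ n1 (mule_ge0 h0 n2)).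
apply: leeD.
  apply: le_trans (lee_wpmul2l two0 h1) _.
  rewrite muleA -EFinM; apply: lee_wpmul2r => //; rewrite lee_fin /error_cst.
  by have := l2_cst_gt0; have := h10_cst_gt0; rewrite /l2_cst; lra.
apply: le_trans (lee_wpmul2l two0 h2) _.
rewrite !muleA -!EFinM; apply: lee_wpmul2r => //; rewrite lee_fin.
have -> : 2 * (l2_cst * (h * (2 * h))) = (4 * l2_cst) * h ^+ 2 by ring.
apply: ler_wpM2r; first exact: sqr_ge0.
by rewrite /error_cst lerDl ltW// h10_cst_gt0.
Qed.

End ErrorBounds.

(** * The rate for 1 <= s <= 2 *)

Section Smooth.
Context {R : realType} (L : R) (n : nat).
Hypothesis L_gt0 : 0 < L.
Let T := n.+1%:R * L.
Let T_gt0 : 0 < T := final_time_gt0 n L_gt0.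
Variables (m : seq R * seq R) (c : R).
Hypothesis m_mesh : is_mesh T m.
Hypothesis m_slices : time_slice_matching L n.+1 m.
Hypothesis m_adm : S10_admissible T c m.
Let h := meshwidth m.
Let h_gt0 : 0 < h := meshwidth_gt0 T_gt0 m_mesh.
Implicit Types (z zh w u v : (R -> R) * (R -> R)).

Lemma l2normsqS0 : l2normsqS T 0 = 0%E.
Proof.
have e : sqint (itvT T) (cst 0) = 0%E.
  by rewrite /sqint; apply: integral0_eq => x _; rewrite expr0n.
by rewrite /l2normsqS !l2normsqE [X in (X + _)%E]e [X in (_ + X)%E]e adde0.
Qed.

(** As v is its own Galerkin approximation, z - v and zh - v have the same error, for
    which w := z - v is admissible in both bounds of the K-functional. *)
Lemma galerkin_rate_prim z zh v u : inL2S T z -> galerkin_approx L n m z zh ->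
  S10 T m v -> is_primS T (z - v) u ->
  (\int[mu]_(t in `]0%R, +oo[) ((t `^ (- 2))%:E * K_sq T t (z - zh)%R) <=
   (2 * error_cst n c * h)%:E * l2normsqS T u)%E.
Proof.
move=> z2 zg vS vu; have v2 := S10_inL2S m_mesh vS.
have g := galerkin_approxB L_gt0 m_mesh z2 v2 zg (galerkin_approx_id vS).
have yE : z - zh = (z - v) - (zh - v) by rewrite opprB addrA subrK.
have U0 := l2normsqS_ge0 T u; have M0 := error_cst_gt0 n c.
have HK t : (K_sq T t (z - zh)%R <= (error_cst n c * t ^+ 2)%:E * l2normsqS T u)%E.
  rewrite yE; apply: le_trans (K_sq_galerkin_error L_gt0 m_mesh m_slices m_adm t (inL2SB z2 v2) g vu) _.
  by rewrite subrr l2normsqS0 add0e muleA -EFinM.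
have HL : (l2normsqS T (z - zh)%R <= (error_cst n c * h ^+ 2)%:E * l2normsqS T u)%E.
  have e := l2_galerkin_error L_gt0 c m_mesh m_slices (inL2SB z2 v2) g vu.
  rewrite yE; apply: (le_trans e).
  by rewrite subrr l2normsqS0 add0e muleA -EFinM.
have one_lt2 : 1 < 2 :> R by lra.
apply: le_trans (weighted_split_le (A := fun t => ((error_cst n c * t ^+ 2)%:E * l2normsqS T u)%E)
  (B := ((error_cst n c * h ^+ 2)%:E * l2normsqS T u)%E) h_gt0 one_lt2 _ _ _ _ _) _.
- by move=> t _; exact: K_sq_ge0.
- by apply: emeasurable_funM => //; apply/measurable_EFinP; apply: measurable_funM => //; exact: measurable_funX.
- by move=> t _; exact: HK.
- by rewrite mule_ge0// lee_fin mulr_ge0 ?sqr_ge0// ltW.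
- by move=> t _; apply: le_trans HL; exact: K_sq_le_l2normsqS.
have -> : (\int[mu]_(t in `]0%R, h[) ((t `^ (- 2))%:E * ((error_cst n c * t ^+ 2)%:E * l2normsqS T u)) =
   \int[mu]_(t in `]0%R, h[) cst ((error_cst n c)%:E * l2normsqS T u) t)%E.
  apply: eq_integral => t; rewrite inE/= in_itv/= => /andP[t0 _].
  rewrite muleA -EFinM; congr ((_)%:E * _)%E.
  rewrite powRN powR_mulrn ?ltW// mulrCA mulVf ?mulr1//.
  by rewrite gt_eqF// exprn_gt0.
have mue : mu (`]0, h[%classic : set R) = h%:E.
  by rewrite lebesgue_measure_itv/= lte_fin h_gt0 sube0.
rewrite integral_cst// [X in (_ * X + _)%E]mue.
have -> : 1 - 2 = - 1 :> R by lra.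
have -> : 2 - 1 = 1 :> R by lra.
rewrite divr1 powRN powRr1 ?(ltW h_gt0)// muleAC -EFinM muleA -EFinM.
have -> : h^-1 * (error_cst n c * h ^+ 2) = error_cst n c * h.
  by rewrite expr2 mulrCA mulKf// gt_eqF.
rewrite -ge0_muleDl; [|by rewrite lee_fin ltW// mulr_gt0..].
by rewrite -EFinD (_ : _ + _ = 2 * error_cst n c * h)//; ring.
Qed.

End Smooth.

Lemma slobodeckij_sq_ge0 {R : realType} (T s : R) f : (0 <= slobodeckij_sq T s f)%E.
Proof.
apply: integral_ge0 => x _; apply: integral_ge0 => y _.
by rewrite lee_fin divr_ge0 ?sqr_ge0 ?powR_ge0.
Qed.

Lemma hs_normsq_ge0 {R : realType} (T s : R) f : (0 <= hs_normsq T s f)%E.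
Proof.
apply: adde_ge0; first by apply: sume_ge0 => k _; rewrite l2normsqE; exact: sqint_ge0.
by case: ifP => // _; exact: slobodeckij_sq_ge0.
Qed.

Section Components.
Context {R : realType} (T : R) (p : seq R) (h : R).
Hypothesis T_gt0 : 0 < T.
Hypothesis p_part : itv_partition 0 T p.
Hypothesis h_gt0 : 0 < h.
Hypothesis p_width : forall e, e \in cells 0 p -> e.2 - e.1 <= h.
Implicit Types (f g : R -> R) (s : R).

(** For s = 1 the zero spline will do; for larger s the derivative is compared with
    its means over the cells. *)
Lemma spline0_approx s f : 1 <= s <= 2 -> inHs T s f -> inH10 T f ->
  exists v g, [/\ spline0 T p v, is_prim T (fun x => f x - v x) g &
    (sqint (itvT T) g <= (2 * h `^ (2 * (s - 1)))%:E * hs_normsq T s f)%E].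
Proof.
move=> /andP[s1 s2] fs f0; have fp := inH10_is_prim T_gt0 f0.
set g := weak_derivative T f in fp.
have [_ g2 fg] := fp.
pose v := interp_lin 0 p (prim T g).
have vS : spline0 T p v by exact: spline0_interp_lin.
have vp : is_prim T v (interp_slope 0 p (prim T g)) by exact: is_prim_interp_lin.
have q0 : 0 <= h `^ (2 * (s - 1)) by exact: powR_ge0.
case: (ltP s 2) => [s_lt2|s_ge2].
  have tr : Num.truncn s = 1%N.
    by apply/eqP; rewrite truncn_eq ?(le_trans _ s1)// s1.
  have hsE : hs_normsq T s f = (sqint (itvT T) f + sqint (itvT T) g +
      (if (0 < s - 1)%R then slobodeckij_sq T (s - 1) g else 0))%E.
    by rewrite /hs_normsq tr big_ord_recl big_ord1 /= !l2normsqE.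
  have S0 := slobodeckij_sq_ge0 T (s - 1) g.
  have n1 := sqint_ge0 (itvT T) f; have n2 := sqint_ge0 (itvT T) g.
  case: (ltP 0 (s - 1)) => th; last first.
    exists (cst 0), g; split.
    - exact: spline0_0.
    - by apply: is_prim_eq fp => x _ /=; rewrite subr0.
    - have -> : s - 1 = 0 by lra.
      rewrite mulr0 powRr0 mulr1 hsE ifF; last by apply/negbTE; rewrite -leNgt.
      rewrite adde0 ge0_muleDr// -[leLHS]add0e; apply: leeD.
        by rewrite mule_ge0.
      by rewrite -[leLHS]mul1e; apply: lee_wpmul2r => //; rewrite lee_fin; lra.
  exists v, (fun x => g x - interp_slope 0 p (prim T g) x); split => //.
    exact: is_primB fp vp.
  apply: le_trans (slobodeckij_interp_error p_part h_gt0 p_width g2 th) _.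
  apply: lee_pmul => //.
    by rewrite lee_fin; lra.
  by rewrite hsE th -[leLHS]add0e; apply: leeD => //; exact: adde_ge0.
have -> : s = 2 by apply/le_anti; rewrite s2 s_ge2.
have sE : s = 2 by apply/le_anti; rewrite s2 s_ge2.
move: fs; rewrite sE => -[_ fk _].
have tr : Num.truncn (2 : R) = 2%N by exact: natrK.
have wd : is_weak_derivative T g (weak_derivative T g).
  have := fk 1%N; rewrite tr => /(_ isT) => -[k gk].
  by apply: xgetPex; exists k.
exists v, (fun x => g x - interp_slope 0 p (prim T g) x); split => //.
  exact: is_primB fp vp.
apply: le_trans (weak_derivative_interp_error p_part h_gt0 p_width wd) _.
have -> : 2 - 1 = 1 :> R by lra.
rewrite mulr1 powR_mulrn ?(ltW h_gt0)//.
have -> : h * (2 * h) = 2 * h ^+ 2 by ring.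
apply: lee_wpmul2l; first by rewrite lee_fin mulr_ge0// sqr_ge0.
rewrite /hs_normsq tr subrr ltxx adde0 big_ord_recr/= l2normsqE.
by rewrite -[leLHS]add0e; apply: leeD => //; apply: sume_ge0 => k _; rewrite l2normsqE; exact: sqint_ge0.
Qed.

End Components.

Section SmoothRate.
Context {R : realType} (L : R) (n : nat).
Hypothesis L_gt0 : 0 < L.
Let T := n.+1%:R * L.
Let T_gt0 : 0 < T := final_time_gt0 n L_gt0.
Variables (m : seq R * seq R) (c : R).
Hypothesis m_mesh : is_mesh T m.
Hypothesis m_slices : time_slice_matching L n.+1 m.
Hypothesis m_adm : S10_admissible T c m.
Let h := meshwidth m.
Let h_gt0 : 0 < h := meshwidth_gt0 T_gt0 m_mesh.

Lemma galerkin_rate_ge1 s z zh : 1 <= s <= 2 -> inHsS T s z -> inH10S T z ->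
  galerkin_approx L n m z zh ->
  (\int[mu]_(t in `]0%R, +oo[) ((t `^ (- 2))%:E * K_sq T t (z - zh)%R) <=
   (4 * error_cst n c * h `^ (2 * s - 1))%:E *
     (hs_normsq T s z.1 + hs_normsq T s z.2))%E.
Proof.
move=> s12 [zs1 zs2] z0 zg; have [z01 z02] := z0; have [m1 m2] := m_mesh.
have z2 := is_primS_inL2S (inH10S_is_primS T_gt0 z0).
have [|v1 [u1 [v1S vu1 H1]]] := spline0_approx T_gt0 m1 h_gt0 _ s12 zs1 z01.
  by move=> e em; apply: cells_le_meshwidth; rewrite mem_cat em.
have [|v2 [u2 [v2S vu2 H2]]] := spline0_approx T_gt0 m2 h_gt0 _ s12 zs2 z02.
  by move=> e em; apply: cells_le_meshwidth; rewrite mem_cat em orbT.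
have vu : is_primS T (z - (v1, v2)) (u1, u2) by split.
apply: le_trans (galerkin_rate_prim L_gt0 m_mesh m_slices m_adm z2 zg _ vu) _; first by split.
rewrite /l2normsqS !l2normsqE/=.
apply: (@le_trans _ _ ((2 * error_cst n c * h)%:E * ((2 * h `^ (2 * (s - 1)))%:E * (hs_normsq T s z.1 + hs_normsq T s z.2)))%E).
  apply: lee_wpmul2l; first by rewrite lee_fin !mulr_ge0// ltW// error_cst_gt0.
  have a1 := hs_normsq_ge0 T s z.1; have a2 := hs_normsq_ge0 T s z.2.
  by rewrite (ge0_muleDr _ a1 a2); apply: (leeD H1 H2).
rewrite muleA -EFinM (_ : 2 * error_cst n c * h * _ = 4 * error_cst n c * h `^ (2 * s - 1))//.
have -> : 2 * s - 1 = 2 * (s - 1) + 1 by ring.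
rewrite powRD; last by apply/implyP => _; rewrite gt_eqF.
by rewrite powRr1 ?(ltW h_gt0)//; ring.
Qed.

End SmoothRate.

(** * Moduli of continuity and the Hardy inequality *)

Section ReflectionAndTails.
Context {R : realType}.
Implicit Types (a q : R) (f phi : R -> \bar R).

Lemma lebesgue_measure_reflect a (A : set R) : measurable A ->
  pushforward mu ((fun x : R => (a - x)%R) : measurableTypeR R -> measurableTypeR R) A = mu A.
Proof.
move=> mA; apply/esym/lebesgue_measure_unique => //.
  by apply: measurable_funB; [exact: measurable_cst|exact: measurable_id].
move=> mf _ [[b c] /= _ <-].
rewrite /pushforward.
rewrite (_ : _ @^-1` _ = `[(a - c)%R, (a - b)%R[%classic); last first.
  by apply/seteqP; split => x /=; rewrite !in_itv/=; lra.
rewrite !lebesgue_measure_itv/= !lte_fin ltrD2l ltrN2.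
by case: ifP => // _; rewrite -!EFinB; congr (_%:E); lra.
Qed.

Lemma ge0_integral_reflect a (D : set R) f :
  measurable D -> measurable_fun D f -> (forall x, D x -> (0 <= f x)%E) ->
  (\int[mu]_(x in (fun x => a - x)%R @^-1` D) f (a - x)%R = \int[mu]_(x in D) f x)%E.
Proof.
move=> mD mf f0.
have ms : measurable_fun setT ((fun x : R => (a - x)%R) : measurableTypeR R -> measurableTypeR R).
  by apply: measurable_funB; [exact: measurable_cst|exact: measurable_id].
have := @ge0_integral_pushforward _ _ _ _ _ _ ms mu D f mD mf.
rewrite /comp => <-; last by move=> x /set_mem /f0.
by apply: eq_measure_integral => A mA _; exact: lebesgue_measure_reflect.
Qed.

Lemma integral_powR_tail_oo a q : 0 < a -> 1 < q ->
  (\int[mu]_(t in `]a, +oo[) (t `^ (- q))%:E = (a `^ (1 - q) / (q - 1))%:E)%E.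
Proof.
by move=> a0 q1; rewrite integral_itv_obnd_cbnd ?integral_powR_tail//; exact: measurable_powRN.
Qed.

(** Tonelli's theorem on the region r < t. *)
Lemma tail_swap phi q : 1 < q -> measurable_fun setT phi -> (forall r, 0 <= phi r)%E ->
  (\int[mu]_(t in `]0%R, +oo[) ((t `^ (- q))%:E * \int[mu]_(r in `]0%R, t[) phi r) =
   \int[mu]_(r in `]0%R, +oo[) ((r `^ (1 - q) / (q - 1))%:E * phi r))%E.
Proof.
move=> q1 mphi phi0.
have w0 t : (0 <= (t `^ (- q))%:E :> \bar R)%E by rewrite lee_fin powR_ge0.
pose G t r : \bar R := ((t `^ (- q) * \1_(`]0%R, +oo[%classic : set R) (t - r))%:E * phi r)%E.
have i0 t r : (0 <= (t `^ (- q) * \1_(`]0%R, +oo[%classic : set R) (t - r))%:E :> \bar R)%E.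
  by rewrite lee_fin mulr_ge0 ?powR_ge0// indicE.
have G0 t r : (0 <= G t r)%E by rewrite mule_ge0.
have m1 := @measurable_fst _ _ (measurableTypeR R) (measurableTypeR R).
have m2 := @measurable_snd _ _ (measurableTypeR R) (measurableTypeR R).
have mG : measurable_fun setT (fun z : measurableTypeR R * measurableTypeR R => G z.1 z.2).
  apply: emeasurable_funM; last exact: (measurableT_comp mphi).
  apply/measurable_EFinP; apply: measurable_funM.
    have mp : measurable_fun setT (@powR R ^~ (- q)) by exact: measurable_powR.
    exact: (measurableT_comp mp).
  have mi : measurable_fun setT (\1_(`]0%R, +oo[%classic : set R) : R -> R) by exact: measurable_indic.
  have mc := measurable_fun_comp_diff mi; exact mc.
transitivity (\int[mu]_(t in `]0%R, +oo[) \int[mu]_(r in `]0%R, +oo[) G t r)%E.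
  apply: eq_integral => t _.
  rewrite -ge0_integralZl//; last exact: measurable_funTS.
  have -> : `]0, t[%classic = `]0, +oo[ `&` `]-oo, t[ :> set R.
    by apply/seteqP; split => r /=; rewrite !in_itv/= andbT; [move/andP|move=> [-> ->]].
  rewrite integral_mkcondr; apply: eq_integral => r _.
  rewrite patchE /G indicE (_ : (t - r \in _) = (r \in `]-oo, t[%classic)); last first.
    by apply/idP/idP; rewrite !inE/= !in_itv/= andbT subr_gt0.
  by case: ifP => _; rewrite ?mulr1// mulr0 mul0e.
rewrite tonelli_set//; last exact: measurable_funTS.
apply: eq_integral => r; rewrite inE/= in_itv/= andbT => r0.
rewrite -integral_powR_tail_oo// -ge0_integralZr//; last exact: measurable_powRN.
have -> : `]r, +oo[%classic = `]0, +oo[ `&` `]r, +oo[ :> set R.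
  apply/seteqP; split => t /=; rewrite !in_itv/= !andbT; last by case.
  by move=> rt; split => //; exact: lt_trans rt.
rewrite integral_mkcondr; apply: eq_integral => t _.
rewrite patchE /G indicE (_ : (t - r \in _) = (t \in `]r, +oo[%classic)); last first.
  by apply/idP/idP; rewrite !inE/= !in_itv/= !andbT subr_gt0.
by case: ifP => _; rewrite ?mulr1// mulr0 mul0e.
Qed.

End ReflectionAndTails.

Section Differences.
Context {R : realType} (T : R) (f : R -> R).
Hypothesis f2 : inL2 T f.
Let F := cut T f.
Let mF : measurable_fun setT F.
Proof. by apply: measurable_cut; case: f2. Qed.
Implicit Types (t x r q s : R).

Definition diffq t x := t^-1 * (f x - delay t f x).
(** The mean over ]x - t, x[ of f extended by zero. *)
Definition average t x := t^-1 * (prim T f x - prim T f (x - t)).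
(** The square of the L^2 modulus of continuity of f extended by zero. *)
Definition modulus t : \bar R := sqint (itvT T) (fun x => F x - F (x - t)).

Lemma measurable_difference :
  measurable_fun setT (fun z : measurableTypeR R * measurableTypeR R => F z.1 - F (z.1 - z.2)).
Proof.
have m1 := @measurable_fst _ _ (measurableTypeR R) (measurableTypeR R).
apply: measurable_funB; first by apply: (@measurableT_comp _ _ _ _ _ _ F).
have mc := measurable_fun_comp_diff mF; exact mc.
Qed.

Lemma modulus_ge0 t : (0 <= modulus t)%E. Proof. exact: sqint_ge0. Qed.

Lemma measurable_modulus : measurable_fun setT modulus.
Proof.
apply: (@measurable_fun_tonelli R _ _ (measurableTypeR R) (measurableTypeR R) mu setT (itvT T)
  (fun t x => ((F x - F (x - t)) ^+ 2)%:E)) => //.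
  apply/measurable_EFinP; apply: measurable_funTS; apply: measurable_funX.
  have mc := measurableT_comp measurable_difference (@measurable_swap _ _ (measurableTypeR R) (measurableTypeR R)).
  exact mc.
by move=> t x _ _; rewrite lee_fin sqr_ge0.
Qed.

(** The derivative of the mean over a window of length t is a difference quotient,
    since delaying commutes with taking primitives. *)
Lemma is_prim_average t : 0 < t -> is_prim T (average t) (diffq t).
Proof.
move=> t0; have fp := is_prim_prim f2.
apply: is_prim_eq (is_primZ t^-1 (is_primB fp (is_prim_delay t0 fp))) => x.
rewrite inE /itvT/= in_itv/= => xT; congr (_ * (_ - _)); have [x0 xT'] := andP xT.
rewrite (delayE (T := T))//; have [xt|xt] := ltP 0 (x - t); first by rewrite cutE// xt; lra.
by rewrite cut0 ?negb_and -?leNgt ?xt// prim_le0.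
Qed.

Lemma sqint_diffq t : 0 < t -> ((t ^+ 2)%:E * sqint (itvT T) (diffq t) = modulus t)%E.
Proof.
move=> t0; have [_ [md _] _] := is_prim_average t0; rewrite -sqintZ//.
apply: eq_sqint => x; rewrite inE /itvT/= in_itv/= => xT.
by rewrite /diffq mulrA mulfV ?mul1r ?gt_eqF// (delayE (T := T))// /F (cutE _ xT).
Qed.

Lemma measurable_sqr_slice (a b : R) (D : set R) : measurable_fun D (fun y => (a - F (b - y)) ^+ 2).
Proof.
apply: measurable_funTS; apply: measurable_funX.
apply: measurable_funB; first exact: measurable_cst.
have mr : measurable_fun setT ((fun r : R => b - r) : measurableTypeR R -> measurableTypeR R).
  by apply: measurable_funB; [exact: measurable_cst|exact: measurable_id].
have mc := measurableT_comp mF mr; exact mc.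
Qed.

Lemma sqr_sub_average_le t x : 0 < t -> 0 < x < T ->
  (((f x - average t x) ^+ 2)%:E <=
   t^-1%:E * \int[mu]_(r in `]0%R, t[) ((F x - F (x - r)) ^+ 2)%:E)%E.
Proof.
move=> t0 xT; rewrite /average primB//; last 2 first.
- exact: inL2_integrable.
- by rewrite gerBl ltW.
have md : measurable (`](x - t), x]%classic : set R) by exact: measurable_itv.
have mue : mu (`](x - t), x]%classic : set R) = t%:E.
  rewrite lebesgue_measure_itv/= lte_fin ltrBlDr ltrDl t0 -EFinB.
  by rewrite opprB addrCA subrr addr0.
have Fs := sqintegrable_cut md f2.
rewrite mulrC; apply: le_trans (sqr_sub_mean_le (f x) md t0 mue Fs) _.
have mD2 : measurable_fun setT (fun y => ((f x - F y) ^+ 2)%:E).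
  apply: measurable_sqr; apply: measurable_funB => //; exact: measurable_cst.
apply: lee_wpmul2l; first by rewrite lee_fin invr_ge0 ltW.
rewrite /sqint -(@ge0_integral_reflect _ x)//; last 2 first.
- by apply: measurable_funTS.
- by move=> y _; rewrite lee_fin sqr_ge0.
have -> : (fun r => x - r) @^-1` `](x - t), x] = `[0, t[%classic :> set R.
  by apply/seteqP; split => r /=; rewrite !in_itv/=; lra.
rewrite -integral_itv_obnd_cbnd.
  by rewrite /F (cutE _ xT).
by apply/measurable_EFinP; exact: measurable_sqr_slice.
Qed.

(** Integrate the local bound [sqr_sub_average_le] over x. *)
Lemma average_error t : 0 < t ->
  (sqint (itvT T) (fun x => f x - average t x)%R <=
   t^-1%:E * \int[mu]_(r in `]0%R, t[) modulus r)%E.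
Proof.
move=> t0; have ti : (0 <= t^-1%:E :> \bar R)%E by rewrite lee_fin invr_ge0 ltW.
have mK : measurable_fun setT (fun z : measurableTypeR R * measurableTypeR R => ((F z.1 - F (z.1 - z.2)) ^+ 2)%:E).
  by apply/measurable_EFinP; apply: measurable_funX; exact: measurable_difference.
apply: (@le_trans _ _ (\int[mu]_(x in itvT T) (t^-1%:E * \int[mu]_(r in `]0%R, t[) ((F x - F (x - r)) ^+ 2)%:E))%E).
  apply: ge0_le_integral_nonmeas => x; first by rewrite lee_fin sqr_ge0.
  by rewrite /itvT/= in_itv/= => xT; exact: sqr_sub_average_le.
rewrite ge0_integralZl; [|exact: measurable_itvT| | |exact: ti]; last 2 first.
- apply: (@measurable_fun_tonelli R _ _ (measurableTypeR R) (measurableTypeR R) mu (itvT T) `]0, t[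
    (fun x r => ((F x - F (x - r)) ^+ 2)%:E)) => //; first exact: measurable_funTS.
  by move=> x r _ _; rewrite lee_fin sqr_ge0.
- by move=> x _; apply: integral_ge0 => r _; rewrite lee_fin sqr_ge0.
apply: lee_wpmul2l; first exact: ti.
rewrite (@tonelli_set R _ _ (measurableTypeR R) (measurableTypeR R) mu mu (itvT T) `]0, t[
    (fun x r => ((F x - F (x - r)) ^+ 2)%:E))//; first exact: measurable_funTS.
by move=> x r _ _; rewrite lee_fin sqr_ge0.
Qed.

Definition hardy_sq s : \bar R := \int[mu]_(x in itvT T) (x `^ (- (2 * s)) * f x ^+ 2)%:E.

Lemma hardy_sq_ge0 s : (0 <= hardy_sq s)%E.
Proof. by apply: integral_ge0 => x _; rewrite lee_fin mulr_ge0 ?powR_ge0 ?sqr_ge0. Qed.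

Let mf : measurable_fun (itvT T) f. Proof. by case: f2. Qed.

Lemma measurable_hardy s : measurable_fun (itvT T) (fun x => (x `^ (- (2 * s)) * f x ^+ 2)%:E).
Proof.
apply/measurable_EFinP; apply: measurable_funM; last exact: measurable_funX.
by apply: measurable_funTS; exact: measurable_powR.
Qed.

Let itvT_gt0 : itvT T `<=` `]0, +oo[.
Proof. by move=> x; rewrite /itvT/= !in_itv/= => /andP[->]. Qed.

Lemma hardy_sq_tail s : 0 < s ->
  (\int[mu]_(t in `]0%R, +oo[) ((t `^ (- (2 * s + 1)))%:E * sqint `]0%R, t[ F) =
   (2 * s)^-1%:E * hardy_sq s)%E.
Proof.
move=> s0; rewrite /sqint (tail_swap (phi := fun r => ((F r) ^+ 2)%:E)); last 3 first.
- lra.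
- by apply: measurable_sqr.
- by move=> r; rewrite lee_fin sqr_ge0.
have -> : 1 - (2 * s + 1) = - (2 * s) by ring.
have -> : 2 * s + 1 - 1 = 2 * s by ring.
rewrite /hardy_sq -ge0_integralZl//; last 3 first.
- exact: measurable_hardy.
- by move=> x _; rewrite lee_fin mulr_ge0 ?powR_ge0 ?sqr_ge0.
- by rewrite lee_fin invr_ge0 mulr_ge0// ltW.
rewrite -[in RHS](setIidr itvT_gt0) integral_mkcondr; apply: eq_integral => x _.
rewrite patchE /F /cut patchE; case: ifP => _; last by rewrite expr0n mule0.
by rewrite -!EFinM; congr (_%:E); ring.
Qed.

Let slob_tail s x := (\int[mu]_(y in itvT T) (`|f x - f y| ^+ 2 / `|x - y| `^ (1 + 2 * s))%:E)%E.

Let slob_tail_ge0 s x : (0 <= slob_tail s x)%E.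
Proof. by apply: integral_ge0 => y _; rewrite lee_fin divr_ge0 ?sqr_ge0 ?powR_ge0. Qed.

Let measurable_slob_tail s : measurable_fun (itvT T) (slob_tail s).
Proof.
apply: (@measurable_fun_tonelli R _ _ (measurableTypeR R) (measurableTypeR R) mu (itvT T) (itvT T)
  (fun x y => (`|f x - f y| ^+ 2 / `|x - y| `^ (1 + 2 * s))%:E)) => //.
  exact: measurable_slobodeckij_kernel.
Qed.

Lemma slob_left_le s x : 0 < x < T ->
  (\int[mu]_(y in `]0%R, x[) ((x - y) `^ (- (2 * s + 1)) * (f x - F y) ^+ 2)%:E <= slob_tail s x)%E.
Proof.
move=> /andP[x0 xT].
have sub : `]0, x[ `<=` itvT T by apply: subset_itvl; rewrite bnd_simp ltW.
rewrite -(setIidr sub) integral_mkcondr; apply: ge0_le_integral_nonmeas => y yT.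
  by apply: erestrict_ge0 => *; rewrite lee_fin mulr_ge0 ?powR_ge0 ?sqr_ge0.
rewrite patchE; case: ifP => [|_]; last by rewrite lee_fin divr_ge0 ?sqr_ge0 ?powR_ge0.
rewrite inE/= in_itv/= => /andP[y0 yx].
rewrite lee_fin /F cut_in ?inE// real_normK ?num_real// gtr0_norm ?subr_gt0//.
by rewrite powRN mulrC (addrC 1).
Qed.

(** For r < x this is the kernel of the seminorm, integrated over y = x - r. For
    r >= x the extended function vanishes at x - r, which leaves f x ^+ 2 times the
    tail of the weight. *)
Lemma modulus_tail_le s x : 0 < s -> 0 < x < T ->
  (\int[mu]_(r in `]0%R, +oo[) (r `^ (- (2 * s + 1)) * (F x - F (x - r)) ^+ 2)%:E <=
   slob_tail s x + (2 * s)^-1%:E * (x `^ (- (2 * s)) * f x ^+ 2)%:E)%E.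
Proof.
move=> s0 xT; have [x0 xT'] := andP xT; set q := 2 * s + 1.
have mk (D : set R) : measurable_fun D (fun r => (r `^ (- q) * (F x - F (x - r)) ^+ 2)%:E).
  apply/measurable_EFinP; apply: measurable_funM; last exact: measurable_sqr_slice.
  by apply: measurable_funTS; exact: measurable_powR.
rewrite (itv0y_split x0) ge0_integral_setU//=; last 3 first.
- exact: mk.
- by move=> r _; rewrite lee_fin mulr_ge0 ?powR_ge0 ?sqr_ge0.
- apply/disj_setPS => t [/=]; rewrite !in_itv/= => /andP[_ th].
  by rewrite andbT leNgt th.
apply: leeD.
  apply: le_trans (slob_left_le s xT).
  rewrite -(@ge0_integral_reflect _ x `]0, x[ (fun y => ((x - y) `^ (- (2 * s + 1)) * (f x - F y) ^+ 2)%:E))//; last 2 first.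
  - apply/measurable_EFinP; apply: measurable_funM.
      apply: measurable_funTS.
      apply: (@measurableT_comp _ _ _ _ _ _ (fun z : R => z `^ (- (2 * s + 1)))).
        exact: measurable_powR.
      by apply: measurable_funB; [exact: measurable_cst|exact: measurable_id].
    apply: measurable_funTS; apply: measurable_funX.
    by apply: measurable_funB => //; exact: measurable_cst.
  - by move=> y _; rewrite lee_fin mulr_ge0 ?powR_ge0 ?sqr_ge0.
  have -> : (fun r => x - r) @^-1` `]0, x[ = `]0, x[%classic :> set R.
    by apply/seteqP; split => r /=; rewrite !in_itv/=; lra.
  rewrite le_eqVlt; apply/orP; left; apply/eqP; apply: eq_integral => r _.
  by rewrite subKr /F (cutE _ xT).
have -> : (\int[mu]_(r in `[x, +oo[) (r `^ (- q) * (F x - F (x - r)) ^+ 2)%:E =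
    \int[mu]_(r in `[x, +oo[) ((f x ^+ 2)%:E * (r `^ (- q))%:E))%E.
  apply: eq_integral => r; rewrite inE/= in_itv/= andbT => xr.
  rewrite /F (cutE _ xT) cut0; last by rewrite negb_and -leNgt subr_le0 xr.
  by rewrite subr0 -EFinM mulrC.
rewrite ge0_integralZl//; last 3 first.
- exact: measurable_powRN.
- by move=> r _; rewrite lee_fin powR_ge0.
- by rewrite lee_fin sqr_ge0.
rewrite integral_powR_tail//; last by rewrite /q; lra.
rewrite -!EFinM lee_fin /q le_eqVlt; apply/orP; left; apply/eqP.
have -> : 1 - (2 * s + 1) = - (2 * s) by ring.
by have -> : 2 * s + 1 - 1 = 2 * s by [ring|]; ring.
Qed.

Lemma modulus_integral_le s : 0 < s ->
  (\int[mu]_(r in `]0%R, +oo[) ((r `^ (- (2 * s + 1)))%:E * modulus r) <=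
   slobodeckij_sq T s f + (2 * s)^-1%:E * hardy_sq s)%E.
Proof.
move=> s0; set q := 2 * s + 1.
pose k r x : \bar R := (r `^ (- q) * (F x - F (x - r)) ^+ 2)%:E.
have k0 r x : (0 <= k r x)%E by rewrite lee_fin mulr_ge0 ?powR_ge0 ?sqr_ge0.
have mk : measurable_fun ((`]0, +oo[%classic : set (measurableTypeR R)) `*` (itvT T : set (measurableTypeR R)))
    (fun z : measurableTypeR R * measurableTypeR R => k z.1 z.2).
  apply: measurable_funTS; apply/measurable_EFinP; apply: measurable_funM.
    have mp : measurable_fun setT (@powR R ^~ (- q)) by exact: measurable_powR.
    have mc := measurableT_comp mp (@measurable_fst _ _ (measurableTypeR R) (measurableTypeR R)).
    exact mc.
  apply: measurable_funX.
  have mc := measurableT_comp measurable_difference (@measurable_swap _ _ (measurableTypeR R) (measurableTypeR R)).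
  exact mc.
have -> : (\int[mu]_(r in `]0%R, +oo[) ((r `^ (- q))%:E * modulus r) =
    \int[mu]_(r in `]0%R, +oo[) \int[mu]_(x in itvT T) k r x)%E.
  apply: eq_integral => r _; rewrite /modulus /sqint -ge0_integralZl_EFin ?powR_ge0//.
  - by move=> x _; rewrite lee_fin sqr_ge0.
  - apply: measurable_sqr; apply: measurable_funTS; apply: measurable_funB => //.
    have mr : measurable_fun setT ((fun x : R => x - r) : measurableTypeR R -> measurableTypeR R).
      by apply: measurable_funB; [exact: measurable_id|exact: measurable_cst].
    have mc := measurableT_comp mF mr; exact mc.
rewrite (@tonelli_set R _ _ (measurableTypeR R) (measurableTypeR R) mu mu `]0, +oo[ (itvT T) k)//.
have ms0 : (0 <= (2 * s)^-1%:E :> \bar R)%E by rewrite lee_fin invr_ge0 mulr_ge0// ltW.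
apply: (@le_trans _ _ (\int[mu]_(x in itvT T)
   (slob_tail s x + (2 * s)^-1%:E * (x `^ (- (2 * s)) * f x ^+ 2)%:E))%E).
  apply: ge0_le_integral_nonmeas => x; first by move=> _; exact: integral_ge0.
  by rewrite /itvT/= in_itv/=; exact: modulus_tail_le.
have h0 x : (0 <= (x `^ (- (2 * s)) * f x ^+ 2)%:E)%E by rewrite lee_fin mulr_ge0 ?powR_ge0 ?sqr_ge0.
have mh := measurable_hardy s.
rewrite ge0_integralD//; last 3 first.
- exact: measurable_slob_tail.
- by move=> x _; exact: mule_ge0.
- exact: measurable_funeM.
by rewrite /hardy_sq ge0_integralZl.
Qed.

(** Averaging f x ^+ 2 <= (1 + e) f y ^+ 2 + (1 + 1/e) (f x - f y) ^+ 2 over y < x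
    bounds the left side by (1 + e) / (2 s) times itself plus a multiple of the
    squared seminorm. For 2 s > 1 some e > 0 makes this factor less than 1, and
    the first term is absorbed in the left side, which is finite. *)
Lemma hardy_inequality s : 2^-1 < s -> (hardy_sq s < +oo)%E ->
  (hardy_sq s <= (4 * s * (2 * s + 1) / (2 * s - 1) ^+ 2)%:E * slobodeckij_sq T s f)%E.
Proof.
move=> s1 Nfin; have s0 : 0 < s by apply: lt_trans s1; rewrite invr_gt0.
have s21 : 0 < 2 * s - 1 by lra.
pose q := 2 * s + 1; have q0 : 0 < q by rewrite /q; lra.
(* With this e, (1 + e) / (2 s) = (2 s + 1) / (4 s) < 1. *)
pose e := (2 * s - 1) / 2; have e0 : 0 < e by rewrite divr_gt0.
pose b := (2 * s + 1) / (2 * s - 1); have b0 : 0 < b by rewrite divr_gt0.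
have be : b = 1 + e^-1 by rewrite /b /e; field; rewrite gt_eqF.
have w0 x : (0 <= (x `^ (- q))%:E :> \bar R)%E by rewrite lee_fin powR_ge0.
have eE0 : (0 <= (1 + e)%:E :> \bar R)%E by rewrite lee_fin; lra.
have bE0 : (0 <= b%:E :> \bar R)%E by rewrite lee_fin ltW.
have young x y : x ^+ 2 <= (1 + e) * y ^+ 2 + b * (x - y) ^+ 2.
  rewrite -subr_ge0 be.
  have -> : (1 + e) * y ^+ 2 + (1 + e^-1) * (x - y) ^+ 2 - x ^+ 2 = e^-1 * (e * y - (x - y)) ^+ 2.
    by field; rewrite gt_eqF.
  by rewrite mulr_ge0 ?sqr_ge0// invr_ge0 ltW.
have mFx (D : set R) : measurable_fun D F by exact: measurable_funTS.
have mdF x (D : set R) : measurable_fun D (fun y => f x - F y).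
  by apply: measurable_funB => //; exact: measurable_cst.
have key x : 0 < x < T -> ((x `^ (- (2 * s)) * f x ^+ 2)%:E <=
    (1 + e)%:E * ((x `^ (- q))%:E * sqint `]0%R, x[ F) + b%:E * slob_tail s x)%E.
  move=> xT; have [x0 xT'] := andP xT.
  have h1 : ((x * f x ^+ 2)%:E <= (1 + e)%:E * sqint `]0%R, x[ F + b%:E * sqint `]0%R, x[ (fun y => f x - F y)%R)%E.
    have mue : mu (`]0, x[%classic : set R) = x%:E.
      by rewrite lebesgue_measure_itv/= lte_fin x0 sube0.
    have -> : (x * f x ^+ 2)%:E = sqint `]0, x[ (cst (f x)).
      rewrite /sqint (_ : (fun x0 => _) = cst (f x ^+ 2)%:E)// integral_cst//.
      by rewrite [X in (_ * X)%E]mue -EFinM mulrC.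
    by apply: sqint_le2.
  have -> : x `^ (- (2 * s)) * f x ^+ 2 = x `^ (- q) * (x * f x ^+ 2).
    have -> : - (2 * s) = - q + 1 by rewrite /q; ring.
    rewrite powRD; last by rewrite (gt_eqF x0) implybT.
    by rewrite powRr1 ?(ltW x0)// mulrA.
  rewrite EFinM; apply: le_trans (lee_wpmul2l (w0 x) h1) _.
  have p1 : (0 <= (1 + e)%:E * sqint `]0%R, x[ F)%E by rewrite mule_ge0// sqint_ge0.
  have p2 : (0 <= b%:E * sqint `]0%R, x[ (fun y => f x - F y)%R)%E by rewrite mule_ge0// sqint_ge0.
  rewrite (ge0_muleDr _ p1 p2) (muleCA _ (1 + e)%:E) (muleCA _ b%:E).
  apply: leeD => //; apply: lee_wpmul2l => //; apply: le_trans (slob_left_le s xT).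
  rewrite /sqint -ge0_integralZl_EFin; [|exact: measurable_itv| | |exact: powR_ge0]; last 2 first.
  - by move=> y _; rewrite lee_fin sqr_ge0.
  - exact: measurable_sqr.
  apply: ge0_le_integral_nonmeas => y; rewrite /= in_itv/= => /andP[y0 yx].
    by rewrite mule_ge0// lee_fin sqr_ge0.
  rewrite -EFinM lee_fin; apply: ler_wpM2r; first exact: sqr_ge0.
  rewrite !powRN lef_pV2 ?posrE ?powR_gt0 ?subr_gt0//.
  by apply: ge0_ler_powR; rewrite ?nnegrE ?subr_ge0 ?(ltW q0) ?(ltW yx) ?(ltW x0)//; lra.
have msq : measurable_fun (`]0, +oo[%classic : set R) (fun x => (x `^ (- q))%:E * sqint `]0%R, x[ F)%E.
  apply: emeasurable_funM; first exact: measurable_powRN.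
  apply: nondecreasing_emeasurable => x y x0 xy.
  apply: sqint_subset => //.
  by apply: subset_itvl; rewrite bnd_simp.
have sq0 x : (0 <= (x `^ (- q))%:E * sqint `]0%R, x[ F)%E by rewrite mule_ge0// sqint_ge0.
have H : (hardy_sq s <= ((2 * s + 1) / (4 * s))%:E * hardy_sq s + b%:E * slobodeckij_sq T s f)%E.
  apply: (@le_trans _ _ (\int[mu]_(x in itvT T)
     ((1 + e)%:E * ((x `^ (- q))%:E * sqint `]0%R, x[ F) + b%:E * slob_tail s x))%E).
    apply: ge0_le_integral_nonmeas => x.
      by rewrite lee_fin mulr_ge0 ?powR_ge0 ?sqr_ge0.
    by rewrite /itvT/= in_itv/=; exact: key.
  have msT : measurable_fun (itvT T) (fun x => (x `^ (- q))%:E * sqint `]0%R, x[ F)%E.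
    exact: measurable_funS msq.
  have mst : measurable_fun (itvT T) (slob_tail s) by exact: measurable_slob_tail.
  rewrite ge0_integralD//; last 4 first.
  - by move=> x _; exact: mule_ge0.
  - exact: measurable_funeM.
  - by move=> x _; exact: mule_ge0.
  - exact: measurable_funeM.
  rewrite !ge0_integralZl//.
  apply: leeD => //.
  have -> : (2 * s + 1) / (4 * s) = (1 + e) * (2 * s)^-1.
    by rewrite /e; field; rewrite gt_eqF.
  rewrite EFinM -muleA; apply: lee_wpmul2l => //.
  rewrite -hardy_sq_tail//; apply: ge0_subset_integral => //.
have S0 := slobodeckij_sq_ge0 T s f.
have Nf : hardy_sq s \is a fin_num by rewrite ge0_fin_numE// hardy_sq_ge0.
have C0 : 0 < 4 * s * (2 * s + 1) / (2 * s - 1) ^+ 2.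
  by rewrite divr_gt0 ?exprn_gt0// !mulr_gt0// addr_gt0// mulr_gt0.
case: (slobodeckij_sq T s f) S0 H => [S _|_ _|//]; last by rewrite gt0_muley ?leey.
rewrite -(fineK Nf) -!EFinM -EFinD !lee_fin; set N := fine _ => H.
(* The inverse of 1 - (2 s + 1) / (4 s). *)
pose k := 4 * s / (2 * s - 1).
have k0 : 0 < k by rewrite divr_gt0// mulr_gt0.
have : k * (N - (2 * s + 1) / (4 * s) * N) <= k * (b * S).
  by rewrite ler_pM2l//; lra.
have -> : k * (N - (2 * s + 1) / (4 * s) * N) = N.
  by rewrite /k; field; rewrite ?gt_eqF.
have -> // : k * (b * S) = 4 * s * (2 * s + 1) / (2 * s - 1) ^+ 2 * S.
by rewrite /k /b; field; rewrite gt_eqF.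
Qed.

End Differences.

(** * The rate for 1/2 < s < 1 *)

Section Gap.
Context {R : realType} (T : R) (f : R -> R).
Hypothesis f2 : inL2 T f.
Implicit Types (t r s : R).

(** Bounds the two terms that the splitting of f by its mean over a window of
    length t produces, see [average_splitting_le]. *)
Definition averaging_bound t : \bar R :=
  (t^-1%:E * (\int[mu]_(r in `]0%R, t[) modulus T f r) + modulus T f t)%E.

Let mmod (D : set R) : measurable_fun D (modulus T f).
Proof. by apply: measurable_funTS; exact: measurable_modulus. Qed.

Let int_ge0 t : (0 <= \int[mu]_(r in `]0%R, t[) modulus T f r)%E.
Proof. by apply: integral_ge0 => r _; exact: modulus_ge0. Qed.

Lemma averaging_bound_ge0 t : 0 < t -> (0 <= averaging_bound t)%E.
Proof.
move=> t0; apply: adde_ge0; last exact: modulus_ge0.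
by rewrite mule_ge0// lee_fin invr_ge0 ltW.
Qed.

Let measurable_int_modulus : measurable_fun (`]0, +oo[%classic : set R)
  (fun t => \int[mu]_(r in `]0%R, t[) modulus T f r)%E.
Proof.
apply: nondecreasing_emeasurable => x y x0 xy; apply: ge0_subset_integral => //.
- exact: mmod.
- by move=> r _; exact: modulus_ge0.
- by apply: subset_itvl; rewrite bnd_simp.
Qed.

Let measurable_average_modulus : measurable_fun (`]0, +oo[%classic : set R)
  (fun t => t^-1%:E * (\int[mu]_(r in `]0%R, t[) modulus T f r))%E.
Proof.
apply: emeasurable_funM.
  apply: (eq_measurable_fun (fun t : R => (t `^ (- 1))%:E)).
    by move=> t; rewrite inE/= in_itv/= andbT => t0; rewrite powRN powRr1 ?ltW.
  exact: measurable_powRN.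
exact: measurable_int_modulus.
Qed.

Lemma measurable_averaging_bound : measurable_fun (`]0, +oo[%classic : set R) averaging_bound.
Proof.
have mm : measurable_fun (`]0, +oo[%classic : set R) (modulus T f) by exact: mmod.
exact (emeasurable_funD measurable_average_modulus mm).
Qed.

Lemma average_splitting_le t : 0 < t ->
  (sqint (itvT T) (fun x => f x - average T f t x)%R +
   (t ^+ 2)%:E * sqint (itvT T) (diffq f t) <= averaging_bound t)%E.
Proof. by move=> t0; rewrite (sqint_diffq f2 t0) leeD2r//; exact: average_error. Qed.

(** Exchanging the integrations, the mean of the modulus over ]0, t[ has a weighted
    integral not larger than that of the modulus itself. *)
Lemma averaging_bound_integral_le s : 0 < s ->
  (\int[mu]_(t in `]0%R, +oo[) ((t `^ (- (2 * s + 1)))%:E * averaging_bound t) <=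
   2%:E * \int[mu]_(t in `]0%R, +oo[) ((t `^ (- (2 * s + 1)))%:E * modulus T f t))%E.
Proof.
move=> s0; set q := 2 * s + 1; have q1 : 1 < q by rewrite /q; lra.
have w0 t : (0 <= (t `^ (- q))%:E :> \bar R)%E by rewrite lee_fin powR_ge0.
have mw (D : set R) : measurable_fun D (fun t : R => (t `^ (- q))%:E) by exact: measurable_powRN.
have D0 : measurable (`]0, +oo[%classic : set R) by exact: measurable_itv.
have -> : (\int[mu]_(t in `]0%R, +oo[) ((t `^ (- q))%:E * averaging_bound t) =
  \int[mu]_(t in `]0%R, +oo[) ((t `^ (- (q + 1)))%:E * (\int[mu]_(r in `]0%R, t[) modulus T f r)) +
  \int[mu]_(t in `]0%R, +oo[) ((t `^ (- q))%:E * modulus T f t))%E.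
  rewrite -ge0_integralD//; first last.
  - have mm : measurable_fun (`]0, +oo[%classic : set R) (modulus T f) by exact: mmod.
    exact (emeasurable_funM (mw _) mm).
  - by move=> t _; rewrite mule_ge0// modulus_ge0.
  - have mw1 : measurable_fun (`]0, +oo[%classic : set R) (fun t : R => (t `^ (- (q + 1)))%:E).
      exact: measurable_powRN.
    exact (emeasurable_funM mw1 measurable_int_modulus).
  - by move=> t _; rewrite mule_ge0// lee_fin powR_ge0.
  apply: eq_integral => t; rewrite inE/= in_itv/= andbT => t0.
  have p1 : (0 <= t^-1%:E * (\int[mu]_(r in `]0%R, t[) modulus T f r))%E.
    by rewrite mule_ge0// lee_fin invr_ge0 ltW.
  rewrite /averaging_bound (ge0_muleDr _ p1 (modulus_ge0 _ _ _)) muleA -EFinM; congr ((_)%:E * _ + _)%E.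
  rewrite (opprD q) powRD; last by rewrite (gt_eqF t0) implybT.
  by rewrite (powRN t 1) powRr1// ltW.
rewrite tail_swap//; last 2 first.
- lra.
- by move=> r; exact: modulus_ge0.
have -> : 2%:E = (1%:E + 1%:E)%E :> \bar R by rewrite -EFinD; congr (_%:E); lra.
rewrite ge0_muleDl ?lee_fin// mul1e; apply: leeD => //.
apply: ge0_le_integral_nonmeas => r; rewrite /= in_itv/= andbT => r0.
  by rewrite mule_ge0 ?modulus_ge0// lee_fin divr_ge0 ?powR_ge0//; lra.
apply: lee_wpmul2r; first exact: modulus_ge0.
have -> : 1 - (q + 1) = - q by ring.
have -> : q + 1 - 1 = q by ring.
rewrite lee_fin ler_pdivrMr; last by lra.
by rewrite ler_peMr ?powR_ge0// ltW.
Qed.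

Definition averaging_cst s : R :=
  2 * (1 + (2 * s)^-1 * (4 * s * (2 * s + 1) / (2 * s - 1) ^+ 2)).

Lemma averaging_bound_slobodeckij_le s : 2^-1 < s -> (hardy_sq T f s < +oo)%E ->
  (\int[mu]_(t in `]0%R, +oo[) ((t `^ (- (2 * s + 1)))%:E * averaging_bound t) <=
   (averaging_cst s)%:E * slobodeckij_sq T s f)%E.
Proof.
move=> s1 Nfin; have s0 : 0 < s by apply: lt_trans s1; rewrite invr_gt0.
have two0 : (0 <= 2%:E :> \bar R)%E by [].
have ms0 : (0 <= (2 * s)^-1%:E :> \bar R)%E by rewrite lee_fin invr_ge0 mulr_ge0// ltW.
apply: le_trans (averaging_bound_integral_le s0) _.
rewrite /averaging_cst EFinM -muleA; apply: lee_wpmul2l => //.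
apply: le_trans (modulus_integral_le f2 s0) _.
rewrite EFinD ge0_muleDl//; last first.
  by rewrite lee_fin mulr_ge0 ?invr_ge0 ?divr_ge0 ?sqr_ge0// !mulr_ge0 ?addr_ge0// ?mulr_ge0// ltW.
rewrite mul1e; apply: leeD => //.
rewrite EFinM -muleA; apply: lee_wpmul2l => //.
exact: hardy_inequality.
Qed.

End Gap.

Section LowRate.
Context {R : realType} (L : R) (n : nat).
Hypothesis L_gt0 : 0 < L.
Let T := n.+1%:R * L.
Let T_gt0 : 0 < T := final_time_gt0 n L_gt0.
Variables (m : seq R * seq R) (c : R).
Hypothesis m_mesh : is_mesh T m.
Hypothesis m_slices : time_slice_matching L n.+1 m.
Hypothesis m_adm : S10_admissible T c m.
Let h := meshwidth m.
Let h_gt0 : 0 < h := meshwidth_gt0 T_gt0 m_mesh.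
Let M := error_cst n c.
Let M_gt0 : 0 < M := error_cst_gt0 n c.

(** The mass of z near 0 is bounded by the K-functional, whose weighted integral is
    finite by assumption. *)
Lemma hardy_sq_lty s z : inL2S T z -> 0 < s ->
  (\int[mu]_(t in `]0%R, +oo[) ((t `^ (- (2 * s) - 1))%:E * K_sq T t z) < +oo)%E ->
  (hardy_sq T z.1 s < +oo)%E /\ (hardy_sq T z.2 s < +oo)%E.
Proof.
move=> z2 s0 Kfin; have [z21 z22] := z2.
have key f : inL2 T f -> (forall t, (0 < t)%R -> sqint (`]0%R, t[ `&` itvT T) f <= 2%:E * K_sq T t z)%E ->
  (hardy_sq T f s < +oo)%E.
  move=> f2 Hf.
  have H : ((2 * s)^-1%:E * hardy_sq T f s <=
     2%:E * \int[mu]_(t in `]0%R, +oo[) ((t `^ (- (2 * s) - 1))%:E * K_sq T t z))%E.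
    rewrite -(hardy_sq_tail f2 s0) -ge0_integralZl//; last 2 first.
    - apply: emeasurable_funM; last exact: measurable_K_sq.
      have -> : - (2 * s) - 1 = - (2 * s + 1) by ring.
      exact: measurable_powRN.
    - by move=> t _; rewrite mule_ge0 ?K_sq_ge0// lee_fin powR_ge0.
    apply: ge0_le_integral_nonmeas => t; rewrite /= in_itv/= andbT => t0.
      by rewrite mule_ge0 ?sqint_ge0// lee_fin powR_ge0.
    rewrite muleCA opprD; apply: lee_wpmul2l; first by rewrite lee_fin powR_ge0.
    by rewrite sqint_cut//; exact: Hf.
  have : ((2 * s)^-1%:E * hardy_sq T f s < +oo)%E.
    by apply: le_lt_trans H _; exact: lte_mul_pinfty.
  case E : (hardy_sq T f s) => [r| |]//; rewrite ?ltry//.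
  by rewrite gt0_muley// lte_fin invr_gt0 mulr_gt0.
split; apply: key => // t t0; have [h1 h2] := sqint_near0_K_sq T_gt0 z2 t0 => //.
Qed.

Lemma galerkin_rate_lt1 s z zh : 2^-1 < s < 1 -> inL2S T z ->
  (\int[mu]_(t in `]0%R, +oo[) ((t `^ (- (2 * s) - 1))%:E * K_sq T t z) < +oo)%E ->
  galerkin_approx L n m z zh ->
  (\int[mu]_(t in `]0%R, +oo[) ((t `^ (- 2))%:E * K_sq T t (z - zh)%R) <=
   (9 * M * averaging_cst s * h `^ (2 * s - 1))%:E *
     (hs_normsq T s z.1 + hs_normsq T s z.2))%E.
Proof.
move=> /andP[s1 s_lt1] z2 Kfin zg; have s0 : 0 < s by apply: lt_trans s1; rewrite invr_gt0.
have [z21 z22] := z2; have [N1 N2] := hardy_sq_lty z2 s0 Kfin.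
set q := 2 * s + 1; have q1 : 1 < q by rewrite /q; lra.
pose G t := (averaging_bound T z.1 t + averaging_bound T z.2 t)%E.
have G0 t : 0 < t -> (0 <= G t)%E by move=> t0; apply: adde_ge0; exact: averaging_bound_ge0.
have mG (D : set R) : D `<=` `]0, +oo[ -> measurable D -> measurable_fun D G.
  move=> D0 mD; have mGG := emeasurable_funD (measurable_averaging_bound z21) (measurable_averaging_bound z22).
  exact: (measurable_funS (measurable_itv `]0, +oo[) D0 mGG).
pose w t := (average T z.1 t, average T z.2 t).
pose u t := (diffq z.1 t, diffq z.2 t).
have wu t : 0 < t -> is_primS T (w t) (u t) by move=> t0; split; exact: is_prim_average.
have wG t : 0 < t -> (l2normsqS T (z - w t)%R + (t ^+ 2)%:E * l2normsqS T (u t) <= G t)%E.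
  move=> t0; rewrite /l2normsqS !l2normsqE/= (ge0_muleDr _ (sqint_ge0 _ _) (sqint_ge0 _ _)).
  by rewrite addeACA; apply: leeD; exact: average_splitting_le.
pose W := (\int[mu]_(t in `]0%R, +oo[) ((t `^ (- q))%:E * G t))%E.
have wt0 t r : (0 <= (t `^ r)%:E :> \bar R)%E by rewrite lee_fin powR_ge0.
have W0 : (0 <= W)%E.
  by apply: integral_ge0 => t; rewrite /= in_itv/= andbT => t0; rewrite mule_ge0// G0.
have WS : (W <= (averaging_cst s)%:E * (hs_normsq T s z.1 + hs_normsq T s z.2))%E.
  have -> : W = (\int[mu]_(t in `]0%R, +oo[) ((t `^ (- q))%:E * averaging_bound T z.1 t) +
     \int[mu]_(t in `]0%R, +oo[) ((t `^ (- q))%:E * averaging_bound T z.2 t))%E.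
    have mg f : inL2 T f -> measurable_fun (`]0, +oo[%classic : set R) (fun t => (t `^ (- q))%:E * averaging_bound T f t)%E.
      by move=> f2; apply: emeasurable_funM; [exact: measurable_powRN|exact: measurable_averaging_bound].
    have g0 f t : t \in `]0, +oo[ -> (0 <= (t `^ (- q))%:E * averaging_bound T f t)%E.
      by rewrite in_itv/= andbT => t0; rewrite mule_ge0// averaging_bound_ge0.
    have D0 : measurable (`]0, +oo[%classic : set R) by exact: measurable_itv.
    rewrite -(ge0_integralD mu D0 (g0 z.1) (mg _ z21) (g0 z.2) (mg _ z22)).
    apply: eq_integral => t; rewrite inE/= in_itv/= andbT => t0.
    by rewrite ge0_muleDr// averaging_bound_ge0.
  have tr : Num.truncn s = 0%N by apply/eqP; rewrite truncn_eq ?s_lt1 ltW.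
  have hsE f : (slobodeckij_sq T s f <= hs_normsq T s f)%E.
    rewrite /hs_normsq tr subr0 s0 big_ord1/= l2normsqE -[leLHS]add0e.
    by apply: leeD => //; exact: sqint_ge0.
  have low0 : (0 <= (averaging_cst s)%:E)%E.
    rewrite lee_fin /averaging_cst mulr_ge0// addr_ge0// mulr_ge0 ?invr_ge0 ?divr_ge0 ?sqr_ge0//.
      by rewrite mulr_ge0// ltW.
    by rewrite !mulr_ge0 ?addr_ge0// ?mulr_ge0// ltW.
  have hz1 := hs_normsq_ge0 T s z.1; have hz2 := hs_normsq_ge0 T s z.2.
  rewrite (ge0_muleDr _ hz1 hz2); apply: leeD.
    exact: (le_trans (averaging_bound_slobodeckij_le z21 s1 N1) (lee_wpmul2l low0 (hsE _))).
  exact: (le_trans (averaging_bound_slobodeckij_le z22 s1 N2) (lee_wpmul2l low0 (hsE _))).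
have M0 : (0 <= M%:E :> \bar R)%E by rewrite lee_fin ltW.
have KG t : 0 < t -> (K_sq T t (z - zh)%R <= M%:E * G t)%E.
  move=> t0; apply: le_trans (K_sq_galerkin_error L_gt0 m_mesh m_slices m_adm t z2 zg (wu t t0)) _.
  by apply: lee_wpmul2l => //; exact: wG.
pose B := l2normsqS T (z - zh)%R.
have BG t : h / 2 <= t -> (B <= (4 * M)%:E * G t)%E.
  move=> ht; have t0 : 0 < t by apply: lt_le_trans ht; rewrite divr_gt0.
  apply: le_trans (l2_galerkin_error L_gt0 c m_mesh m_slices z2 zg (wu t t0)) _.
  have -> : (4 * M)%:E = (M%:E * 4%:E)%E by rewrite -EFinM mulrC.
  rewrite -muleA; apply: lee_wpmul2l => //.
  have u0 := l2normsqS_ge0 T (u t); have v0 := l2normsqS_ge0 T (z - w t).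
  have t20 : (0 <= (t ^+ 2)%:E :> \bar R)%E by rewrite lee_fin sqr_ge0.
  apply: (@le_trans _ _ (4%:E * (l2normsqS T (z - w t)%R + (t ^+ 2)%:E * l2normsqS T (u t)))%E); last first.
    by apply: lee_wpmul2l => //; exact: wG.
  rewrite (ge0_muleDr _ v0 (mule_ge0 t20 u0)); apply: leeD.
    by rewrite -[leLHS]mul1e; apply: lee_wpmul2r => //; rewrite lee_fin; lra.
  rewrite muleA -EFinM; apply: lee_wpmul2r => //; rewrite lee_fin.
  have -> : 4 * t ^+ 2 = (2 * t) ^+ 2 by ring.
  by rewrite ler_sqr ?nnegrE ?mulr_ge0// ?(ltW h_gt0) ?(ltW t0)//; move: ht; rewrite ler_pdivrMr// mulrC.
have B0 : (0 <= B)%E by exact: l2normsqS_ge0.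
(* The bound [BG] for one window length is averaged over [h/2, h[ against the
   weight, which has mass at least (h / 2) h^(- q) there. *)
have BW : ((h^-1)%:E * B <= (8 * M * h `^ (2 * s - 1))%:E * W)%E.
  have H1 : ((h / 2 * h `^ (- q))%:E * B <= (4 * M)%:E * W)%E.
    have mue : mu (`[h / 2, h[%classic : set R) = (h / 2)%:E.
      rewrite lebesgue_measure_itv/= lte_fin ltr_pdivrMr// ltr_pMr// ifT; last by lra.
      by rewrite -EFinB; congr (_%:E); lra.
    have sub : `[h / 2, h[ `<=` `]0, +oo[.
      move=> t /=; rewrite !in_itv/= andbT => /andP[ht _].
      by apply: lt_le_trans ht; rewrite divr_gt0.
    rewrite (mulrC (h / 2)) EFinM muleAC -mue -integral_cst//.
    apply: (@le_trans _ _ (\int[mu]_(t in `[(h / 2)%R, h[) ((4 * M)%:E * ((t `^ (- q))%:E * G t)))%E).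
      apply: ge0_le_integral_nonmeas => t; first by rewrite mule_ge0.
      rewrite /= in_itv/= => /andP[ht th]; rewrite muleCA.
      have t0 : 0 < t by apply: lt_le_trans ht; rewrite divr_gt0.
      apply: (@le_trans _ _ ((t `^ (- q))%:E * B)%E).
        apply: lee_wpmul2r => //; rewrite lee_fin !powRN lef_pV2 ?posrE ?powR_gt0//.
        by apply: ge0_ler_powR; rewrite ?nnegrE ?(ltW t0) ?(ltW h_gt0) ?(ltW th)//; lra.
      by apply: lee_wpmul2l => //; exact: BG.
    rewrite -ge0_integralZl//; last 3 first.
    - by apply: emeasurable_funM; [exact: measurable_powRN|exact: mG].
    - by move=> t; rewrite /= in_itv/= andbT => t0; rewrite mule_ge0// G0.
    - by rewrite lee_fin mulr_ge0// ltW.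
    apply: ge0_subset_integral => //.
      apply: measurable_funeM; apply: emeasurable_funM; [exact: measurable_powRN|exact: mG].
    move=> t; rewrite /= in_itv/= andbT => t0; rewrite mule_ge0//.
      by rewrite lee_fin mulr_ge0// ltW.
    by rewrite mule_ge0// G0.
  have r0 : (0 <= (2 * h `^ (2 * s - 1))%:E :> \bar R)%E by rewrite lee_fin mulr_ge0 ?powR_ge0.
  have := lee_wpmul2l r0 H1; rewrite !muleA -!EFinM.
  have -> : 2 * h `^ (2 * s - 1) * (h / 2 * h `^ (- q)) = h^-1.
    transitivity (h * (h `^ (2 * s - 1) * h `^ (- q))); first by field.
    rewrite -powRD; last by rewrite (gt_eqF h_gt0) implybT.
    have -> : 2 * s - 1 + - q = - 2 by rewrite /q; ring.
    by rewrite powRN powR_mulrn ?(ltW h_gt0)// expr2 invfM mulVKf// gt_eqF.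
  by have -> : 2 * h `^ (2 * s - 1) * (4 * M) = 8 * M * h `^ (2 * s - 1) by ring.
have one_lt2 : 1 < 2 :> R by lra.
have sub : (`]0, h[%classic : set R) `<=` `]0, +oo[ by apply: subset_itvl; rewrite bnd_simp.
apply: le_trans (weighted_split_le (A := fun t => (M%:E * G t)%E) (B := B) h_gt0 one_lt2 _ _ _ _ _) _.
- by move=> t _; exact: K_sq_ge0.
- by apply: measurable_funeM; exact: mG.
- by move=> t /andP[t0 _]; exact: KG.
- exact: B0.
- by move=> t _; exact: K_sq_le_l2normsqS.
have -> : 1 - 2 = - 1 :> R by lra.
have -> : 2 - 1 = 1 :> R by lra.
rewrite divr1 powRN powRr1 ?(ltW h_gt0)//.
(* For t < h the weights compare as t^(- 2) <= h^(2 s - 1) t^(- q). *)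
have H1 : (\int[mu]_(t in `]0%R, h[) ((t `^ (- 2))%:E * (M%:E * G t)) <=
   (M * h `^ (2 * s - 1))%:E * W)%E.
  have Mh0 : (0 <= (M * h `^ (2 * s - 1))%:E :> \bar R)%E.
    by rewrite lee_fin mulr_ge0 ?powR_ge0// ltW.
  rewrite -ge0_integralZl//; last 2 first.
  - by apply: emeasurable_funM; [exact: measurable_powRN|exact: mG].
  - by move=> t; rewrite /= in_itv/= andbT => t0; rewrite mule_ge0// G0.
  apply: (@le_trans _ _ (\int[mu]_(t in `]0%R, h[) ((M * h `^ (2 * s - 1))%:E * ((t `^ (- q))%:E * G t)))%E).
    apply: ge0_le_integral_nonmeas => t; rewrite /= in_itv/= => /andP[t0 th].
      by rewrite !mule_ge0// G0.
    rewrite !muleA -!EFinM; apply: lee_wpmul2r; first exact: G0.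
    rewrite lee_fin mulrC -mulrA ler_pM2l//.
    have -> : - 2 = (2 * s - 1) + - q by rewrite /q; ring.
    rewrite powRD; last by rewrite (gt_eqF t0) implybT.
    apply: ler_wpM2r; first exact: powR_ge0.
    by apply: ge0_ler_powR; rewrite ?nnegrE ?(ltW t0) ?(ltW h_gt0) ?(ltW th)//; lra.
  apply: ge0_subset_integral => //.
    apply: measurable_funeM; apply: emeasurable_funM; [exact: measurable_powRN|exact: mG].
  by move=> t; rewrite /= in_itv/= andbT => t0; rewrite !mule_ge0// G0.
apply: le_trans (leeD H1 BW) _.
rewrite -ge0_muleDl; [|by rewrite lee_fin !mulr_ge0 ?powR_ge0// ltW..].
rewrite -EFinD (_ : _ + _ = 9 * M * h `^ (2 * s - 1)); last by ring.
have Mh0 : (0 <= (9 * M * h `^ (2 * s - 1))%:E :> \bar R)%E.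
  by rewrite lee_fin !mulr_ge0 ?powR_ge0// ltW.
apply: le_trans (lee_wpmul2l Mh0 WS) _.
rewrite muleA -EFinM.
by have -> : 9 * M * h `^ (2 * s - 1) * averaging_cst s = 9 * M * averaging_cst s * h `^ (2 * s - 1) by ring.
Qed.

End LowRate.

(** * The error estimate *)

Section InterpolationNorm.
Context {R : realType} (T : R).
Implicit Types (v : (R -> R) * (R -> R)).

Definition K_integral v : \bar R :=
  (\int[mu]_(t in `]0%R, +oo[) ((t `^ (- 2))%:E * K_sq T t v))%E.

Lemma K_integral_ge0 v : (0 <= K_integral v)%E.
Proof. by apply: integral_ge0 => t _; rewrite mule_ge0 ?K_sq_ge0// lee_fin powR_ge0. Qed.

Lemma interp_normE v : interp_norm T 2^-1 v = sqrte ((2 / pi)%:E * K_integral v)%E.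
Proof.
have E : (\int[mu]_(tau in `]0%R, +oo[) ((tau `^ (- (2 * 2^-1) - 1))%:E * K_sq T tau v) =
    K_integral v)%E.
  by apply: eq_integral => t _; rewrite mulfV// -opprD.
by rewrite /interp_norm E sin_pihalf mulr1.
Qed.

Lemma interp_norm_le v (C h a : R) (X : \bar R) : 0 <= C -> 0 < h -> (0 <= X)%E ->
  (K_integral v <= (C * h `^ (2 * a))%:E * X)%E ->
  (interp_norm T 2^-1 v <= (Num.sqrt (2 / pi * C) * h `^ a)%:E * sqrte X)%E.
Proof.
move=> C0 h0 X0 H; have p0 : 0 <= 2 / pi :> R by rewrite divr_ge0 ?pi_ge0.
have -> : (Num.sqrt (2 / pi * C) * h `^ a)%:E = sqrte (2 / pi * C * h `^ (2 * a))%:E.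
  have e : Num.sqrt (2 / pi * C * h `^ (2 * a)) = Num.sqrt (2 / pi * C) * h `^ a.
    have -> : 2 * a = a * 2 by exact: mulrC.
    rewrite sqrtrM; last exact: mulr_ge0.
    rewrite powRrM powR_mulrn ?powR_ge0//; congr (_ * _).
    by rewrite sqrtr_sqr ger0_norm ?powR_ge0.
  by rewrite -e.
have q0 : 0 <= 2 / pi * C * h `^ (2 * a) by rewrite mulr_ge0 ?powR_ge0// mulr_ge0.
rewrite interp_normE -sqrteM ?lee_fin// lee_sqrt; last by rewrite mule_ge0.
by rewrite -mulrA (EFinM (2 / pi)) -muleA; apply: lee_wpmul2l.
Qed.

Lemma interp_norm_ge0 s v : (0 <= interp_norm T s v)%E.
Proof. exact: sqrte_ge0. Qed.

End InterpolationNorm.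

Lemma averaging_cst_gt0 {R : realType} (s : R) : 2^-1 < s -> 0 < averaging_cst s.
Proof.
move=> s1; have s0 : 0 < s by apply: lt_trans s1; rewrite invr_gt0.
rewrite /averaging_cst mulr_gt0// ltr_wpDr// mulr_ge0 ?invr_ge0 ?divr_ge0 ?sqr_ge0//.
  by rewrite mulr_ge0// ltW.
by rewrite !mulr_ge0 ?addr_ge0// ?mulr_ge0// ltW.
Qed.

Lemma exact_galerkin_approx {R : realType} (L : R) (n : nat)
    (m : seq R * seq R) (g z zh : (R -> R) * (R -> R)) : 0 < L ->
  is_mesh (n.+1%:R * L) m ->
  inL2S (n.+1%:R * L) g -> inL2S (n.+1%:R * L) z ->
  ae_eqS (n.+1%:R * L) (bie_op L z) g ->
  galerkin_solution (n.+1%:R * L) L m g zh -> galerkin_approx L n m z zh.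
Proof.
move=> L0 m_mesh [[mg1 _] [mg2 _]] z2 [e1 e2] [zhS zg]; split => // vh vS.
have [[mz1 _] [mz2 _]] := inL2S_bie L0 z2.
have [[mv1 _] [mv2 _]] := S10_inL2S m_mesh vS.
rewrite zg//; congr (_ + _); rewrite /Rintegral; congr fine.
  apply: ae_eq_integral => //; try by apply/measurable_EFinP; exact: measurable_funM.
  by apply: filterS e1 => x + xT => ->.
apply: ae_eq_integral => //; try by apply/measurable_EFinP; exact: measurable_funM.
by apply: filterS e2 => x + xT => ->.
Qed.

Lemma l2normsq_le_hs {R : realType} (T s : R) f : (l2normsq T f <= hs_normsq T s f)%E.
Proof.
rewrite /hs_normsq big_ord_recl/= -addeA -[leLHS]adde0; apply: leeD => //.
apply: adde_ge0; first by apply: sume_ge0 => k _; rewrite l2normsqE; exact: sqint_ge0.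
by case: ifP => // _; exact: slobodeckij_sq_ge0.
Qed.

Lemma interp_norm_lty {R : realType} (T s : R) v : 0 < s < 1 ->
  (interp_norm T s v < +oo)%E ->
  (\int[mu]_(t in `]0%R, +oo[) ((t `^ (- (2 * s) - 1))%:E * K_sq T t v) < +oo)%E.
Proof.
move=> /andP[s0 s1]; rewrite /interp_norm; set J := (\int[_]_(t in _) _)%E.
have p0 := pi_gt0 R.
have k0 : 0 < 2 * sin (pi * s) / pi.
  rewrite divr_gt0// mulr_gt0// sin_gt0_pi// mulr_gt0//=.
  by rewrite gtr_pMr.
by clearbody J; case: J => [r| |]//; rewrite ?ltry// gt0_muley.
Qed.

Section Rates.
Context {R : realType} (L : R) (n : nat).
Hypothesis L_gt0 : 0 < L.
Let T := n.+1%:R * L.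
Let T_gt0 : 0 < T := final_time_gt0 n L_gt0.
Variables (m : seq R * seq R) (c : R).
Hypothesis m_mesh : is_mesh T m.
Hypothesis m_slices : time_slice_matching L n.+1 m.
Hypothesis m_adm : S10_admissible T c m.
Let h := meshwidth m.
Let h_gt0 : 0 < h := meshwidth_gt0 T_gt0 m_mesh.

(** Stability in the interpolation norm, from the infimum over w in
    [K_sq_galerkin_error]. *)
Lemma galerkin_K_integral_le z zh : inL2S T z -> galerkin_approx L n m z zh ->
  (K_integral T (z - zh)%R <= (error_cst n c)%:E * K_integral T z)%E.
Proof.
move=> z2 zg; have M0 := error_cst_gt0 n c.
have M0E : (0 <= (error_cst n c)%:E)%E by rewrite lee_fin ltW.
rewrite /K_integral -ge0_integralZl//; last 2 first.
- by apply: emeasurable_funM; [exact: measurable_powRN|exact: measurable_K_sq].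
- by move=> t _; rewrite mule_ge0 ?K_sq_ge0// lee_fin powR_ge0.
apply: ge0_le_integral_nonmeas => t _; first by rewrite mule_ge0 ?K_sq_ge0// lee_fin powR_ge0.
rewrite muleCA; apply: lee_wpmul2l; first by rewrite lee_fin powR_ge0.
rewrite -lee_pdivrMl//; apply: le_ereal_inf_tmp => _ [w wH <-].
rewrite lee_pdivrMl//.
have wu := inH10S_is_primS T_gt0 wH.
by rewrite (is_primS_h10_normsqS T_gt0 wu); exact: (K_sq_galerkin_error L_gt0 m_mesh m_slices m_adm t z2 zg wu).
Qed.

End Rates.

(* At s = 1/2 no constant independent of z exists for the norm of
   H^{1/2}(Sigma), which is strictly weaker than that of H^{1/2}_{0,}(Sigma);
   hence the two forms of the estimate. *)
Theorem corollary5p2 (R : realType) (L : R) (n : nat) (I : Type)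
    (Sigma_h : I -> seq R * seq R) (s : R) :
  0 < L -> (0 < n)%N ->
  let T := n%:R * L in
  (forall i, is_mesh T (Sigma_h i)) ->
  (exists c_s1 : R, forall i, S10_admissible T c_s1 (Sigma_h i)) ->
  (forall i, time_slice_matching L n (Sigma_h i)) ->
  2^-1 <= s <= 2 ->
  (exists2 c : R, 0 < c &
    forall g z, exact_solution T L s g z ->
    forall i zh, galerkin_solution T L (Sigma_h i) g zh ->
    (interp_norm T 2^-1 (z - zh)%R <=
     (c * meshwidth (Sigma_h i) `^ (s - 2^-1))%:E *
     (if (s == 2^-1)%R then interp_norm T 2^-1 z else hs_normS T s z))%E) /\
  (forall g z, exact_solution T L s g z ->
    exists2 c : R, 0 < c &
    forall i zh, galerkin_solution T L (Sigma_h i) g zh ->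
    (interp_norm T 2^-1 (z - zh)%R <=
     (c * meshwidth (Sigma_h i) `^ (s - 2^-1))%:E * hs_normS T s z)%E).
Proof.
move=> L_gt0; case: n => // n _ T m_mesh [c m_adm] m_slices /andP[s1 s2].
have T_gt0 : 0 < T := final_time_gt0 n L_gt0.
have M0 := error_cst_gt0 n c.
have p0 : 0 < 2 / pi :> R by rewrite divr_gt0 ?pi_gt0.
have gL2 g z : exact_solution T L s g z -> inL2S T g.
  by case=> + _ _; rewrite /inHs0S ifT; [case|lra].
have zL2 g z : exact_solution T L s g z -> inL2S T z.
  case=> _ + _; rewrite /inHs0S; case: ifP => _ [] //.
  by move=> _ /(inH10S_is_primS T_gt0); exact: is_primS_inL2S.
have approx g z i zh : exact_solution T L s g z ->
    galerkin_solution T L (Sigma_h i) g zh -> galerkin_approx L n (Sigma_h i) z zh.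
  move=> zE zg; have [_ _ e] := zE.
  exact: exact_galerkin_approx L_gt0 (m_mesh i) (gL2 _ _ zE) (zL2 _ _ zE) e zg.
have h0 i := meshwidth_gt0 T_gt0 (m_mesh i).
have [s_half|s_neq] := eqVneq s 2^-1.
  have sM0 : 0 < Num.sqrt (error_cst n c) by rewrite sqrtr_gt0.
  have stable g z i zh : exact_solution T L s g z ->
      galerkin_solution T L (Sigma_h i) g zh ->
      (interp_norm T 2^-1 (z - zh)%R <=
       (Num.sqrt (error_cst n c))%:E * interp_norm T 2^-1 z)%E.
    move=> zE zg; rewrite !interp_normE -[(Num.sqrt _)%:E]/(sqrte (error_cst n c)%:E).
    have M0E : (0 <= (error_cst n c)%:E)%E by rewrite lee_fin ltW.
    have p0E : (0 <= (2 / pi : R)%:E)%E by rewrite lee_fin ltW.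
    have K0 := K_integral_ge0 T z.
    rewrite -sqrteM// lee_sqrt; last by rewrite !mule_ge0.
    rewrite muleCA; apply: lee_wpmul2l => //.
    exact: (galerkin_K_integral_le L_gt0 (m_mesh i) (m_slices i) (m_adm i)
      (zL2 _ _ zE) (approx _ _ _ _ zE zg)).
  split.
    exists (Num.sqrt (error_cst n c)) => // g z zE i zh zg.
    by rewrite s_half subrr powRr0 mulr1; exact: stable zE zg.
  move=> g z zE; have [_ zs _] := zE.
  have yfin : (interp_norm T 2^-1 z < +oo)%E.
    move: zs; rewrite /inHs0S ifT; last by lra.
    by rewrite s_half => -[].
  have y0 := interp_norm_ge0 T 2^-1 z.
  (* The constant is the ratio of the two norms of z, unless one is degenerate. *)
  case X : (hs_normS T s z) => [r| |].
  - have r0 : 0 <= r by rewrite -lee_fin -X; exact: sqrte_ge0.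
    move: r0; rewrite le_eqVlt => /predU1P[r0|r0].
      have K0 : K_integral T z = 0%E.
        have S0 : (0 <= hs_normsq T s z.1 + hs_normsq T s z.2)%E.
          by apply: adde_ge0; exact: hs_normsq_ge0.
        have l0 : (l2normsqS T z <= 0)%E.
          have -> : 0%E = (hs_normsq T s z.1 + hs_normsq T s z.2)%E.
            by rewrite -(sqr_sqrte S0) -/(hs_normS T s z) X -r0 expe2 mule0.
          by apply: leeD; exact: l2normsq_le_hs.
        apply: integral0_eq => t _; rewrite [K_sq _ _ _](_ : _ = 0%E) ?mule0//.
        apply/le_anti; rewrite K_sq_ge0 andbT.
        exact: le_trans (K_sq_le_l2normsqS _ _ _) l0.
      exists 1 => // i zh zg; apply: le_trans (stable _ _ _ _ zE zg) _.
      by rewrite interp_normE K0 mule0 sqrte0 mule0 mule_ge0// lee_fin ?mulr_ge0 ?powR_ge0// -r0.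
    have yf : interp_norm T 2^-1 z \is a fin_num by rewrite ge0_fin_numE.
    have f0 : 0 <= fine (interp_norm T 2^-1 z) by exact: fine_ge0.
    exists (Num.sqrt (error_cst n c) * fine (interp_norm T 2^-1 z) / r + 1).
      by rewrite ltr_wpDl// divr_ge0 ?mulr_ge0// ltW.
    move=> i zh zg; apply: le_trans (stable _ _ _ _ zE zg) _.
    rewrite s_half subrr powRr0 mulr1 -(fineK yf) -!EFinM lee_fin /=.
    by rewrite mulrDl mul1r divfK ?gt_eqF// lerDl ltW.
  - by exists 1 => // i zh zg; rewrite gt0_muley ?leey// lte_fin mul1r powR_gt0.
  - by have := sqrte_ge0 (hs_normsq T s z.1 + hs_normsq T s z.2)%E; rewrite -/(hs_normS T s z) X.
suff [C C0 H] : exists2 C : R, 0 < C & forall g z, exact_solution T L s g z ->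
    forall i zh, galerkin_solution T L (Sigma_h i) g zh ->
    (K_integral T (z - zh)%R <= (C * meshwidth (Sigma_h i) `^ (2 * (s - 2^-1)))%:E *
       (hs_normsq T s z.1 + hs_normsq T s z.2))%E.
  have c0 : 0 < Num.sqrt (2 / pi * C) by rewrite sqrtr_gt0 mulr_gt0.
  have est g z : exact_solution T L s g z ->
      forall i zh, galerkin_solution T L (Sigma_h i) g zh ->
      (interp_norm T 2^-1 (z - zh)%R <=
       (Num.sqrt (2 / pi * C) * meshwidth (Sigma_h i) `^ (s - 2^-1))%:E * hs_normS T s z)%E.
    move=> zE i zh zg; apply: interp_norm_le => //; first exact: ltW.
      by apply: adde_ge0; exact: hs_normsq_ge0.
    exact: H zE i zh zg.
  by split => [|g z zE]; exists (Num.sqrt (2 / pi * C)) => //; exact: est.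
have s_gt : 2^-1 < s by rewrite lt_neqAle eq_sym s_neq.
have -> : 2 * (s - 2^-1) = 2 * s - 1 by rewrite mulrBr mulfV//; lra.
have [s_lt1|s_ge1] := ltP s 1.
  exists (9 * error_cst n c * averaging_cst s); first by apply: mulr_gt0; [exact: mulr_gt0|exact: averaging_cst_gt0].
  move=> g z zE i zh zg; have [_ zs _] := zE.
  move: zs; rewrite /inHs0S s_lt1 => -[z2 zfin].
  apply: (galerkin_rate_lt1 L_gt0 (m_mesh i) (m_slices i) (m_adm i)) => //.
  - by rewrite s_gt.
  - by apply: interp_norm_lty zfin; rewrite s_lt1 andbT; lra.
  - exact: approx zE zg.
exists (4 * error_cst n c); first by rewrite mulr_gt0.
move=> g z zE i zh zg; have [_ zs _] := zE.
move: zs; rewrite /inHs0S ltNge s_ge1/= => -[zs z0].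
apply: (galerkin_rate_ge1 L_gt0 (m_mesh i) (m_slices i) (m_adm i)) => //.
- by rewrite s_ge1.
- exact: approx zE zg.
Qed.
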